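(* Let $(M,\omega)$ be a symplectic $G$-space, $*$ a $G$-invariant star product of Fedosov type on $M$ with Fedosov connection $D$ and quantization map $Q$, and $\Phi_*$ a quantum moment map for $*$ with classical part $\Phi_0$. Let $\xi=\xi_0+\xi_1\lambda+\cdots\in\mathfrak g_\lambda$. Then the series $$\sum_{k=0}^\infty\frac1{k!}\,Q(\Phi_*(\xi))^{\circ k}$$ converges $\lambda$-formally absolutely and uniformly on any compact subset of $M$, and defines an element of $W_D$ (a smooth flat section of the Weyl bundle). Moreover, $$\sum_{k=0}^\infty\frac1{k!}\,Q(\Phi_*(\xi))^{\circ k}=e^{\Phi_0(\xi_0)}\sum_{I,j}p_{I,j}\bigl(\Phi_*(\xi),\partial\Phi_*(\xi),\cdots\bigr)\,y^I\lambda^j,$$ where the $p_{I,j}$ are polynomials in $\{\Phi_*(\xi),\partial\Phi_*(\xi),\cdots\}$.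
   Context: Setting. $G$ is a Lie group with finite-dimensional real Lie algebra $\mathfrak g$, acting on $(M,\omega)$ by symplectomorphisms. $C^\infty(\cdot)$ means complex-valued smooth functions; $\lambda$ is a formal parameter. A star product on $M$ is an associative $\mathbb C[[\lambda]]$-bilinear product on $C^\infty(M)[[\lambda]]$ of the form $u*v=uv+\sum_{n\ge1}(\lambda/2)^nC_n(u,v)$, $C_n$ bidifferential operators annihilating constants, $C_1(u,v)-C_1(v,u)=2\{u,v\}$; it is $G$-invariant if $g(u*v)=gu*gv$, $(gu)(x)=u(g^{-1}x)$. Write $[a,b]_*=a*b-b*a$. $\mathfrak g_\lambda=\mathfrak g[[\lambda]]$ has the $\lambda$-bilinear bracket with $[\xi,\eta]_\lambda=\lambda[\xi,\eta]$ for $\xi,\eta\in\mathfrak g$. A quantum moment map for $*$ is a ($\mathbb C[[\lambda]]$-linear) homomorphism of associative algebras $\Phi_*:\mathfrak U(\mathfrak g_\lambda)\to(C^\infty(M)[[\lambda]],* )$ ($\mathfrak U$ the universal enveloping algebra) with $[\Phi_*(\xi),u]_*=\lambda\,\xi u$ for $\xi\in\mathfrak g$ ($\xi u$ the infinitesimal action). For $\xi\in\mathfrak g$ one has $\Phi_*(\xi)=\Phi_0(\xi)+O(\lambda)$ with $\Phi_0$ the corresponding classical moment map. Fedosov type. The formal Weyl algebra $W_x$ ($x\in M$) consists of formal series $\sum\lambda^ka_{k,J}y^J$, $y$ linear coordinates on $T_xM$, with product $a\circ b=\sum_k(\lambda/2)^k\frac1{k!}\omega^{i_1j_1}\cdots\omega^{i_kj_k}\partial_{y^{i_1}}\cdots\partial_{y^{i_k}}a\;\partial_{y^{j_1}}\cdots\partial_{y^{j_k}}b$,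 filtered by $\deg y^j=1$, $\deg\lambda=2$; $\Gamma W$ denotes smooth sections of the resulting bundle $W\to M$; $a^{\circ k}$ is the $k$-th power for $\circ$. Given a torsion-free symplectic connection with induced covariant derivative $\partial$ on $\Gamma W$, a Fedosov connection is $Da=-\delta a+\partial a-\frac1\lambda[\gamma,a]$, $\delta a=dx^k\wedge\partial a/\partial y^k$, $\gamma\in\Gamma W\otimes\Lambda^1$, $\deg\gamma\ge3$, which is Abelian (its Weyl curvature is a scalar 2-form, so $D^2=0$). Let $W_D=\{a\in\Gamma W:Da=0\}$. The map $\sigma:W_D\to C^\infty(M)[[\lambda]]$, $\sigma(a)=a|_{y=0}$, is bijective with inverse $Q$. A star product is of Fedosov type if $a*b=\sigma(Q(a)\circ Q(b))$ for such a $D$. Conventions. A series in $\Gamma W$ converges $\lambda$-formally absolutely and uniformly on a compact set if, for every multi-index $I$ and $j\ge0$, the series of coefficients of $y^I\lambda^j$ converges absolutely and uniformly there. ''Polynomial in $\{\Phi_*(\xi),\partial\Phi_*(\xi),\dots\}$'' means, in local coordinates on $M$, a polynomial in the $\lambda$-coefficients of $\Phi_*(\xi)$ and finitely many of their partial derivatives, with coefficients smooth functions on $M$ that depend on the Fedosov data but not on $\xi$. *)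

(* Defs.v *)
From HB Require Import structures.
From mathcomp Require Import all_boot all_order all_algebra.
From mathcomp Require Import all_classical all_reals all_analysis.
From mathcomp Require Import complex generic_quotient.

Set Implicit Arguments.
Unset Strict Implicit.
Unset Printing Implicit Defensive.
Import Order.TTheory GRing.Theory Num.Theory numFieldNormedType.Exports.

Local Open Scope classical_set_scope.
Local Open Scope ring_scope.
Local Open Scope complex_scope.
Local Open Scope quotient_scope.

Section Euclidean.
Variables (R : realType) (n : nat).

Definition pd (i : 'I_n) (f : 'rV[R]_n -> R) : 'rV[R]_n -> R :=
  fun z => 'D_(delta_mx 0 i) f z.

(* f is C^infinity on the open set O: all iterated partial derivatives of f
   exist and are continuous at every point of O. *)
Definition smooth_on (O : set 'rV[R]_n) (f : 'rV[R]_n -> R) : Prop :=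
  forall (s : seq 'I_n) z, O z ->
    {for z, continuous (foldr pd f s)} /\
    forall i, derivable (foldr pd f s) z (delta_mx 0 i).

End Euclidean.

(* [coord a] is only meaningful on [dom a], and [point a], its inverse, only on
   the open set [coord a @` dom a]. *)
Record manifold (R : realType) (n : nat) := Manifold {
  pts :> topologicalType;
  chart : Type;
  dom : chart -> set pts;
  coord : chart -> pts -> 'rV[R]_n;
  point : chart -> 'rV[R]_n -> pts;
  chart_at : pts -> chart;
  dom_chart_at : forall x, dom (chart_at x) x;
  dom_open : forall a, open (dom a);
  coord_dom_open : forall a, open (coord a @` dom a);
  coordK : forall a x, dom a x -> point a (coord a x) = x;
  coord_continuous : forall a x, dom a x -> {for x, continuous (coord a)};
  point_continuous : forall a z, (coord a @` dom a) z ->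
    {for z, continuous (point a)};
  transition_smooth : forall a b (j : 'I_n),
    smooth_on (coord a @` (dom a `&` dom b))
      (fun z => coord b (point a z) 0 j);
  manifold_hausdorff : hausdorff_space pts;
  manifold_second_countable : @second_countable pts
}.

Section SmoothMaps.
Variables (R : realType) (n1 n2 n3 : nat).
Variables (A : manifold R n1) (B : manifold R n2) (D : manifold R n3).

Definition smooth_map (f : A -> B) : Prop :=
  continuous f /\
  forall (a : chart A) (b : chart B) (j : 'I_n2),
    smooth_on (coord a @` [set x | dom a x /\ dom b (f x)])
      (fun z => coord b (f (point a z)) 0 j).

Definition smooth_map2 (f : A -> B -> D) : Prop :=
  continuous (fun p : A * B => f p.1 p.2) /\
  forall (a : chart A) (b : chart B) (c : chart D) (j : 'I_n3),
    smooth_on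
      [set z | exists x y, [/\ dom a x, dom b y, dom c (f x y) &
                               z = row_mx (coord a x) (coord b y)]]
      (fun z => coord c (f (point a (lsubmx z)) (point b (rsubmx z))) 0 j).

(* Entry (i, j) is the i-th partial derivative of the j-th component. *)
Definition jac (a : chart A) (b : chart B) (f : A -> B) (x : A)
    : 'M[R]_(n1, n2) :=
  \matrix_(i, j) pd i (fun z => coord b (f (point a z)) 0 j) (coord a x).

End SmoothMaps.

Section Functions.
Variables (R : realType) (n : nat) (M : manifold R n).
Local Notation C := R[i].

Definition rsmooth (a : chart M) (f : M -> R) : Prop :=
  smooth_on (coord a @` dom a) (f \o point a).

Definition rpd (a : chart M) (i : 'I_n) (f : M -> R) : M -> R :=
  fun x => pd i (f \o point a) (coord a x).

Definition csmooth (a : chart M) (f : M -> C) : Prop :=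
  rsmooth a (fun x => complex.Re (f x)) /\ rsmooth a (fun x => complex.Im (f x)).

Definition cpd (a : chart M) (i : 'I_n) (f : M -> C) : M -> C :=
  fun x => rpd a i (fun y => complex.Re (f y)) x
           +i* rpd a i (fun y => complex.Im (f y)) x.

Definition smooth_fun (f : M -> C) : Prop := forall a, csmooth a f.

Definition mi : Type := {ffun 'I_n -> nat}.

Definition cpdm (a : chart M) (J : mi) (f : M -> C) : M -> C :=
  foldr (cpd a) f (flatten [seq nseq (J i) i | i <- enum 'I_n]).

(* C^infinity(M)[[lambda]] consists of the u : fseries with smooth_series u;
   u k is the coefficient of lambda^k. *)
Definition fseries : Type := nat -> M -> C.
Definition smooth_series (u : fseries) : Prop := forall k, smooth_fun (u k).

End Functions.

Section Symplectic.
Variables (R : realType) (n : nat) (M : manifold R n).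
Local Notation trans a b x := (jac a b (@id M) x).

(* omega a x is the matrix (omega_ij) of the form at x in the chart a. *)
Record symplectic_form := SymplecticForm {
  omega :> chart M -> M -> 'M[R]_n;
  omega_smooth : forall a i j, rsmooth a (fun x => omega a x i j);
  omega_trans : forall a b x, dom a x -> dom b x ->
    omega a x = trans a b x *m omega b x *m (trans a b x)^T;
  omega_skew : forall a x, dom a x -> (omega a x)^T = - omega a x;
  omega_nondeg : forall a x, dom a x -> omega a x \in unitmx;
  omega_closed : forall a x i j k, dom a x ->
    rpd a i (fun y => omega a y j k) x + rpd a j (fun y => omega a y k i) x
    + rpd a k (fun y => omega a y i j) x = 0
}.

(* The matrix (omega^ij): the inverse of (omega_ij). *)
Definition poisson (w : symplectic_form) (a : chart M) (x : M) : 'M[R]_n :=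
  invmx (w a x).

Definition bracket (w : symplectic_form) (a : chart M) (u v : M -> R[i])
    (x : M) : R[i] :=
  \sum_i \sum_j (poisson w a x i j)%:C * cpd a i u x * cpd a j v x.

(* chr a x k i j is the Christoffel symbol Gamma^k_ij:
   nabla_i d_j = Gamma^k_ij d_k. *)
Record symplectic_connection (w : symplectic_form) := SymplecticConnection {
  chr :> chart M -> M -> 'I_n -> 'I_n -> 'I_n -> R;
  chr_smooth : forall a k i j, rsmooth a (fun x => chr a x k i j);
  chr_trans : forall a b x i j (l : 'I_n), dom a x -> dom b x ->
    \sum_k chr a x k i j * trans a b x k l =
    rpd a i (fun y => trans a b y j l) x
    + \sum_p \sum_q trans a b x i p * trans a b x j q * chr b x l p q;
  chr_torsion_free : forall a x k i j, dom a x -> chr a x k i j = chr a x k j i;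
  chr_symplectic : forall a x i j k, dom a x ->
    rpd a i (fun y => w a y j k) x
    = \sum_l (chr a x l i j * w a x l k + chr a x l i k * w a x j l)
}.

(* curvature a x k l i j = R^k_lij:
   (nabla_i nabla_j - nabla_j nabla_i) d_l = R^k_lij d_k. *)
Definition curvature (w : symplectic_form) (G : symplectic_connection w)
    (a : chart M) (x : M) (k l i j : 'I_n) : R :=
  rpd a i (fun y => G a y k j l) x - rpd a j (fun y => G a y k i l) x
  + \sum_m (G a x k i m * G a x m j l - G a x k j m * G a x m i l).

End Symplectic.

Section WeylFibre.
Variables (R : realType) (n : nat).
Local Notation C := R[i].
Local Notation mi := (mi n).

Definition mi0 : mi := [ffun=> 0%N].
Definition midx (i : 'I_n) : mi := [ffun j => (j == i) : nat].
Definition misize (J : mi) : nat := (\sum_i J i)%N.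
Definition miadd (I J : mi) : mi := [ffun i => (I i + J i)%N].
Definition misub (I J : mi) : mi := [ffun i => (I i - J i)%N].

Definition yseries : Type := mi -> C.

Definition ymul (f g : yseries) : yseries := fun J =>
  \sum_(I : {ffun 'I_n -> 'I_(misize J).+1} | [forall i, (I i <= J i)%N])
     f [ffun i => I i : nat] * g (misub J [ffun i => I i : nat]).

Definition yder (i : 'I_n) (f : yseries) : yseries := fun J =>
  (J i).+1%:R * f (miadd J (midx i)).

(* a k J is the coefficient of lambda^k y^J. *)
Definition weyl : Type := nat -> yseries.

(* a o b for the bivector P = (omega^ij). *)
Definition circ (P : 'M[R]_n) (a b : weyl) : weyl := fun k J =>
  \sum_(r < k.+1) \sum_(p < (k - r).+1) ((2 ^ r * r`!)%:R)^-1 *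
    \sum_(s : r.-tuple 'I_n) \sum_(t : r.-tuple 'I_n)
      (\prod_(l < r) (P (tnth s l) (tnth t l))%:C) *
      ymul (foldr yder (a p) s) (foldr yder (b (k - r - p)%N) t) J.

Definition wone : weyl := fun k J => ((k == 0%N) && (J == mi0))%:R.

Definition wpow (P : 'M[R]_n) (a : weyl) (m : nat) : weyl :=
  iter m (circ P a) wone.

(* (1/lambda)[a, b]; the lambda^0 term of [a, b] vanishes. *)
Definition wcomm (P : 'M[R]_n) (a b : weyl) : weyl := fun k J =>
  circ P a b k.+1 J - circ P b a k.+1 J.

(* The value at y = v of the homogeneous part of degree m in y of the
   coefficient of lambda^k. *)
Definition heval (a : weyl) (k m : nat) (v : 'rV[R]_n) : C :=
  \sum_(I : {ffun 'I_n -> 'I_m.+1} | (\sum_i (I i : nat))%N == m)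
     a k [ffun i => I i : nat] * (\prod_i v 0 i ^+ I i)%:C.

End WeylFibre.
Arguments wone {R n}.

Section WeylBundle.
Variables (R : realType) (n : nat) (M : manifold R n).
Local Notation C := R[i].
Local Notation trans a b x := (jac a b (@id M) x).

(* s a x is the value at x of the section s, in the linear coordinates y on
   T_xM induced by the chart a; only the values at x in dom a matter. *)
Definition wfield : Type := chart M -> M -> weyl R n.

(* s a x i is the dx^i-component of the W-valued one-form s. *)
Definition wform : Type := chart M -> M -> 'I_n -> weyl R n.

Definition wsection (s : wfield) : Prop :=
  (forall a k J, csmooth a (fun x => s a x k J)) /\
  (forall a b x, dom a x -> dom b x -> forall k m v,
     heval (s a x) k m v = heval (s b x) k m (v *m trans a b x)).

Definition wsection1 (s : wform) : Prop :=
  (forall a i k J, csmooth a (fun x => s a x i k J)) /\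
  (forall a b x, dom a x -> dom b x -> forall i k m v,
     heval (s a x i) k m v =
     \sum_j (trans a b x i j)%:C * heval (s b x j) k m (v *m trans a b x)).

Variable w : symplectic_form M.

Definition scirc (s t : wfield) : wfield := fun a x =>
  circ (poisson w a x) (s a x) (t a x).

Definition spow (s : wfield) (m : nat) : wfield := fun a x =>
  wpow (poisson w a x) (s a x) m.

Variable G : symplectic_connection w.

(* The dx^i-component of the covariant derivative:
   d/dx^i - Gamma^k_ij y^j d/dy^k. *)
Definition covder (a : chart M) (i : 'I_n) (s : M -> weyl R n)
    : M -> weyl R n := fun x k J =>
  cpd a i (fun z => s z k J) x
  - \sum_j \sum_l (G a x l i j)%:C *
      (if J j is 0%N then 0 else yder l (s x k) (misub J (midx j))).

(* Since (1/lambda)[omega_ij y^j, b] = db/dy^i, one has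
   -delta - (1/lambda)[gamma, .] = -(1/lambda)[theta, .] for
   theta_i = omega_ij y^j + gamma_i. *)
Definition theta (gam : wform) (a : chart M) (i : 'I_n) (x : M) : weyl R n :=
  fun k J =>
  \sum_j (w a x i j)%:C * ((k == 0%N) && (J == midx j))%:R + gam a x i k J.

(* The quadratic form (1/2) omega_kp R^k_qij y^p y^q; its inner derivation
   represents the curvature: on sections the (i, j)-component of the square of
   the covariant derivative is -(1/lambda)[curvature_form_ij, .]. *)
Definition curvature_form (a : chart M) (i j : 'I_n) (x : M) : weyl R n :=
  fun k J =>
  \sum_p \sum_q ((2^-1 * \sum_l w a x l p * curvature G a x l q i j)%:C) *
    ((k == 0%N) && (J == miadd (midx p) (midx q)))%:R.

(* The (i, j)-component of the Weyl curvature
   curvature_form + d theta - (1/lambda) theta o theta (d the covariant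
   exterior derivative), for which D^2 = -(1/lambda)[weyl_curvature, .]. *)
Definition weyl_curvature (gam : wform) (a : chart M) (i j : 'I_n) (x : M)
    : weyl R n := fun k J =>
  curvature_form a i j x k J
  + covder a i (theta gam a j) x k J - covder a j (theta gam a i) x k J
  - wcomm (poisson w a x) (theta gam a i x) (theta gam a j x) k J.

Record fedosov := Fedosov {
  gam : wform;
  gam_section : wsection1 gam;
  gam_deg : forall a x i k J, dom a x -> (2 * k + misize J < 3)%N ->
    gam a x i k J = 0;
  gam_abelian : forall a x i j k J, dom a x -> J != @mi0 n ->
    weyl_curvature gam a i j x k J = 0
}.

Definition fedD (F : fedosov) (s : wfield) (a : chart M) (x : M) (i : 'I_n)
    : weyl R n := fun k J =>
  - yder i (s a x k) J + covder a i (s a) x k J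
  - wcomm (poisson w a x) (gam F a x i) (s a x) k J.

(* Membership in W_D. *)
Definition flat (F : fedosov) (s : wfield) : Prop :=
  wsection s /\ forall a x i k J, dom a x -> fedD F s a x i k J = 0.

(* The restriction to y = 0; any chart at x gives the same value. *)
Definition symbol (s : wfield) : fseries M := fun k x =>
  s (chart_at x) x k (@mi0 n).

Definition is_quantization_map (F : fedosov) (Q : fseries M -> wfield) : Prop :=
  (forall u, smooth_series u -> flat F (Q u) /\ symbol (Q u) = u) /\
  (forall s, flat F s -> forall a x, dom a x -> Q (symbol s) a x = s a x).

End WeylBundle.

Section StarProducts.
Variables (R : realType) (n : nat) (M : manifold R n) (w : symplectic_form M).
Local Notation C := R[i].

Definition bidifferential (B : (M -> C) -> (M -> C) -> M -> C) : Prop :=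
  exists N : nat, forall a : chart M,
  exists c : {ffun 'I_n -> 'I_N} -> {ffun 'I_n -> 'I_N} -> M -> C,
    (forall I J, csmooth a (c I J)) /\
    (forall u v, smooth_fun u -> smooth_fun v -> forall x, dom a x ->
       B u v x = \sum_I \sum_J c I J x *
         cpdm a [ffun i => I i : nat] u x * cpdm a [ffun i => J i : nat] v x).

(* Cn r is the operator C_r, with C_0(u, v) = uv. *)
Definition star (Cn : nat -> (M -> C) -> (M -> C) -> M -> C)
    (u v : fseries M) : fseries M := fun k x =>
  \sum_(r < k.+1) \sum_(p < (k - r).+1)
    ((2 ^ r)%:R)^-1 * Cn r (u p) (v (k - r - p)%N) x.

Record is_star_product (Cn : nat -> (M -> C) -> (M -> C) -> M -> C) : Prop :=
  IsStarProduct {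
  star_C0 : forall u v x, Cn 0%N u v x = u x * v x;
  star_bidiff : forall r, bidifferential (Cn r);
  star_const : forall r c u x, (0 < r)%N -> smooth_fun u ->
    Cn r (fun=> c) u x = 0 /\ Cn r u (fun=> c) x = 0;
  star_C1 : forall u v a x, smooth_fun u -> smooth_fun v -> dom a x ->
    Cn 1%N u v x - Cn 1%N v u x = 2 * bracket w a u v x;
  star_assoc : forall u v t,
    smooth_series u -> smooth_series v -> smooth_series t ->
    star Cn (star Cn u v) t = star Cn u (star Cn v t)
}.

Definition fedosov_type (Cn : nat -> (M -> C) -> (M -> C) -> M -> C)
    (Q : fseries M -> wfield M) : Prop :=
  forall u v, smooth_series u -> smooth_series v ->
    star Cn u v = symbol (scirc w (Q u) (Q v)).

End StarProducts.

(* [chart1] is a chart at the identity; it identifies the Lie algebra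
   T_1 G with row vectors. *)
Record lieGroup (R : realType) (d : nat) := LieGroup {
  lie_mfd :> manifold R d;
  lmul : lie_mfd -> lie_mfd -> lie_mfd;
  linv : lie_mfd -> lie_mfd;
  lone : lie_mfd;
  lmulA : forall x y z, lmul x (lmul y z) = lmul (lmul x y) z;
  lmul1 : forall x, lmul lone x = x;
  lmulV : forall x, lmul (linv x) x = lone;
  lmul_smooth : smooth_map2 lmul;
  linv_smooth : smooth_map linv;
  chart1 : chart lie_mfd;
  dom_chart1 : dom chart1 lone
}.

Section LieAlgebra.
Variables (R : realType) (d : nat) (G : lieGroup R d).
Local Notation a := (chart1 G).
Local Notation e := (coord a (lone G)).

(* The j-th component, at the point with coordinates z, of the left-invariant
   vector field with value xi at the identity. *)
Definition left_field (xi z : 'rV[R]_d) (j : 'I_d) : R :=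
  'D_xi (fun y => coord a (lmul (point a z) (point a y)) 0 j) e.

(* The commutator of left-invariant vector fields, at the identity. *)
Definition lie_bracket (xi eta : 'rV[R]_d) : 'rV[R]_d :=
  \row_j ('D_xi (fun z => left_field eta z j) e
          - 'D_eta (fun z => left_field xi z j) e).

(* g[[lambda]] *)
Definition glam : Type := nat -> 'rV[R]_d.

Definition gconst (xi : 'rV[R]_d) : glam := fun k => if k is 0%N then xi else 0.
Definition gadd (xi eta : glam) : glam := fun k => xi k + eta k.
Definition gscale (c : nat -> R) (xi : glam) : glam := fun k =>
  \sum_(p < k.+1) c p *: xi (k - p)%N.
Definition gbracket (xi eta : glam) : glam := fun k =>
  if k is k'.+1 then \sum_(p < k'.+1) lie_bracket (xi p) (eta (k' - p)%N)
  else 0.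

(* C[[lambda]] *)
Definition scal : Type := nat -> R[i].
Definition sconst (c : R[i]) : scal := fun k => if k is 0%N then c else 0.
Definition sadd (b c : scal) : scal := fun k => b k + c k.
Definition smul (b c : scal) : scal := fun k =>
  \sum_(p < k.+1) b p * c (k - p)%N.

(* The universal enveloping algebra of g_lambda over C[[lambda]], by generators
   and relations: unital algebra expressions in the elements of g_lambda modulo
   the least congruence containing the axioms of unital associative
   C[[lambda]]-algebras, the R[[lambda]]-linearity of the inclusion of g_lambda
   and the relations xi eta - eta xi = [xi, eta]_lambda.  [UScal c] stands for
   c.1; opposites are multiples by -1. *)
Inductive uterm : Type :=
| UGen of glam
| UScal of scal
| UAdd of uterm & uterm
| UMul of uterm & uterm.

Inductive ueq : uterm -> uterm -> Prop :=
| UE_refl t : ueq t t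
| UE_sym s t : ueq s t -> ueq t s
| UE_trans s t u : ueq s t -> ueq t u -> ueq s u
| UE_add s s' t t' : ueq s s' -> ueq t t' -> ueq (UAdd s t) (UAdd s' t')
| UE_mul s s' t t' : ueq s s' -> ueq t t' -> ueq (UMul s t) (UMul s' t')
| UE_addC s t : ueq (UAdd s t) (UAdd t s)
| UE_addA s t u : ueq (UAdd s (UAdd t u)) (UAdd (UAdd s t) u)
| UE_add0 t : ueq (UAdd (UScal (sconst 0)) t) t
| UE_mulA s t u : ueq (UMul s (UMul t u)) (UMul (UMul s t) u)
| UE_mulDl s t u : ueq (UMul (UAdd s t) u) (UAdd (UMul s u) (UMul t u))
| UE_mulDr s t u : ueq (UMul s (UAdd t u)) (UAdd (UMul s t) (UMul s u))
| UE_mul1 t : ueq (UMul (UScal (sconst 1)) t) t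
| UE_mul0 t : ueq (UMul (UScal (sconst 0)) t) (UScal (sconst 0))
| UE_scalC c t : ueq (UMul (UScal c) t) (UMul t (UScal c))
| UE_scalD b c : ueq (UScal (sadd b c)) (UAdd (UScal b) (UScal c))
| UE_scalM b c : ueq (UScal (smul b c)) (UMul (UScal b) (UScal c))
| UE_genD xi eta : ueq (UGen (gadd xi eta)) (UAdd (UGen xi) (UGen eta))
| UE_genZ (c : nat -> R) xi :
    ueq (UGen (gscale c xi)) (UMul (UScal (fun k => (c k)%:C)) (UGen xi))
| UE_genL xi eta :
    ueq (UMul (UGen xi) (UGen eta))
        (UAdd (UMul (UGen eta) (UGen xi)) (UGen (gbracket xi eta))).

HB.instance Definition _ := gen_eqMixin uterm.
HB.instance Definition _ := gen_choiceMixin uterm.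

Definition ueqb (s t : uterm) : bool := `[< ueq s t >].

Lemma ueqb_refl : reflexive ueqb.
Proof. by move=> t; apply/asboolP; apply: UE_refl. Qed.

Lemma ueqb_sym : symmetric ueqb.
Proof. by move=> s t; apply/asboolP/asboolP; apply: UE_sym. Qed.

Lemma ueqb_trans : transitive ueqb.
Proof.
by move=> t s u /asboolP st /asboolP tu; apply/asboolP; apply: UE_trans st tu.
Qed.

Definition ueq_equiv : equiv_rel uterm :=
  EquivRel ueqb ueqb_refl ueqb_sym ueqb_trans.

Definition uea : Type := {eq_quot ueq_equiv}.
Definition ucls (t : uterm) : uea := \pi_({eq_quot ueq_equiv}) t.
Definition uinc (xi : glam) : uea := ucls (UGen xi).

End LieAlgebra.

Arguments UScal {R d} _.

Section Actions.
Variables (R : realType) (n d : nat) (M : manifold R n).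
Variables (w : symplectic_form M) (G : lieGroup R d).
Local Notation C := R[i].

Record is_symplectic_action (act : G -> M -> M) : Prop := IsSymplecticAction {
  act1 : forall x, act (lone G) x = x;
  actM : forall g h x, act (lmul g h) x = act g (act h x);
  act_smooth : smooth_map2 act;
  act_symplectic : forall g a b x, dom a x -> dom b (act g x) ->
    w a x = jac a b (act g) x *m w b (act g x) *m (jac a b (act g) x)^T
}.

Variable act : G -> M -> M.

(* (g u)(x) = u(g^-1 x) *)
Definition gact (g : G) (u : fseries M) : fseries M := fun k x =>
  u k (act (linv g) x).

(* xi u: the derivative of g |-> g u at the identity in the direction xi. *)
Definition infact (xi : 'rV[R]_d) (u : M -> C) (x : M) : C :=
  let f := fun z => u (act (linv (point (chart1 G) z)) x) in
  let e := coord (chart1 G) (lone G) in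
  'D_xi (fun z => complex.Re (f z)) e +i* 'D_xi (fun z => complex.Im (f z)) e.

Definition star_invariant (st : fseries M -> fseries M -> fseries M) : Prop :=
  forall g u v, smooth_series u -> smooth_series v ->
    gact g (st u v) = st (gact g u) (gact g v).

(* A homomorphism of unital C[[lambda]]-algebras
   uea G -> (C^infinity(M)[[lambda]], st) with
   [Phi xi, u] = lambda xi u for xi in the Lie algebra. *)
Record quantum_moment_map (st : fseries M -> fseries M -> fseries M)
    (Phi : uea G -> fseries M) : Prop := QuantumMomentMap {
  qmm_smooth : forall X, smooth_series (Phi X);
  qmm_scal : forall c, Phi (ucls G (UScal c)) = fun k _ => c k;
  qmm_add : forall s t, Phi (ucls G (UAdd s t)) =
    fun k x => Phi (ucls G s) k x + Phi (ucls G t) k x;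
  qmm_mul : forall s t, Phi (ucls G (UMul s t)) =
    st (Phi (ucls G s)) (Phi (ucls G t));
  qmm_comm : forall (xi : 'rV[R]_d) u, smooth_series u -> forall k x,
    st (Phi (uinc G (gconst xi))) u k x - st u (Phi (uinc G (gconst xi))) k x
    = if k is k'.+1 then infact xi (u k') x else 0
}.

End Actions.

Section Analysis.
Variables (R : realType) (n : nat) (M : manifold R n).
Local Notation C := R[i].

Definition cexp (z : C) : C :=
  (expR (complex.Re z) * cos (complex.Im z))
  +i* (expR (complex.Re z) * sin (complex.Im z)).

(* The series sum_m f m converges absolutely and uniformly on K, to S. *)
Definition abs_unif_cvg (K : set M) (f : nat -> M -> C) (S : M -> C) : Prop :=
  [/\ forall x, K x -> cvgn (series (fun m => ComplexField.Normc.normc (f m x))),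
      {uniform K, (fun N x => complex.Re (\sum_(m < N) f m x)) @ \oo -->
                  (fun x => complex.Re (S x))} &
      {uniform K, (fun N x => complex.Im (\sum_(m < N) f m x)) @ \oo -->
                  (fun x => complex.Im (S x))}].

(* Polynomials, with functions as coefficients, in the variables (m, J)
   standing for the J-th partial derivative of the coefficient of lambda^m:
   lists of monomials, a monomial being a coefficient and a list of variables. *)
Definition diffpoly : Type := seq ((M -> C) * seq (nat * mi n)).

Fixpoint diffpoly_smooth (a : chart M) (p : diffpoly) : Prop :=
  if p is t :: p' then csmooth a t.1 /\ diffpoly_smooth a p' else True.

Definition diffpoly_eval (a : chart M) (p : diffpoly) (u : fseries M) (x : M)
    : C :=
  \sum_(t <- p) t.1 x * \prod_(v <- t.2) cpdm a v.2 (u v.1) x.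

End Analysis.

(* Main.v *)
(** Write [a = Q u] and [a = u_0 + a'], where [u_0] is the central scalar part of
    [a].  In the filtration [deg y = 1], [deg lambda = 2] the series [a'] has
    degree at least 1, so [a'^m] has degree at least [m], and
      [sum_k a^k / k! = e^(u_0) sum_m a'^m / m!]
    where only finitely many [m] contribute to each coefficient.  The convergence
    is therefore that of the exponential series on bounded sets.  The flatness
    equation determines the coefficients of [Q u] recursively, by degree, as
    differential polynomials in [u].  Finally [D] is a derivation of the
    fibrewise product and [D a' = - d u_0], whence the partial sums satisfy
      [D (e^(u_0) sum_(m <= N) a'^m / m!) = e^(u_0) (d u_0) a'^N / N!],
    which vanishes in degrees below [N]. *)

Require Import Defs.
From HB Require Import structures.
From mathcomp Require Import all_boot all_order all_algebra.
From mathcomp Require Import all_classical all_reals all_analysis.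
From mathcomp Require Import complex zify ring.
Import Order.TTheory GRing.Theory Num.Theory numFieldNormedType.Exports.
Local Open Scope classical_set_scope.
Local Open Scope ring_scope.
Set Implicit Arguments.
Unset Strict Implicit.
Unset Printing Implicit Defensive.
Local Open Scope complex_scope.
(* The vector-space [coord] and the topological [point] shadow the chart maps. *)
Local Notation coord := Defs.coord.
Local Notation point := Defs.point.

(** * Multi-indices and formal power series *)

(** The number of powers of [a'] that matter grows with the degree, so no single partial sum is the
    exponential. Flatness is still accessible because [D] is local for the filtration: in a given
    degree it reads coefficients at most two degrees higher, the two coming from the division of the
    commutator by lambda, so one long partial sum settles each degree. The same division threatens
    the recursion for [Q u]; there [deg gamma >= 3] pays for it.

    Vanishing in low degree, smoothness in [x] and being a differential polynomial pass to products
    for one reason: a coefficient of [a o b] is a finite combination of products of coefficients of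
    the same total degree.

    Charts are compared through values of homogeneous parts in [y]. Up to factorials these are
    iterated directional derivatives at [y = 0], and in this form the Leibniz rule makes the product
    compatible with linear changes of coordinates.

    Smoothness is given by iterated partial derivatives, so their symmetry is drawn from the mean
    value theorem. Finally [xi - xi_0] is lambda times an element of [g_lambda], which brings in
    [Phi_0 xi_0]. *)

Lemma big_bij_on (A : nmodType) (S T : eqType) (s : seq S) (t : seq T)
    (P : pred S) (Q : pred T) (h : S -> T) (h' : T -> S) (F : S -> A) (H : T -> A) :
  uniq s -> uniq t ->
  (forall i, i \in s -> P i -> [/\ h i \in t, Q (h i), h' (h i) = i & F i = H (h i)]) ->
  (forall j, j \in t -> Q j -> [/\ h' j \in s, P (h' j) & h (h' j) = j]) ->
  \sum_(i <- s | P i) F i = \sum_(j <- t | Q j) H j.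
Proof.
move=> us ut hP hQ.
rewrite -[LHS]big_filter -[RHS]big_filter.
rewrite (perm_big (map h (seq.filter P s))) /=; last first.
  apply: uniq_perm; first by rewrite filter_uniq.
    rewrite map_inj_in_uniq ?filter_uniq // => i j.
    rewrite !mem_filter => /andP[Pi si] /andP[Pj sj] e.
    by have [_ _ <- _] := hP _ si Pi; rewrite e; have [_ _ -> _] := hP _ sj Pj.
  move=> j; apply/idP/mapP.
    rewrite mem_filter => /andP[Qj tj]; have [si Pi e] := hQ _ tj Qj.
    by exists (h' j); rewrite ?mem_filter ?si ?Pi.
  case=> i; rewrite mem_filter => /andP[Pi si] ->.
  by have [ti Qi _ _] := hP _ si Pi; rewrite mem_filter ti Qi.
rewrite big_map big_seq [RHS]big_seq; apply: eq_bigr => i.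
by rewrite mem_filter => /andP[Pi si]; have [_ _ _ ->] := hP _ si Pi.
Qed.

Section MultiIndices.
Variable n : nat.
Implicit Types (I J K : mi n) (i j : 'I_n).

Definition mle I J := [forall i, (I i <= J i)%N].

Definition mibox N : seq (mi n) :=
  [seq [ffun i => u i : nat] | u : {ffun 'I_n -> 'I_N}].

Lemma mibox_uniq N : uniq (mibox N).
Proof.
rewrite map_inj_uniq ?enum_uniq // => I J /ffunP e.
by apply/ffunP => i; apply/val_inj; have := e i; rewrite !ffunE.
Qed.

Lemma mem_mibox N J : (J \in mibox N) = [forall i, (J i < N)%N].
Proof.
apply/mapP/forallP => [[I _ ->] i|h]; first by rewrite ffunE.
exists [ffun i => Ordinal (h i)]; first by rewrite mem_enum.
by apply/ffunP => i; rewrite !ffunE.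
Qed.

Lemma leq_misize J i : (J i <= misize J)%N.
Proof. by rewrite /misize (bigD1 i) //= leq_addr. Qed.

Lemma misize_add I J : misize (miadd I J) = (misize I + misize J)%N.
Proof. by rewrite /misize -big_split /=; apply: eq_bigr => i _; rewrite ffunE. Qed.

Lemma misize_midx i : misize (midx i) = 1%N.
Proof.
rewrite /misize (bigD1 i) //= ffunE eqxx big1 // => j /negPf ji.
by rewrite ffunE ji.
Qed.

Lemma misize0 : misize (mi0 n) = 0%N.
Proof. by rewrite /misize big1 // => i _; rewrite ffunE. Qed.

Lemma misize_eq0 J : (misize J == 0%N) = (J == mi0 n).
Proof.
apply/idP/eqP => [/eqP h|->]; last by rewrite misize0.
apply/ffunP => i; rewrite ffunE; apply/eqP; rewrite -leqn0 -h.
exact: leq_misize.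
Qed.

Lemma miaddC I J : miadd I J = miadd J I.
Proof. by apply/ffunP => i; rewrite !ffunE addnC. Qed.

Lemma miaddA I J K : miadd I (miadd J K) = miadd (miadd I J) K.
Proof. by apply/ffunP => i; rewrite !ffunE addnA. Qed.

Lemma miaddK I J : misub (miadd J I) I = J.
Proof. by apply/ffunP => i; rewrite !ffunE addnK. Qed.

Lemma misubK I J : mle I J -> miadd (misub J I) I = J.
Proof.
by move=> /forallP h; apply/ffunP => i; rewrite !ffunE subnK //; apply: h.
Qed.

Lemma mle_midx i J : mle (midx i) J = (0 < J i)%N.
Proof.
apply/forallP/idP => [/(_ i)|h j]; first by rewrite ffunE eqxx.
by rewrite ffunE; case: eqP => [->|].
Qed.

Lemma misubKx i J : (0 < J i)%N -> miadd (misub J (midx i)) (midx i) = J.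
Proof. by rewrite -mle_midx; apply: misubK. Qed.

Lemma mi_neq0 J : J != mi0 n -> exists i, (0 < J i)%N.
Proof.
move=> J0; apply/existsP; apply: contraNT J0 => /existsPn h.
by apply/eqP/ffunP => i; rewrite ffunE; apply/eqP; rewrite -leqn0 leqNgt.
Qed.

End MultiIndices.

Section PowerSeries.
Variables (R : realType) (n : nat).
Local Notation C := R[i].
Local Notation ys := (yseries R n).
Implicit Types (f g h : ys) (i j : 'I_n) (I J K : mi n).

(** The index type of the sum in [ymul] depends on [misize J]; a box of free side [N] lets products
    at different multi-indices be summed over one common range. *)
Lemma ymul_box N f g J : (forall i, (J i < N)%N) ->
  ymul f g J = \sum_(I <- mibox n N | mle I J) f I * g (misub J I).
Proof.
move=> JN; have -> : ymul f g J =
    \sum_(I <- mibox n (misize J).+1 | mle I J) f I * g (misub J I).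
  rewrite /ymul /mibox big_image_cond /=; apply: eq_bigl => I.
  by apply: eq_forallb => i; rewrite ffunE.
apply: (@big_bij_on _ _ _ _ _ _ _ id id);
  rewrite ?mibox_uniq // => I _ IJ; split => //; rewrite ?mem_mibox;
  apply/forallP => i; move/forallP/(_ i): IJ => /leq_ltn_trans; apply => //.
  by rewrite ltnS leq_misize.
Qed.

Lemma yderE i f J : yder i f J = (J i).+1%:R * f (miadd J (midx i)).
Proof. by []. Qed.

Lemma ysD f g J : (f + g) J = f J + g J. Proof. by []. Qed.
Lemma ysZ (c : C) f J : (c *: f) J = c * f J. Proof. by []. Qed.

Lemma yder_is_linear i : linear (@yder R n i).
Proof.
move=> c f g; apply/funext => J.
by rewrite ysD ysZ /yder ysD ysZ mulrDr mulrCA.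
Qed.
HB.instance Definition _ i :=
  GRing.isLinear.Build C ys ys _ (@yder R n i) (@yder_is_linear i).

Lemma yderC i j f : yder i (yder j f) = yder j (yder i f).
Proof.
apply/funext => J; rewrite /yder !ffunE !mulrA -!miaddA (miaddC (midx j)).
rewrite [i == j]eq_sym; case: (eqVneq j i) => [->|_]; first by [].
by rewrite !addn0; congr (_ * _); rewrite mulrC.
Qed.

Lemma ymulC f g : ymul f g = ymul g f.
Proof.
apply/funext => J.
have h i : (J i < (misize J).+1)%N by rewrite ltnS leq_misize.
rewrite !(@ymul_box (misize J).+1) //.
apply: (@big_bij_on _ _ _ _ _ _ _ (fun I => misub J I) (fun I => misub J I));
  rewrite ?mibox_uniq // => I _ IJ.
all: have e : misub J (misub J I) = I
  by apply/ffunP => i; rewrite !ffunE subKn //; move/forallP: IJ; apply.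
all: split; rewrite ?e 1?mulrC ?mem_mibox //.
all: apply/forallP => i; rewrite ffunE ?leq_subr //.
all: by apply: leq_ltn_trans (h i); rewrite leq_subr.
Qed.

Lemma ymul_is_linear f : linear (ymul f).
Proof.
move=> c g g'; apply/funext => J.
rewrite ysD ysZ /ymul mulr_sumr -big_split /=.
by apply: eq_bigr => I _; rewrite ysD ysZ mulrDr mulrCA.
Qed.
HB.instance Definition _ f :=
  GRing.isLinear.Build C ys ys _ (ymul f) (@ymul_is_linear f).

Lemma ymulDl f g h : ymul (f + g) h = ymul f h + ymul g h.
Proof. by rewrite ymulC linearD /= !(ymulC h). Qed.

Lemma ymulZl c f h : ymul (c *: f) h = c *: ymul f h.
Proof. by rewrite ymulC linearZ /= !(ymulC h). Qed.

(** In the convolution at [miadd J (midx i)] the weight [(J i).+1] is the exponent of [y_i] in the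
    first factor plus that in the second; each half is one of the two Leibniz terms. *)
Lemma yder_mul i f g : yder i (ymul f g) = ymul (yder i f) g + ymul f (yder i g).
Proof.
have half f' g' J : \sum_(I <- mibox n (misize J).+2 | mle I (miadd J (midx i)))
     (I i)%:R * (f' I * g' (misub (miadd J (midx i)) I)) = ymul (yder i f') g' J.
  have h k : (J k < (misize J).+2)%N by rewrite !ltnS ltnW // ltnS leq_misize.
  rewrite (bigID (fun I : mi n => (0 < I i)%N)) /= [X in _ + X]big1 ?addr0; last first.
    by move=> I /andP[_]; rewrite lt0n negbK => /eqP ->; rewrite mul0r.
  rewrite (ymul_box _ _ h); symmetry.
  apply: (@big_bij_on _ _ _ _ _ _ _ (fun I => miadd I (midx i))
     (fun I => misub I (midx i))); rewrite ?mibox_uniq // => I.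
    rewrite mem_mibox => /forallP bI /forallP IJ; split.
    - rewrite mem_mibox; apply/forallP => k; rewrite !ffunE ltnS.
      rewrite (leq_trans (leq_add (IJ k) (leqnn _))) //.
      case: eqP; rewrite ?addn1 ?addn0 ?ltnS ?leq_misize //.
      by move=> _; rewrite ltnW // ltnS leq_misize.
    - rewrite !ffunE eqxx addn1 andbT; apply/forallP => k.
      by rewrite !ffunE leq_add2r.
    - by rewrite miaddK.
    rewrite yderE !ffunE eqxx addn1 mulrA; congr (_ * g' _).
    by apply/ffunP => k; rewrite !ffunE subnDr.
  rewrite mem_mibox => /forallP bI /andP[/forallP IJ Ii]; split.
  - rewrite mem_mibox; apply/forallP => k; rewrite ffunE.
    by apply: leq_ltn_trans (bI k); rewrite leq_subr.
  - apply/forallP => k; rewrite ffunE leq_subLR addnC.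
    by have := IJ k; rewrite ffunE.
  by rewrite misubKx.
apply/funext => J.
have hh k : (miadd J (midx i) k < (misize J).+2)%N.
  rewrite ffunE ltnS (leq_trans (leq_add (leq_misize J k) (leq_misize _ k))) //.
  by rewrite misize_midx addn1.
rewrite ysD [ymul f (yder i g)]ymulC -!half yderE (@ymul_box (misize J).+2) //.
(* Reflecting [I] in [miadd J (midx i)] exchanges the two factors, so that both halves carry the
   same product and only their weights differ. *)
have -> : \sum_(I <- mibox n (misize J).+2 | mle I (miadd J (midx i)))
    (I i)%:R * (g I * f (misub (miadd J (midx i)) I)) =
    \sum_(I <- mibox n (misize J).+2 | mle I (miadd J (midx i)))
    (misub (miadd J (midx i)) I i)%:R * (f I * g (misub (miadd J (midx i)) I)).
{ apply: (@big_bij_on _ _ _ _ _ _ _ (fun I => misub (miadd J (midx i)) I)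
     (fun I => misub (miadd J (midx i)) I)); rewrite ?mibox_uniq // => I _ IJ.
  all: have e : misub (miadd J (midx i)) (misub (miadd J (midx i)) I) = I
    by apply/ffunP => k; rewrite ffunE [misub _ I k]ffunE subKn //; move/forallP: IJ; apply.
  all: split; rewrite ?e ?mem_mibox // 1?(mulrC (g I)) //.
  all: apply/forallP => k; rewrite [misub _ I k]ffunE ?leq_subr //.
  all: by apply: leq_ltn_trans (hh k); rewrite leq_subr. }
rewrite -big_split /= big_distrr /=; apply: eq_bigr => I /forallP /(_ i) IJ.
rewrite -mulrDl -natrD; congr (_%:R * _).
by rewrite [misub _ I i]ffunE subnKC // ffunE // ffunE eqxx addn1.
Qed.

(** Multiplication by [y_i], separate from [ymul] so that identities can be proved by peeling off
    one coordinate at a time. *)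
Definition ymono i f : ys := fun J =>
  if (0 < J i)%N then f (misub J (midx i)) else 0.

Lemma ymono_is_linear i : linear (ymono i).
Proof.
move=> c f g; apply/funext => J; rewrite ysD ysZ /ymono.
by case: ifP => // _; rewrite mulr0 addr0.
Qed.
HB.instance Definition _ i :=
  GRing.isLinear.Build C ys ys _ (ymono i) (@ymono_is_linear i).

Lemma yder_mono i j f :
  yder i (ymono j f) = (i == j)%:R *: f + ymono j (yder i f).
Proof.
apply/funext => J; rewrite ysD ysZ yderE /ymono !ffunE [j == i]eq_sym; have [->|ij] := eqVneq i j; last first.
  rewrite addn0 mul0r add0r; case: ifP => [Jj|]; last by rewrite mulr0.
  rewrite yderE !ffunE (negPf ij) subn0; congr (_ * f _).
  apply/ffunP => k; rewrite !ffunE; case: (eqVneq k j) => [->|]; rewrite ?subn0 //.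
  by rewrite eq_sym (negPf ij) !addn0.
rewrite addn1 ltn0Sn mul1r miaddK; case: ifP => Jj; last first.
  by move: Jj; rewrite lt0n => /negbFE/eqP ->; rewrite mul1r addr0.
rewrite yderE misubKx // !ffunE eqxx subn1 prednK //.
by rewrite -[in LHS]addn1 natrD mulrDl mul1r addrC.
Qed.

Lemma ymul_mono i f g : ymul (ymono i f) g = ymono i (ymul f g).
Proof.
apply/funext => J; rewrite /ymono.
have h k : (J k < (misize J).+1)%N by rewrite ltnS leq_misize.
rewrite (ymul_box _ _ h).
rewrite (bigID (fun I : mi n => (0 < I i)%N)) /= [X in _ + X]big1 ?addr0; last first.
  by move=> I /andP[_ /negPf ->]; rewrite mul0r.
case: ifP => Ji; last first.
  rewrite big1 // => I /andP[/forallP /(_ i)]; rewrite leqNgt => + Ii.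
  by rewrite (leq_trans _ Ii) // ltnS leqNgt Ji.
rewrite (@ymul_box (misize J).+1); last first.
  by move=> k; rewrite ffunE (leq_ltn_trans _ (h k)) // leq_subr.
apply: (@big_bij_on _ _ _ _ _ _ _ (fun I => misub I (midx i))
     (fun I => miadd I (midx i))); rewrite ?mibox_uniq // => I.
  rewrite mem_mibox => /forallP bI /andP[/forallP IJ Ii]; split.
  - rewrite mem_mibox; apply/forallP => k; rewrite ffunE.
    by apply: leq_ltn_trans (bI k); rewrite leq_subr.
  - by apply/forallP => k; rewrite !ffunE leq_sub2r.
  - by rewrite misubKx.
  rewrite Ii; congr (_ * g _); apply/ffunP => k; rewrite !ffunE.
  have := IJ k; case: (eqVneq k i) => [->|]; rewrite ?subn0 //.
  by rewrite -subnDA subnKC.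
rewrite mem_mibox => /forallP bI /forallP IJ.
have IJ' : mle (miadd I (midx i)) J.
  apply/forallP => k; have := IJ k; rewrite !ffunE; case: (eqVneq k i) => [->|]; last by rewrite subn0 addn0.
  by rewrite leq_subRL // addnC.
split; last by rewrite miaddK.
- rewrite mem_mibox; apply/forallP => k.
  by apply: leq_ltn_trans (h k); move/forallP: IJ'; apply.
- by rewrite IJ' !ffunE eqxx addn1.
Qed.

Lemma ymul_eq0 f g : ymul f g (mi0 n) = f (mi0 n) * g (mi0 n).
Proof.
rewrite (@ymul_box 1%N) => [|i]; last by rewrite ffunE.
rewrite big_mkcond (bigD1_seq (mi0 n)) ?mibox_uniq //=; last first.
  by rewrite mem_mibox; apply/forallP => i; rewrite ffunE.
rewrite ifT; last by apply/forallP => i; rewrite ffunE.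
rewrite big1 ?addr0 => [|I I0].
  by congr (_ * g _); apply/ffunP => i; rewrite !ffunE.
case: ifP => // /forallP h; case/negP: I0; apply/eqP/ffunP => i.
by have := h i; rewrite !ffunE leqn0 => /eqP.
Qed.

End PowerSeries.

(** * The fibrewise product *)

Section Moyal.
Variables (R : realType) (n : nat) (P : 'M[R]_n).
Local Notation C := R[i].
Local Notation ys := (yseries R n).
Implicit Types (f g h : ys) (i j : 'I_n) (I J K : mi n).

(* The product of the [r]-th power of the bivector operator applied to the tensor
   [f], [g]; [circ] is the sum of the [(lambda/2)^r / r!] times these. *)
Fixpoint bidiff r f g : ys :=
  if r is r'.+1 then
    \sum_s \sum_t (P s t)%:C *: bidiff r' (yder s f) (yder t g)
  else ymul f g.

Lemma bidiffS r f g : bidiff r.+1 f g =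
  \sum_s \sum_t (P s t)%:C *: bidiff r (yder s f) (yder t g).
Proof. by []. Qed.

Lemma bidiff_is_linear r f : linear (bidiff r f).
Proof.
elim: r f => [|r IH] f c g g'; first exact: linearP.
rewrite !bidiffS scaler_sumr -big_split; apply: eq_bigr => s _ /=.
rewrite scaler_sumr -big_split; apply: eq_bigr => t _ /=.
by rewrite linearP IH scalerDr !scalerA mulrC.
Qed.
HB.instance Definition _ r f :=
  GRing.isLinear.Build C ys ys _ (bidiff r f) (@bidiff_is_linear r f).

Lemma bidiff_linearl r g (c : C) f f' :
  bidiff r (c *: f + f') g = c *: bidiff r f g + bidiff r f' g.
Proof.
elim: r f f' g => [|r IH] f f' g; first by rewrite /= ymulDl ymulZl.
rewrite !bidiffS scaler_sumr -big_split; apply: eq_bigr => s _ /=.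
rewrite scaler_sumr -big_split; apply: eq_bigr => t _ /=.
by rewrite linearP IH scalerDr !scalerA mulrC.
Qed.

Lemma bidiffDl r f f' g : bidiff r (f + f') g = bidiff r f g + bidiff r f' g.
Proof. by have := bidiff_linearl r g 1 f f'; rewrite !scale1r. Qed.

Lemma bidiff0l r g : bidiff r 0 g = 0.
Proof. by have := bidiff_linearl r g (-1) 0 0; rewrite scaler0 addr0 scaleN1r addNr. Qed.

Lemma bidiffZl r (c : C) f g : bidiff r (c *: f) g = c *: bidiff r f g.
Proof. by have := bidiff_linearl r g c f 0; rewrite bidiff0l !addr0. Qed.

Lemma yder_foldr i f s : foldr (@yder R n) (yder i f) s = yder i (foldr (@yder R n) f s).
Proof. by elim: s => //= j s ->; rewrite yderC. Qed.

Lemma sum_tupleS (A : nmodType) r (F : r.+1.-tuple 'I_n -> A) :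
  \sum_t F t = \sum_i \sum_(t : r.-tuple 'I_n) F [tuple of i :: t].
Proof.
rewrite pair_big (reindex (fun p : 'I_n * r.-tuple 'I_n => [tuple of p.1 :: p.2])) //=.
exists (fun t => (thead t, [tuple of behead t])) => [[i t]|t] _ /=.
  by congr (_, _); apply: val_inj.
by apply: val_inj; rewrite /= {3}[t]tuple_eta.
Qed.

(** Peeling off the first entries of both tuples identifies the recursion, which suits induction,
    with the sum over tuples in [circ]. *)
Lemma bidiffE r f g J : bidiff r f g J =
  \sum_(s : r.-tuple 'I_n) \sum_(t : r.-tuple 'I_n)
     (\prod_(l < r) (P (tnth s l) (tnth t l))%:C) *
     ymul (foldr (@yder R n) f s) (foldr (@yder R n) g t) J.
Proof.
elim: r f g => [|r IH] f g.
  rewrite (big_pred1 [tuple]) => [|t]; last by rewrite [t]tuple0; apply/esym/eqP.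
  rewrite (big_pred1 [tuple]) => [|t]; last by rewrite [t]tuple0; apply/esym/eqP.
  by rewrite big_ord0 mul1r.
rewrite bidiffS fct_sumE sum_tupleS; apply: eq_bigr => i _.
rewrite fct_sumE; under [RHS]eq_bigr do rewrite sum_tupleS.
rewrite exchange_big; apply: eq_bigr => j _ /=.
rewrite ysZ IH mulr_sumr; apply: eq_bigr => s _.
rewrite mulr_sumr; apply: eq_bigr => t _.
rewrite !yder_foldr big_ord_recl !tnth0 mulrA; congr (_ * _ * _).
by apply: eq_bigr => l _; rewrite !tnthS.
Qed.

Lemma yder_bidiff i r f g :
  yder i (bidiff r f g) = bidiff r (yder i f) g + bidiff r f (yder i g).
Proof.
elim: r f g => [|r IH] f g; first exact: yder_mul.
rewrite !bidiffS linear_sum -big_split; apply: eq_bigr => s _ /=.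
rewrite linear_sum -big_split; apply: eq_bigr => t _ /=.
by rewrite linearZ /= IH scalerDr (yderC s) (yderC t).
Qed.

(** The commutator of the bivector operator with [y_i] on the first factor is [\sum_j P i j d_j] on
    the second. This commutes with the operator, so a power contributes its exponent times one lower
    power. *)
Lemma bidiff_mono r i f g : bidiff r.+1 (ymono i f) g =
  ymono i (bidiff r.+1 f g) + r.+1%:R *: \sum_j (P i j)%:C *: bidiff r f (yder j g).
Proof.
(* Stated with [k.-1] so that [k = 0], where the extra term has coefficient 0, is an instance and
   serves as the base case. *)
have step k f' g' : (forall f g, bidiff k (ymono i f) g = ymono i (bidiff k f g)
    + k%:R *: \sum_j (P i j)%:C *: bidiff k.-1 f (yder j g)) ->
  bidiff k.+1 (ymono i f') g' = ymono i (bidiff k.+1 f' g') +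
    k.+1%:R *: \sum_j (P i j)%:C *: bidiff k f' (yder j g').
  move=> IH; rewrite [in LHS]bidiffS.
  under eq_bigr => s _.
    under eq_bigr do rewrite yder_mono bidiffDl bidiffZl IH addrCA !scalerDr.
    rewrite !big_split /=; over.
  rewrite !big_split /=; congr (_ + _).
    rewrite linear_sum; apply: eq_bigr => s _.
    by rewrite linear_sum; apply: eq_bigr => t _; rewrite linearZ.
  rewrite -addn1 natrD scalerDl scale1r addrC; congr (_ + _); last first.
    rewrite (bigD1 i) //= [X in _ + X]big1 ?addr0; last first.
      move=> s /negPf si; rewrite big1 // => t _.
      by rewrite si scale0r scaler0.
    by apply: eq_bigr => t _; rewrite eqxx scale1r.
  case: k IH => [|k] IH.
    rewrite scale0r big1 // => s _; rewrite big1 // => t _.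
    by rewrite scale0r scaler0.
  under eq_bigr do under eq_bigr do rewrite scalerA mulrC -scalerA.
  under eq_bigr do rewrite -scaler_sumr.
  rewrite -scaler_sumr; congr (_ *: _).
  under [RHS]eq_bigr do rewrite bidiffS scaler_sumr.
  rewrite [RHS]exchange_big /=; apply: eq_bigr => s _.
  under [RHS]eq_bigr do rewrite scaler_sumr.
  rewrite [RHS]exchange_big /=; apply: eq_bigr => t _.
  rewrite scaler_sumr; apply: eq_bigr => l _.
  by rewrite !scalerA mulrC (yderC t).
elim: r f g => [|r IH] f g; apply: step => // f' g'.
by rewrite scale0r addr0 /= ymul_mono.
Qed.

End Moyal.

Arguments bidiff : simpl never.

(** * Associativity of the fibrewise product *)

Section Weyl.
Variables (R : realType) (n : nat) (P : 'M[R]_n).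
Local Notation C := R[i].
Local Notation ys := (yseries R n).
Local Notation wl := (weyl R n).
Implicit Types (a b c : wl) (i j : 'I_n) (I J K : mi n).

Lemma wlD a b k : (a + b) k = a k + b k. Proof. by []. Qed.
Lemma wlN a k : (- a) k = - a k. Proof. by []. Qed.
Lemma wlZ (c : C) a k : (c *: a) k = c *: a k. Proof. by []. Qed.

Definition moyal_coef r : C := ((2 ^ r * r`!)%:R)^-1.

Lemma circE a b k : circ P a b k =
  \sum_(r < k.+1) \sum_(p < (k - r).+1)
     moyal_coef r *: bidiff P r (a p) (b (k - r - p)%N).
Proof.
apply/funext => J; rewrite fct_sumE; apply: eq_bigr => r _.
by rewrite fct_sumE; apply: eq_bigr => p _; rewrite ysZ bidiffE.
Qed.

Lemma circ_is_linear a : linear (circ P a).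
Proof.
move=> c b b'; apply/funext => k; rewrite wlD wlZ !circE.
rewrite scaler_sumr -big_split; apply: eq_bigr => r _ /=.
rewrite scaler_sumr -big_split; apply: eq_bigr => p _ /=.
by rewrite wlD wlZ linearP scalerDr !scalerA mulrC.
Qed.
HB.instance Definition _ a :=
  GRing.isLinear.Build C wl wl _ (circ P a) (@circ_is_linear a).

Lemma circ_linearl (c : C) a a' b : circ P (c *: a + a') b = c *: circ P a b + circ P a' b.
Proof.
apply/funext => k; rewrite wlD wlZ !circE.
rewrite scaler_sumr -big_split; apply: eq_bigr => r _ /=.
rewrite scaler_sumr -big_split; apply: eq_bigr => p _ /=.
by rewrite wlD wlZ bidiff_linearl scalerDr !scalerA mulrC.
Qed.

Lemma circDl a a' b : circ P (a + a') b = circ P a b + circ P a' b.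
Proof. by have := circ_linearl 1 a a' b; rewrite !scale1r. Qed.

Lemma circ0l b : circ P 0 b = 0.
Proof. by have := circ_linearl (-1) 0 0 b; rewrite scaler0 addr0 scaleN1r addNr. Qed.

Lemma circZl (c : C) a b : circ P (c *: a) b = c *: circ P a b.
Proof. by have := circ_linearl c a 0 b; rewrite circ0l !addr0. Qed.

Lemma circBl a a' b : circ P (a - a') b = circ P a b - circ P a' b.
Proof. by rewrite -scaleN1r circDl circZl scaleN1r. Qed.

Lemma circ_suml (T : Type) (s : seq T) (F : T -> wl) b :
  circ P (\sum_(x <- s) F x) b = \sum_(x <- s) circ P (F x) b.
Proof. by elim: s => [|x s IH]; rewrite ?big_nil ?circ0l // !big_cons circDl IH. Qed.

Definition wder j a : wl := fun k => yder j (a k).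
Definition wmono j a : wl := fun k => ymono j (a k).
(** Multiplication by lambda. Its injectivity lets identities for [wcomm], a quotient by lambda, be
    checked after multiplying by lambda. *)
Definition wshift a : wl := fun k => if k is k'.+1 then a k' else 0.

Lemma wder_is_linear j : linear (wder j).
Proof. by move=> c a b; apply/funext => k; rewrite wlD wlZ /wder wlD wlZ linearP. Qed.
HB.instance Definition _ j :=
  GRing.isLinear.Build C wl wl _ (wder j) (@wder_is_linear j).
Lemma wmono_is_linear j : linear (wmono j).
Proof. by move=> c a b; apply/funext => k; rewrite wlD wlZ /wmono wlD wlZ linearP. Qed.
HB.instance Definition _ j :=
  GRing.isLinear.Build C wl wl _ (wmono j) (@wmono_is_linear j).
Lemma wshift_is_linear : linear wshift.
Proof.
move=> c a b; apply/funext => -[|k]; rewrite wlD wlZ //=.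
by rewrite scaler0 addr0.
Qed.
HB.instance Definition _ :=
  GRing.isLinear.Build C wl wl _ wshift wshift_is_linear.

Lemma wshift_inj : injective wshift.
Proof. by move=> a b e; apply/funext => k; have := congr1 (fun f : wl => f k.+1) e. Qed.

Lemma circ_shiftl a b : circ P (wshift a) b = wshift (circ P a b).
Proof.
apply/funext => -[|k]; rewrite circE.
  rewrite big_ord1 /= subn0 big_ord1 /=.
  by rewrite bidiff0l scaler0.
rewrite big_ord_recr /= subnn big_ord1 /= bidiff0l scaler0 addr0.
rewrite circE; apply: eq_bigr => r _.
rewrite subSn; last by rewrite -ltnS.
by rewrite big_ord_recl /= bidiff0l scaler0 add0r.
Qed.

Lemma circ_shiftr a b : circ P a (wshift b) = wshift (circ P a b).
Proof.
apply/funext => -[|k]; rewrite circE.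
  rewrite big_ord1 /= subn0 big_ord1 /=.
  by rewrite linear0 scaler0.
rewrite big_ord_recr /= subnn big_ord1 /= linear0 scaler0 addr0.
rewrite circE; apply: eq_bigr => r _.
rewrite subSn; last by rewrite -ltnS.
rewrite big_ord_recr /= subnn linear0 scaler0 addr0; apply: eq_bigr => p _.
by rewrite subSn //; rewrite -ltnS.
Qed.

Lemma wder_circ j a b : wder j (circ P a b) = circ P (wder j a) b + circ P a (wder j b).
Proof.
apply/funext => k; rewrite wlD /wder !circE linear_sum -big_split.
apply: eq_bigr => r _ /=; rewrite linear_sum -big_split; apply: eq_bigr => p _ /=.
by rewrite linearZ /= yder_bidiff scalerDr.
Qed.

Lemma moyal_coefS r : moyal_coef r.+1 * r.+1%:R = 2^-1 * moyal_coef r.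
Proof.
rewrite /moyal_coef expnS factS !natrM.
have h : (2 ^ r)%:R != 0 :> C by rewrite pnatr_eq0 -lt0n expn_gt0.
have h' : r`!%:R != 0 :> C by rewrite pnatr_eq0 -lt0n fact_gt0.
have h3 : r.+1%:R != 0 :> C by rewrite pnatr_eq0.
move: h h' h3; move: (2 ^ r)%:R r`!%:R r.+1%:R => x y s h h' h3.
by field; rewrite h h' h3.
Qed.

(** Sum [bidiff_mono] over all powers: by [moyal_coefS] the terms that lose a power of the bivector
    reassemble into half a product, one order higher in lambda. *)
Lemma circ_mono i a b : circ P (wmono i a) b =
  wmono i (circ P a b) + 2^-1 *: wshift (\sum_j (P i j)%:C *: circ P a (wder j b)).
Proof.
apply/funext => k; rewrite wlD wlZ /wmono !circE.
rewrite big_ord_recl [in X in _ = X + _]big_ord_recl linearD /=.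
rewrite -addrA; congr (_ + _).
  rewrite linear_sum; apply: eq_bigr => p _ /=.
  by rewrite linearZ /= [in LHS]/bidiff ymul_mono.
case: k => [|k]; first by rewrite !big_ord0 linear0 /= scaler0 add0r.
have -> : wshift (\sum_j (P i j)%:C *: circ P a (wder j b)) k.+1 =
    \sum_(r < k.+1) \sum_(p < (k - r).+1) moyal_coef r *:
      \sum_j (P i j)%:C *: bidiff P r (a p) (yder j (b (k - r - p)%N)).
  rewrite /= fct_sumE; under [LHS]eq_bigr do rewrite wlZ circE scaler_sumr.
  rewrite [LHS]exchange_big; apply: eq_bigr => r _.
  under [LHS]eq_bigr do rewrite scaler_sumr.
  rewrite [LHS]exchange_big; apply: eq_bigr => p _.
  by rewrite scaler_sumr; apply: eq_bigr => j _; rewrite !scalerA mulrC.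
rewrite linear_sum scaler_sumr -big_split; apply: eq_bigr => r _ /=.
rewrite /bump leq0n add1n subSS linear_sum scaler_sumr -big_split.
apply: eq_bigr => p _ /=; rewrite bidiff_mono scalerDr !scalerA.
by rewrite linearZ /= -moyal_coefS; congr (_ + _ *: _); apply: mulrC.
Qed.

Lemma ymul1 f : ymul (fun J => (J == mi0 n)%:R) f = f :> ys.
Proof.
apply/funext => J; rewrite (@ymul_box _ _ (misize J).+1); last first.
  by move=> i; rewrite ltnS leq_misize.
rewrite big_mkcond (bigD1_seq (mi0 n)) ?mibox_uniq //=; last first.
  by rewrite mem_mibox; apply/forallP => i; rewrite ffunE.
rewrite eqxx mul1r ifT; last by apply/forallP => i; rewrite ffunE.
rewrite big1 ?addr0; first by congr f; apply/ffunP => i; rewrite !ffunE subn0.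
by move=> I /negPf ->; rewrite mul0r if_same.
Qed.

Lemma yder_wone i k : yder i (@wone R n k) = 0.
Proof.
apply/funext => J; rewrite yderE /wone; case: (_ == mi0 n) /eqP; last by rewrite andbF mulr0.
by move=> /ffunP/(_ i); rewrite !ffunE eqxx addn1.
Qed.

Lemma bidiff_wonel r k f : bidiff P r.+1 (wone k) f = 0.
Proof.
rewrite bidiffS big1 // => s _; rewrite big1 // => t _.
by rewrite yder_wone bidiff0l scaler0.
Qed.

Lemma bidiff_woner r k f : bidiff P r.+1 f (wone k) = 0.
Proof.
rewrite bidiffS big1 // => s _; rewrite big1 // => t _.
by rewrite yder_wone linear0 scaler0.
Qed.

Lemma woneS k : @wone R n k.+1 = 0.
Proof. by []. Qed.

Lemma circ1l a : circ P wone a = a.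
Proof.
apply/funext => k; rewrite circE big_ord_recl big_ord_recl /=.
rewrite /moyal_coef expn0 fact0 mul1n invr1 scale1r !subn0 [in X in X + _ + _]/bidiff.
rewrite [X in ymul X](_ : _ = fun J => (J == mi0 n)%:R) // ymul1 -[RHS]addr0 -addrA.
congr (_ + _); rewrite [X in X + _]big1 => [|p _]; last first.
  by rewrite woneS bidiff0l scaler0.
rewrite add0r big1 // => r _; rewrite big1 // => p _.
by rewrite (bidiff_wonel r) scaler0.
Qed.

Lemma circ1r a : circ P a wone = a.
Proof.
apply/funext => k; rewrite circE big_ord_recl big_ord_recr /=.
rewrite /moyal_coef expn0 fact0 mul1n invr1 scale1r subn0 subnn [bidiff P 0 _ (wone _)]/bidiff.
rewrite [X in ymul _ X](_ : _ = fun J => (J == mi0 n)%:R) // ymulC ymul1 -[RHS]addr0.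
rewrite -addrA addrCA; congr (_ + _); rewrite [X in X + _]big1 => [|p _]; last first.
  have : (0 < k - p)%N by rewrite subn_gt0.
  by case: (k - p)%N => // q _; rewrite woneS linear0 scaler0.
rewrite add0r big1 // => r _; rewrite big1 // => p _.
by rewrite (bidiff_woner r) scaler0.
Qed.

(** Each monomial that contains some [y] is charged to the one variable selected by [pick]; the
    positive powers of lambda without [y] go into the shift. *)
Lemma weyl_decomp a : exists (b : 'I_n -> wl) (c : wl),
  a = a 0%N (mi0 n) *: wone + \sum_i wmono i (b i) + wshift c.
Proof.
exists (fun i k J => if [pick j | (0 < miadd J (midx i) j)%N] == Some i
  then a k (miadd J (midx i)) else 0).
exists (fun k J => if J == mi0 n then a k.+1 J else 0).
apply/funext => k; apply/funext => J.
rewrite !wlD fct_sumE !ysD wlZ ysZ fct_sumE.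
have [->|J0] := eqVneq J (mi0 n).
  rewrite [X in _ + X + _]big1 => [|i _]; last by rewrite /wmono /ymono ffunE.
  case: k => [|k]; first by rewrite /wone !eqxx mulr1 !addr0.
  by rewrite woneS /= eqxx mulr0 !add0r.
rewrite /wone (negPf J0) andbF mulr0 add0r.
have [i0 J0i] := mi_neq0 J0.
case e : [pick j | (0 < J j)%N] => [i|]; last first.
  by move: e; case: pickP => // /(_ i0); rewrite J0i.
rewrite (bigD1 i) //= big1 => [|j ji]; last first.
  rewrite /wmono /ymono; case: ifP => // Jj; rewrite misubKx // e.
  by rewrite ifF //; apply/eqP => -[ij]; rewrite ij eqxx in ji.
rewrite addr0 /wmono /ymono; have -> : (0 < J i)%N by move: e; case: pickP => // ? + [<-].
rewrite misubKx ?e ?eqxx; last by move: e; case: pickP => // ? + [<-].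
by case: k => [|k] /=; rewrite ?(negPf J0) addr0.
Qed.

(* The associator of [y_i a], [b], [c] is [y_i] times that of [a], [b], [c],
   plus terms that gain a factor [lambda]; hence associators vanish to every
   order of the filtration. *)
Lemma circA a b c : circ P (circ P a b) c = circ P a (circ P b c).
Proof.
pose A a b c : wl := circ P (circ P a b) c - circ P a (circ P b c).
suff main N : forall a b c k J, (2 * k + misize J < N)%N -> A a b c k J = 0.
  apply/funext => k; apply/funext => J; apply/eqP; rewrite -subr_eq0; apply/eqP.
  exact: (main (2 * k + misize J).+1).
elim: N => // N IH {}a {}b {}c k J kJ.
have AD x y : A (x + y) b c = A x b c + A y b c.
  by rewrite /A !circDl opprD addrACA.
have A0 : A 0 b c = 0 by rewrite /A !circ0l subr0.
have AS (F : 'I_n -> wl) : A (\sum_i F i) b c = \sum_i A (F i) b c.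
  by rewrite (big_morph _ AD A0).
have [a' [a'' ->]] := weyl_decomp a.
rewrite !AD AS !wlD !ysD.
have -> : A (a 0%N (mi0 n) *: wone) b c = 0.
  by rewrite /A !circZl !circ1l subrr.
have -> : A (wshift a'') b c k J = 0.
  rewrite /A !circ_shiftl -[X in X k]linearB /=; case: k kJ => [|k] // kJ.
  by apply: IH; move: kJ; rewrite mulnS !addSn add0n ltnS; apply: ltnW.
rewrite add0r addr0 !fct_sumE big1 // => i _.
(* After expansion by [circ_mono], the order-lambda part contains [a' o d_j (b o c)]; the Leibniz
   rule for [wder j] splits it so that two associators appear. *)
have -> : A (wmono i (a' i)) b c = wmono i (A (a' i) b c) + 2^-1 *:
    wshift (\sum_j (P i j)%:C *: (A (a' i) b (wder j c) + A (a' i) (wder j b) c)).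
  have e x y z : \sum_j (P i j)%:C *: (x j + y j - z j : wl) =
      \sum_j (P i j)%:C *: x j + \sum_j (P i j)%:C *: y j - \sum_j (P i j)%:C *: z j.
    rewrite -big_split -sumrB; apply: eq_bigr => j _.
    by rewrite scalerBr scalerDr.
  have -> : \sum_j (P i j)%:C *: (A (a' i) b (wder j c) + A (a' i) (wder j b) c) =
     \sum_j (P i j)%:C *: (circ P (circ P (a' i) b) (wder j c) +
        circ P (circ P (a' i) (wder j b)) c - circ P (a' i) (wder j (circ P b c))).
    apply: eq_bigr => j _; congr (_ *: _).
    rewrite /A wder_circ linearD /= addrACA; congr (_ + _).
    by rewrite opprD addrC.
  rewrite e {e} (linearB wshift) (linearD wshift) /= /A (linearB (wmono i)) /=.
  rewrite !circ_mono circDl circZl.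
  rewrite circ_shiftl circ_mono scalerBr scalerDr circ_suml.
  under [X in _ + 2^-1 *: wshift X - _]eq_bigr do rewrite circZl.
  rewrite opprD !addrA; congr (_ - _).
  rewrite -!addrA; congr (_ + _); rewrite [RHS]addrC -!addrA; congr (_ + _).
rewrite wlD ysD wlZ ysZ; have -> : wmono i (A (a' i) b c) k J = 0.
  rewrite /wmono /ymono; case: ifP => // Ji; apply: IH.
  have := misubKx Ji => /(congr1 (@misize n)); rewrite misize_add misize_midx.
  by move: kJ => /[swap] <-; rewrite addn1 addnS ltnS.
rewrite add0r; case: k kJ => [|k] kJ; first by rewrite mulr0.
rewrite /= !fct_sumE big1 ?mulr0 // => j _; rewrite wlZ ysZ wlD ysD.
by rewrite !IH ?addr0 ?mulr0 //; move: kJ; rewrite mulnS !addSn add0n ltnS; apply: ltnW.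
Qed.

End Weyl.

(** * Degree, and linear changes of coordinates *)

Section Commutator.
Variables (R : realType) (n : nat) (P : 'M[R]_n).
Local Notation C := R[i].
Local Notation wl := (weyl R n).
Implicit Types (a b c g : wl).

(** At order zero in lambda the product is the commutative [ymul], so the commutator is divisible by
    lambda. *)
Lemma wcommE a b : wshift (wcomm P a b) = circ P a b - circ P b a.
Proof.
apply/funext => -[|k] //; rewrite wlD wlN !circE !big_ord1 /=.
by rewrite /bidiff [ymul (b _) _]ymulC subrr.
Qed.

Lemma circBr a b b' : circ P a (b - b') = circ P a b - circ P a b'.
Proof. exact: linearB. Qed.

Lemma wshiftD a b : wshift (a + b) = wshift a + wshift b.
Proof. exact: linearD. Qed.

Lemma wshiftZ (c : C) a : wshift (c *: a) = c *: wshift a.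
Proof. exact: linearZ. Qed.

(** Multiplied by lambda this is the derivation property of a commutator in an associative
    algebra. *)
Lemma wcomm_circ g a b :
  wcomm P g (circ P a b) = circ P (wcomm P g a) b + circ P a (wcomm P g b).
Proof.
apply: wshift_inj; rewrite [LHS]wcommE wshiftD.
transitivity (circ P (wshift (wcomm P g a)) b + circ P a (wshift (wcomm P g b))).
  by rewrite (wcommE g a) (wcommE g b) circBl circBr !circA subrKA.
by rewrite circ_shiftl circ_shiftr.
Qed.

Lemma wcomm_is_linear g : linear (wcomm P g).
Proof.
move=> c a b; apply: wshift_inj.
rewrite [LHS]wcommE [RHS]wshiftD wshiftZ (wcommE g a) (wcommE g b) circ_linearl.
have -> : circ P g (c *: a + b) = c *: circ P g a + circ P g b by apply: linearP.
by rewrite scalerBr opprD addrACA.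
Qed.
HB.instance Definition _ g :=
  GRing.isLinear.Build C wl wl _ (wcomm P g) (@wcomm_is_linear g).

Lemma wcomm1 g : wcomm P g wone = 0.
Proof.
apply: wshift_inj; rewrite [LHS]wcommE circ1l circ1r subrr.
by apply/esym; apply: linear0.
Qed.

End Commutator.

(** * Properties inherited by the coefficients of a product *)

Section Closed.
Variables (R : realType) (n : nat) (X : Type).
Local Notation C := R[i].
Variables (Pr : (X -> C) -> Prop) (P : X -> 'M[R]_n).
Hypothesis Pr0 : Pr (fun=> 0).
Hypothesis PrD : forall u v, Pr u -> Pr v -> Pr (fun x => u x + v x).
Hypothesis PrZ : forall c v, Pr v -> Pr (fun x => c * v x).
Hypothesis PrP : forall s t v, Pr v -> Pr (fun x => (P x s t)%:C * v x).

Lemma closed_ext u v : (forall x, u x = v x) -> Pr v -> Pr u.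
Proof. by move=> /funext ->. Qed.

Lemma closed_sum (T : Type) (s : seq T) (Q : pred T) (F : T -> X -> C) :
  (forall i, Q i -> Pr (F i)) -> Pr (fun x => \sum_(i <- s | Q i) F i x).
Proof.
move=> h; elim: s => [|i s IH].
  by rewrite (_ : (fun _ => _) = fun=> 0) //; apply/funext => x; rewrite big_nil.
under eq_fun do rewrite big_cons.
case Qi : (Q i) => //.
by apply: PrD => //; apply: h.
Qed.

Lemma bidiff_closed r (f g : X -> yseries R n) J :
  (forall I K, (misize I + misize K = misize J + r.*2)%N -> Pr (fun x => f x I * g x K)) ->
  Pr (fun x => bidiff (P x) r (f x) (g x) J).
Proof.
elim: r f g J => [|r IH] f g J h.
  apply: closed_sum => I /forallP IJ; apply: h.
  rewrite addn0 /misize -big_split /=; apply: eq_bigr => i _.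
  by rewrite !ffunE subnKC.
apply: closed_ext => [x|]; first by rewrite bidiffS fct_sumE.
apply: closed_sum => s _.
apply: closed_ext => [x|]; first by rewrite fct_sumE.
apply: closed_sum => t _.
apply/PrP/IH => I K IK.
apply: closed_ext => [x|]; first by rewrite !yderE mulrACA.
apply/PrZ/h.
by rewrite !misize_add !misize_midx addnACA IK doubleS -addnA addn2.
Qed.

(** The [r]-th power of the bivector removes [2 r] degrees in [y] and comes with [lambda^r], so only
    pairs of coefficients of the right total degree enter. [Pr] stays abstract in order to serve
    vanishing, smoothness and differential polynomials alike. *)
Lemma circ_closed (f g : X -> weyl R n) k J :
  (forall p q I K, (2 * p + misize I + (2 * q + misize K) = 2 * k + misize J)%N ->
     Pr (fun x => f x p I * g x q K)) ->
  Pr (fun x => circ (P x) (f x) (g x) k J).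
Proof.
move=> h; apply: closed_ext => [x|]; first by rewrite circE fct_sumE.
apply: closed_sum => r _.
apply: closed_ext => [x|]; first by rewrite fct_sumE.
apply: closed_sum => p _.
apply: closed_ext => [x|]; first by rewrite ysZ.
apply/PrZ/bidiff_closed => I K IK; apply: h.
have pr : (p <= k - r)%N by rewrite -ltnS.
have rk : (r <= k)%N by rewrite -ltnS.
by rewrite -muln2 in IK; lia.
Qed.

End Closed.

Section Degree.
Variables (R : realType) (n : nat) (P : 'M[R]_n).
Local Notation wl := (weyl R n).

Definition wvanish (N : nat) (a : wl) := forall k J, (2 * k + misize J < N)%N -> a k J = 0.

Lemma wvanish_circ N N' a b : wvanish N a -> wvanish N' b -> wvanish (N + N') (circ P a b).
Proof.
move=> ha hb k J kJ.
(* Over a one-point base the class [Pr] expresses the vanishing of a single number. *)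
pose Pr (v : unit -> R[i]) := v tt = 0.
apply: (@circ_closed R n unit Pr (fun=> P) _ _ _ _ (fun=> a) (fun=> b)) => //.
- by rewrite /Pr => u v -> ->; rewrite addr0.
- by rewrite /Pr => c v ->; rewrite mulr0.
- by rewrite /Pr => s t v ->; rewrite mulr0.
move=> p q I K e; rewrite /Pr; case: (ltnP (2 * p + misize I) N) => h.
  by rewrite ha // mul0r.
rewrite hb ?mulr0 // -(ltn_add2l (2 * p + misize I)) e.
by apply: leq_trans kJ _; rewrite leq_add2r.
Qed.

Lemma wvanish_pow a m : wvanish 1 a -> wvanish m (wpow P a m).
Proof.
by move=> h; elim: m => [//|m IH]; rewrite -add1n; apply: wvanish_circ.
Qed.

End Degree.

(** * Compatibility of the product with linear changes of coordinates *)

Section LinearChange.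
Variables (R : realType) (n : nat).
Local Notation C := R[i].
Local Notation ys := (yseries R n).
Local Notation wl := (weyl R n).
Implicit Types (f g : ys) (v d : 'rV[R]_n) (T P : 'M[R]_n).

Definition ydir v f : ys := \sum_i (v 0 i)%:C *: yder i f.

Lemma ydir_is_linear v : linear (ydir v).
Proof.
move=> c f g; rewrite /ydir scaler_sumr -big_split; apply: eq_bigr => i _ /=.
by rewrite linearP scalerDr !scalerA mulrC.
Qed.
HB.instance Definition _ v :=
  GRing.isLinear.Build C ys ys _ (ydir v) (@ydir_is_linear v).

Lemma ydirD v w f : ydir (v + w) f = ydir v f + ydir w f.
Proof.
rewrite /ydir -big_split; apply: eq_bigr => i _ /=.
by rewrite mxE rmorphD scalerDl.
Qed.

Lemma ydirZ (t : R) v f : ydir (t *: v) f = t%:C *: ydir v f.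
Proof.
rewrite /ydir scaler_sumr; apply: eq_bigr => i _ /=.
by rewrite mxE rmorphM scalerA.
Qed.

Lemma yder_ydir i v f : yder i (ydir v f) = ydir v (yder i f).
Proof.
rewrite /ydir linear_sum; apply: eq_bigr => j _.
by rewrite linearZ /= yderC.
Qed.

Lemma ydirC v d f : ydir v (ydir d f) = ydir d (ydir v f).
Proof.
rewrite {1}/ydir; under eq_bigr do rewrite yder_ydir.
by rewrite [ydir v f]/ydir linear_sum; apply: eq_bigr => i _; rewrite linearZ.
Qed.

Lemma ydir_mul v f g : ydir v (ymul f g) = ymul (ydir v f) g + ymul f (ydir v g).
Proof.
have ymulZ (h h' : ys) (c : C) : ymul h (c *: h') = c *: ymul h h' by apply: linearZ.
rewrite /ydir linear_sum /= [ymul (\sum_i _) g]ymulC linear_sum /= -big_split.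
by apply: eq_bigr => i _; rewrite yder_mul scalerDr !ymulZ (ymulC g).
Qed.

Lemma ydir_midx i f : ydir (delta_mx 0 i) f = yder i f.
Proof.
rewrite /ydir (bigD1 i) //= big1 ?addr0 => [|j /negPf ji].
  by rewrite mxE !eqxx scale1r.
by rewrite mxE ji andbF scale0r.
Qed.

Definition yeval f m v : C :=
  \sum_(I <- mibox n m.+1 | misize I == m) f I * (\prod_i v 0 i ^+ I i)%:C.

Lemma hevalE (a : wl) k m v : heval a k m v = yeval (a k) m v.
Proof.
rewrite /yeval /mibox big_image_cond /=; apply: eq_big => [I|I _].
  by congr (_ == _); apply: eq_bigr => i _; rewrite ffunE.
by congr (_ * _%:C); apply: eq_bigr => i _; rewrite ffunE.
Qed.

Lemma yeval0 f v : yeval f 0 v = f (mi0 n).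
Proof.
rewrite /yeval big_mkcond (bigD1_seq (mi0 n)) ?mibox_uniq //=; last first.
  by rewrite mem_mibox; apply/forallP => i; rewrite ffunE.
rewrite misize0 eqxx big1 => [|i _]; last by rewrite ffunE.
rewrite mulr1 big1 ?addr0 // => I /negPf I0.
by rewrite ifF // -I0 -misize_eq0.
Qed.

(** Euler's relation for homogeneous polynomials; iterated, it turns values of homogeneous parts
    into derivatives along [v] at the origin. *)
Lemma yeval_euler f m v : m.+1%:R * yeval f m.+1 v = yeval (ydir v f) m v.
Proof.
rewrite /yeval mulr_sumr.
transitivity (\sum_(I <- mibox n m.+2 | misize I == m.+1)
   \sum_i (I i)%:R * (f I * (\prod_j v 0 j ^+ I j)%:C)).
  by apply: eq_bigr => I /eqP <-; rewrite -mulr_suml natr_sum.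
under [RHS]eq_bigr do rewrite /ydir fct_sumE mulr_suml.
rewrite exchange_big [RHS]exchange_big; apply: eq_bigr => i _ /=.
rewrite (bigID (fun I : mi n => (0 < I i)%N)) /= [X in _ + X]big1 ?addr0; last first.
  by move=> I /andP[_]; rewrite lt0n negbK => /eqP ->; rewrite mul0r.
apply: (@big_bij_on _ _ _ _ _ _ _ (fun I => misub I (midx i))
     (fun I => miadd I (midx i))); rewrite ?mibox_uniq // => I.
  rewrite mem_mibox => /forallP bI /andP[/eqP sI Ii].
  have e := misubKx Ii.
  have se : misize (misub I (midx i)) = m.
    by move: sI; rewrite -{1}e misize_add misize_midx addn1 => -[].
  split => //.
  - rewrite mem_mibox; apply/forallP => k; rewrite ltnS -se; exact: leq_misize.
  - by rewrite se.
  have -> : \prod_j v 0 j ^+ I j = v 0 i * \prod_j v 0 j ^+ misub I (midx i) j.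
    rewrite (bigD1 i) //= [in RHS](bigD1 i) //= mulrA !ffunE eqxx subn1 -exprS prednK //.
    by congr (_ * _); apply: eq_bigr => j /negPf ji; rewrite !ffunE ji subn0.
  by rewrite ysZ yderE e !ffunE eqxx subn1 prednK // rmorphM /=; ring.
rewrite mem_mibox => /forallP bI /eqP sI; split.
- rewrite mem_mibox; apply/forallP => k; rewrite ltnS -sI.
  by rewrite (leq_trans (leq_misize _ k)) // misize_add misize_midx addn1.
- by rewrite misize_add misize_midx addn1 sI eqxx ffunE ffunE eqxx addn1.
by rewrite miaddK.
Qed.

Lemma yeval_ydir f m v : m`!%:R * yeval f m v = iter m (ydir v) f (mi0 n).
Proof.
elim: m f => [|m IH] f; first by rewrite yeval0 mul1r.
by rewrite iterSr -IH -yeval_euler factS mulnC natrM mulrA.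
Qed.

(* [f] is the pull-back of [g] under [v |-> v *m T]: the iterated directional
   derivatives at 0 are the homogeneous parts, up to factorials. *)
Definition pulled T f g :=
  forall m v, iter m (ydir v) f (mi0 n) = iter m (ydir (v *m T)) g (mi0 n).

Lemma pulledP T f g :
  pulled T f g <-> forall m v, yeval f m v = yeval g m (v *m T).
Proof.
split=> h m v; last by rewrite -!yeval_ydir h.
have m0 : m`!%:R != 0 :> C by rewrite pnatr_eq0 -lt0n fact_gt0.
by apply: (mulfI m0); rewrite !yeval_ydir.
Qed.

Lemma iter_ydir_linear m v (c : C) f g :
  iter m (ydir v) (c *: f + g) = c *: iter m (ydir v) f + iter m (ydir v) g.
Proof. by elim: m => //= m ->; rewrite linearP. Qed.
HB.instance Definition _ m v :=
  GRing.isLinear.Build C ys ys _ (iter m (ydir v)) (@iter_ydir_linear m v).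

Lemma pulledD T f f' g g' : pulled T f g -> pulled T f' g' -> pulled T (f + f') (g + g').
Proof. by move=> h h' m v; rewrite !linearD /= !ysD h h'. Qed.

Lemma pulled0 T : pulled T 0 0.
Proof. by move=> m v; rewrite !linear0. Qed.

Lemma pulledZ (c : C) T f g : pulled T f g -> pulled T (c *: f) (c *: g).
Proof. by move=> h m v; rewrite !linearZ /= !ysZ h. Qed.

Lemma pulled_sum (S : Type) (s : seq S) (Q : pred S) T (F G : S -> ys) :
  (forall i, Q i -> pulled T (F i) (G i)) ->
  pulled T (\sum_(i <- s | Q i) F i) (\sum_(i <- s | Q i) G i).
Proof. by move=> h; apply: big_ind2 => //; [apply: pulled0|move=> *; apply: pulledD]. Qed.

(** Polarisation: the coefficient of [t] isolates a single derivative along [d] among derivatives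
    along [v], which pure powers of one direction do not show directly. *)
Lemma iter_ydir_poly m v d f : exists p : {poly C},
  [/\ forall t : R, p.[t%:C] = iter m (ydir (v + t *: d)) f (mi0 n),
      p`_0 = iter m (ydir v) f (mi0 n) &
      p`_1 = m%:R * iter m.-1 (ydir v) (ydir d f) (mi0 n)].
Proof.
elim: m f => [|m IH] f.
  exists (f (mi0 n))%:P; split=> [t||]; rewrite ?hornerC //.
    by rewrite coefC eqxx.
  by rewrite coefC mul0r.
have [p [p1 p2 p3]] := IH (ydir v f); have [q [q1 q2 q3]] := IH (ydir d f).
exists (p + q * 'X); split=> [t||].
- rewrite hornerD hornerMX p1 q1 iterSr ydirD ydirZ linearD /= ysD; congr (_ + _).
  by rewrite linearZ /= ysZ mulrC.
- by rewrite coefD coefMX eqxx addr0 p2 -iterSr.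
rewrite coefD coefMX /= p3 q2 -[in RHS]addn1 natrD mulrDl mul1r; congr (_ + _).
by case: m {IH p1 p2 p3 q1 q2 q3} => [|m]; rewrite ?mul0r //= ydirC -iterSr.
Qed.

(** A nonzero difference would vanish at as many natural numbers as its size, which is one more than
    its degree. *)
Lemma poly_eq_real (p q : {poly C}) : (forall t : R, p.[t%:C] = q.[t%:C]) -> p = q.
Proof.
move=> h; apply/eqP; rewrite -subr_eq0; apply: contraT => pq0.
pose rs : seq C := [seq (i%:R : R)%:C | i <- iota 0 (size (p - q))].
have := @max_poly_roots _ _ rs pq0; rewrite size_map size_iota ltnn => -> //.
  by apply/allP => _ /mapP[i _ ->]; rewrite rootE hornerD hornerN h subrr.
rewrite map_inj_uniq ?iota_uniq // => i j /(congr1 (@complex.Re R)) /= /eqP.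
by rewrite eqr_nat => /eqP.
Qed.

(** [pulled] only tests repeated derivatives in one direction. Testing it on [v + t d] at order
    [m.+1] and comparing the coefficients of [t] gives the mixed derivative. *)
Lemma pulled_ydir T d f g : pulled T f g -> pulled T (ydir d f) (ydir (d *m T) g).
Proof.
move=> h m v.
have [p [p1 _ p3]] := iter_ydir_poly m.+1 v d f.
have [q [q1 _ q3]] := iter_ydir_poly m.+1 (v *m T) (d *m T) g.
have pq : p = q.
  by apply: poly_eq_real => t; rewrite p1 q1 h mulmxDl scalemxAl.
have m0 : m.+1%:R != 0 :> C by rewrite pnatr_eq0.
by apply: (mulfI m0); rewrite -p3 -q3 pq.
Qed.

Lemma pulled_yder T i f g : pulled T f g ->
  pulled T (yder i f) (\sum_j (T i j)%:C *: yder j g).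
Proof.
move=> /(pulled_ydir (delta_mx 0 i)); rewrite ydir_midx => h m v; rewrite h.
congr (iter m _ _ _); apply: eq_bigr => j _; congr (_%:C *: _).
by rewrite -rowE mxE.
Qed.

Lemma pulled_mul T f f' g g' :
  pulled T f g -> pulled T f' g' -> pulled T (ymul f f') (ymul g g').
Proof.
(* The relation is truncated at order [k] along the fixed direction [v]: each use of the Leibniz
   rule consumes one order of agreement, which makes the induction on [m] possible. *)
move=> h h' m v; pose rel k f g :=
  forall m, (m <= k)%N -> iter m (ydir v) f (mi0 n) = iter m (ydir (v *m T)) g (mi0 n).
have : rel m f g by move=> k _; apply: h.
have : rel m f' g' by move=> k _; apply: h'.
elim: m f f' g g' {h h'} => [|m IH] f f' g g' h' h.
  by rewrite /= !ymul_eq0 -[f _]/(iter 0 (ydir v) f _) -[f' _]/(iter 0 (ydir v) f' _) h // h'.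
have hS f1 g1 : rel m.+1 f1 g1 -> rel m (ydir v f1) (ydir (v *m T) g1).
  by move=> hr k km; rewrite -!iterSr hr.
have hW f1 g1 : rel m.+1 f1 g1 -> rel m f1 g1.
  by move=> hr k km; rewrite hr // ltnW.
rewrite !iterSr !ydir_mul !linearD /= !ysD.
by congr (_ + _); apply: IH; auto.
Qed.

Lemma bidiff_suml (S : Type) (s : seq S) (F : S -> ys) P r g :
  bidiff P r (\sum_(x <- s) F x) g = \sum_(x <- s) bidiff P r (F x) g.
Proof. by elim: s => [|x s IH]; rewrite ?big_nil ?bidiff0l // !big_cons bidiffDl IH. Qed.

(** Derivatives pull back through [T] by [pulled_yder]; moving the two copies of [T] from the
    derivatives onto the bivector produces [T^T *m P *m T]. *)
Lemma pulled_bidiff T P r f f' g g' : pulled T f g -> pulled T f' g' ->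
  pulled T (bidiff P r f f') (bidiff (T^T *m P *m T) r g g').
Proof.
elim: r f f' g g' => [|r IH] f f' g g' h h'; first exact: pulled_mul.
set P' := T^T *m P *m T; rewrite !bidiffS.
have -> : \sum_p \sum_q (P' p q)%:C *: bidiff P' r (yder p g) (yder q g') =
   \sum_s \sum_t (P s t)%:C *: bidiff P' r (\sum_p (T s p)%:C *: yder p g)
                                       (\sum_q (T t q)%:C *: yder q g').
  transitivity (\sum_p \sum_q \sum_s \sum_t
      ((P s t)%:C * (T s p)%:C * (T t q)%:C) *: bidiff P' r (yder p g) (yder q g')).
    apply: eq_bigr => p _; apply: eq_bigr => q _.
    under [RHS]eq_bigr do rewrite -scaler_suml.
    rewrite -scaler_suml; congr (_ *: _).
    rewrite {1}/P' mxE rmorph_sum exchange_big; apply: eq_bigr => t _ /=.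
    rewrite mxE mulr_suml rmorph_sum; apply: eq_bigr => s _ /=.
    by rewrite mxE !rmorphM /= [(T s p)%:C * _]mulrC.
  have exch (F : 'I_n -> 'I_n -> 'I_n -> 'I_n -> ys) :
      \sum_p \sum_q \sum_s \sum_t F p q s t = \sum_s \sum_t \sum_p \sum_q F p q s t.
    under [LHS]eq_bigr do rewrite exchange_big.
    rewrite [LHS]exchange_big; apply: eq_bigr => s _ /=.
    under [LHS]eq_bigr do rewrite exchange_big.
    by rewrite [LHS]exchange_big.
  rewrite exch; apply: eq_bigr => s _; apply: eq_bigr => t _.
  rewrite linear_sum scaler_sumr exchange_big; apply: eq_bigr => q _ /=.
  rewrite linearZ /= bidiff_suml !scaler_sumr; apply: eq_bigr => p _.
  by rewrite bidiffZl !scalerA; congr (_ *: _); ring.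
apply: pulled_sum => s _; apply: pulled_sum => t _; apply: pulledZ.
by apply: IH; apply: pulled_yder.
Qed.

Lemma pulled_circ T P (a a' b b' : wl) :
  (forall k, pulled T (a k) (b k)) -> (forall k, pulled T (a' k) (b' k)) ->
  forall k, pulled T (circ P a a' k) (circ (T^T *m P *m T) b b' k).
Proof.
move=> h h' k; rewrite !circE; apply: pulled_sum => r _; apply: pulled_sum => p _.
exact/pulledZ/pulled_bidiff.
Qed.

Lemma pulled_wone T k : pulled T (@wone R n k) (@wone R n k).
Proof.
have z v : ydir v (@wone R n k) = 0.
  by rewrite /ydir big1 // => i _; rewrite yder_wone scaler0.
by case=> [|m] v //; rewrite !iterSr !z !linear0.
Qed.

Lemma pulled_wpow T P (a b : wl) m : (forall k, pulled T (a k) (b k)) ->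
  forall k, pulled T (wpow P a m k) (wpow (T^T *m P *m T) b m k).
Proof.
by move=> h; elim: m => [|m IH] k; [apply: pulled_wone|apply: pulled_circ].
Qed.

End LinearChange.

(** * Symmetry of second derivatives *)

Section Clairaut.
Variables (R : realType) (V : normedModType R).
Implicit Types (f : V -> R) (u v w z : V).

Lemma is_derive_line f w u (t : R) : derivable f (w + t *: u) u ->
  is_derive t 1 (fun s : R => f (w + s *: u)) ('D_u f (w + t *: u)).
Proof.
have e : (fun h : R => h^-1 *: (f (h *: u + (w + t *: u)) - f (w + t *: u))) =
   (fun h : R => h^-1 *: (f (w + (h *: 1 + t) *: u) - f (w + t *: u))).
  by apply/funext => h; rewrite [h *: 1]mulr1 scalerDl addrCA.
move=> df; split; first by rewrite /derivable /= -e.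
by rewrite /derive /= -e.
Qed.

(** The mean value theorem twice: along [u] for the difference of [f] in the direction [v], then
    along [v] for the derivative in [u]. *)
Lemma second_difference f u v z (h : R) : 0 < h ->
  (forall s t, 0 <= s <= h -> 0 <= t <= h ->
     derivable f (z + s *: u + t *: v) u /\
     derivable ('D_u f) (z + s *: u + t *: v) v) ->
  exists s t, [/\ 0 <= s <= h, 0 <= t <= h &
    f (z + h *: u + h *: v) - f (z + h *: u) - (f (z + h *: v) - f z) =
    'D_v ('D_u f) (z + s *: u + t *: v) * h * h].
Proof.
move=> h0 df.
have hh : 0 <= h <= h by rewrite lexx ltW.
have h00 : (0 : R) <= 0 <= h by rewrite lexx ltW.
pose g s := f (z + h *: v + s *: u) - f (z + s *: u).
have dg s : 0 <= s <= h -> is_derive s 1 g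
    ('D_u f (z + h *: v + s *: u) - 'D_u f (z + s *: u)).
  move=> sh; apply: is_deriveB; apply: is_derive_line.
    by rewrite addrAC; apply: (df _ _ sh hh).1.
  by have := (df _ _ sh h00).1; rewrite scale0r addr0.
have [s sh es] : exists2 s, s \in `]0, h[%R & g h - g 0 =
    ('D_u f (z + h *: v + s *: u) - 'D_u f (z + s *: u)) * (h - 0).
  apply: MVT => // [s|].
    by rewrite in_itv /= => /andP[s0 sh]; apply: dg; rewrite !ltW.
  by apply: derivable_within_continuous => s; rewrite in_itv /= => /dg [].
have {}sh : 0 <= s <= h by move: sh; rewrite in_itv /= => /andP[/ltW -> /ltW ->].
pose k t := 'D_u f (z + s *: u + t *: v).
have dk t : 0 <= t <= h -> is_derive t 1 k ('D_v ('D_u f) (z + s *: u + t *: v)).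
  by move=> th; apply: is_derive_line; apply: (df _ _ sh th).2.
have [t th et] : exists2 t, t \in `]0, h[%R & k h - k 0 =
    'D_v ('D_u f) (z + s *: u + t *: v) * (h - 0).
  apply: (@MVT _ k (fun t => 'D_v ('D_u f) (z + s *: u + t *: v)) 0 h h0) => [t|].
    by rewrite in_itv /= => /andP[t0 th]; apply: dk; rewrite (ltW t0) ltW.
  by apply: derivable_within_continuous => t; rewrite in_itv /= => /dk [].
exists s, t; split=> //; first by move: th; rewrite in_itv /= => /andP[/ltW -> /ltW ->].
move: es et; rewrite /g /k subr0 !scale0r !addr0 (addrAC z (s *: u)) => es <-.
by rewrite -es [z + h *: u + _]addrAC.
Qed.

Lemma continuous_eq_of_close (A B : V -> R) z :
  {for z, continuous A} -> {for z, continuous B} ->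
  (forall d : R, 0 < d -> exists p q, [/\ ball z d p, ball z d q & A p = B q]) ->
  A z = B z.
Proof.
move=> cA cB AB; apply/eqP; rewrite -subr_eq0 -normr_le0; apply/ler_addgt0Pl => e e0.
have e20 : 0 < e / 2 by rewrite divr_gt0.
move: cA cB => /cvgrPdist_lt /(_ _ e20) /nbhs_ballP[d /= d0 hA].
move=> /cvgrPdist_lt /(_ _ e20) /nbhs_ballP[d' /= d'0 hB].
have [|p [q [zp zq pq]]] := AB (Num.min d d'); first by rewrite lt_min d0.
have [mA mB] : Num.min d d' <= d /\ Num.min d d' <= d' by rewrite !ge_min !lexx orbT.
have {}hA := hA p (le_ball mA zp).
have {}hB := hB q (le_ball mB zq).
rewrite addr0 -(subrKA (A p)) (splitr e); apply: le_trans (ler_normD _ _) _.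
by rewrite ltW // ltrD // pq distrC.
Qed.

Lemma small_step u v (d : R) : 0 < d -> exists2 h : R, 0 < h &
  forall z s t, 0 <= s <= h -> 0 <= t <= h -> ball z d (z + s *: u + t *: v).
Proof.
move=> d0; have N0 : 0 < `|u| + `|v| + 1 by rewrite ltr_wpDl // addr_ge0.
exists (d / (`|u| + `|v| + 1)); first exact: divr_gt0.
move=> z s t /andP[s0 sh] /andP[t0 th].
rewrite -ball_normE /= -addrA opprD addNKr normrN.
apply: (@le_lt_trans _ _ (d / (`|u| + `|v| + 1) * (`|u| + `|v|))); last first.
  by rewrite -mulrA gtr_pMr // ltr_pdivrMl // mulr1 ltrDl.
apply: le_trans (ler_normD _ _) _.
rewrite !normrZ mulrDr !ger0_norm //.
by apply: lerD; apply: ler_wpM2r.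
Qed.

(** The second difference is symmetric in [u] and [v], so the two mixed derivatives agree at points
    arbitrarily close to [z], at possibly different arguments; continuity passes to [z]. *)
Lemma derive_comm f u v z (O : set V) : open O -> O z ->
  (forall w, O w -> [/\ derivable f w u, derivable f w v,
      derivable ('D_u f) w v & derivable ('D_v f) w u]) ->
  {for z, continuous ('D_v ('D_u f))} -> {for z, continuous ('D_u ('D_v f))} ->
  'D_v ('D_u f) z = 'D_u ('D_v f) z.
Proof.
move=> oO Oz df cA cB; apply: (continuous_eq_of_close cA cB) => d d0.
have /nbhs_ballP[d1 /= d10 dO] := open_nbhs_nbhs (conj oO Oz).
have [h h0 close] : exists2 h : R, 0 < h & forall s t, 0 <= s <= h -> 0 <= t <= h ->
    ball z d (z + s *: u + t *: v) /\ O (z + s *: u + t *: v).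
  have dd0 : 0 < Num.min d d1 by rewrite lt_min d0.
  have [h h0 close] := small_step u v dd0; exists h => // s t sh th.
  by split; [|apply: dO]; apply: le_ball (close z s t sh th); rewrite ge_min lexx ?orbT.
have [s [t [sh th est]]] := @second_difference f u v z h h0 (fun s t sh th =>
  let: And4 a _ c _ := df _ (close s t sh th).2 in conj a c).
have [t' [s' [th' sh' est']]] := @second_difference f v u z h h0 (fun t s th sh =>
  let: And4 _ b _ e := df _ (ecast x (O x) (addrAC z (s *: u) (t *: v)) (close s t sh th).2)
  in conj b e).
exists (z + s *: u + t *: v), (z + t' *: v + s' *: u); split.
- exact: (close s t sh th).1.
- by rewrite addrAC; apply: (close s' t' sh' th').1.
have e : f (z + h *: u + h *: v) - f (z + h *: u) - (f (z + h *: v) - f z) =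
    f (z + h *: v + h *: u) - f (z + h *: v) - (f (z + h *: u) - f z).
  rewrite (addrAC z (h *: v)) !opprB addrACA [RHS]addrACA; congr (_ + _).
  exact: addrC.
have hN0 := lt0r_neq0 h0; apply: (mulIf hN0); apply: (mulIf hN0).
exact: (etrans (esym est) (etrans e est')).
Qed.

End Clairaut.

(** * Smooth functions on an open set *)

Section SmoothOn.
Variables (R : realType) (n : nat) (O : set 'rV[R]_n).
Hypothesis oO : open O.
Local Notation fn := ('rV[R]_n -> R).
Implicit Types (f g : fn) (i j : 'I_n) (z : 'rV[R]_n).

Lemma near_eq_on f g z : (forall w, O w -> f w = g w) -> O z -> \near z, f z = g z.
Proof.
move=> fg Oz; apply: filterS (open_nbhs_nbhs (conj oO Oz)) => w.
exact: fg.
Qed.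

Lemma continuous_eq_on f g z : (forall w, O w -> f w = g w) -> O z ->
  {for z, continuous f} -> {for z, continuous g}.
Proof.
move=> fg Oz cf.
change (g @ z --> g z); rewrite -fg //; apply: cvg_trans cf.
exact: (@near_eq_cvg _ _ (nbhs z) _ _ _ (near_eq_on fg Oz)).
Qed.

Lemma pd_eq_on f g i z : (forall w, O w -> f w = g w) -> O z -> pd i f z = pd i g z.
Proof. by move=> fg Oz; apply/near_eq_derive/near_eq_on. Qed.

(** Smoothness as a greatest fixed point: if a class of differentiable functions is stable under
    partial derivatives up to equality on [O], every iterated derivative of a member agrees on the
    open set [O] with some member. *)
Lemma smooth_on_coind (F : fn -> Prop) :
  (forall f, F f -> forall z, O z -> {for z, continuous f} /\
     forall i, derivable f z (delta_mx 0 i)) ->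
  (forall f i, F f -> exists2 g, F g & forall z, O z -> pd i f z = g z) ->
  forall f, F f -> smooth_on O f.
Proof.
move=> hF hd f Ff s.
have [g Fg fg] : exists2 g, F g & forall z, O z -> foldr (@pd R n) f s z = g z.
  elim: s => [|i s [g Fg fg]]; first by exists f.
  have [g' Fg' gg'] := hd g i Fg; exists g' => // z Oz /=.
  by rewrite (pd_eq_on _ fg Oz) gg'.
move=> z Oz; have [cg dg] := hF _ Fg _ Oz; split=> [|i]; last first.
  apply: near_eq_derivable (dg i); apply: near_eq_on _ Oz => w Ow.
  by rewrite fg.
by apply: continuous_eq_on cg => // w Ow; rewrite fg.
Qed.

Lemma smooth_on_eq f g : (forall z, O z -> f z = g z) -> smooth_on O f -> smooth_on O g.
Proof.
move=> fg sf; pose F g := exists2 f, smooth_on O f & forall z, O z -> f z = g z.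
apply: (@smooth_on_coind F); last by exists f.
  move=> {}g [{sf}f sf {}fg] z Oz; have [cf df] := sf [::] z Oz.
  split=> [|i]; last by apply: near_eq_derivable (df i); apply: near_eq_on _ Oz.
  exact: continuous_eq_on cf.
move=> {}g i [{sf}f sf {}fg]; exists (pd i g) => //.
exists (pd i f); last by move=> z Oz; apply: pd_eq_on.
by move=> s z Oz; have := sf (rcons s i) z Oz; rewrite foldr_rcons.
Qed.

Lemma smooth_on_pd f i : smooth_on O f -> smooth_on O (pd i f).
Proof. by move=> sf s z Oz; have := sf (rcons s i) z Oz; rewrite foldr_rcons. Qed.

(** A class stable under differentiation, made for [smooth_on_coind]. Inverses are included for the
    Poisson matrix; exp, sin and cos for the complex exponential. *)
Inductive smooth_gen : fn -> Prop :=
| SGbase f : smooth_on O f -> smooth_gen f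
| SGcst (c : R) : smooth_gen (fun=> c)
| SGadd f g : smooth_gen f -> smooth_gen g -> smooth_gen (fun z => f z + g z)
| SGmul f g : smooth_gen f -> smooth_gen g -> smooth_gen (fun z => f z * g z)
| SGinv f : (forall z, O z -> f z != 0) -> smooth_gen f -> smooth_gen (fun z => (f z)^-1)
| SGexp f : smooth_gen f -> smooth_gen (fun z => expR (f z))
| SGsin f : smooth_gen f -> smooth_gen (fun z => sin (f z))
| SGcos f : smooth_gen f -> smooth_gen (fun z => cos (f z)).

(** Restriction to the line through [z] in the direction [v] reduces this to the chain rule in one
    variable. *)
Lemma is_derive_compR (f : fn) (g : R -> R) z v (g' : R) : derivable f z v ->
  is_derive (f z) 1 g g' -> is_derive z v (fun w => g (f w)) (g' * 'D_v f z).
Proof.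
move=> df dg.
pose h (t : R) := f (z + t *: v).
have h0 : h 0 = f z by rewrite /h scale0r addr0.
have dh : is_derive (0 : R) 1 h ('D_v f z).
  have := @is_derive_line R _ f z v 0; rewrite scale0r addr0; exact.
have dgh : is_derive (0 : R) 1 (g \o h) (g' * 'D_v f z).
  by apply: is_derive1_comp; rewrite h0.
have e : (fun t : R => t^-1 *: (g (f (t *: v + z)) - g (f z))) =
    (fun t : R => t^-1 *: ((g \o h) (t *: 1 + 0) - (g \o h) 0)).
  by apply/funext => t; rewrite /h /= scale0r !addr0 [t *: 1]mulr1 [z + _]addrC.
have [d1 d2] := dgh.
by split; [rewrite /derivable /= e|rewrite /derive /= e].
Qed.

Lemma smooth_genP f : smooth_gen f -> smooth_on O f.
Proof.
have loc g : smooth_gen g -> forall z, O z -> {for z, continuous g} /\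
     forall i, derivable g z (delta_mx 0 i).
  elim=> {g} [g sg|c|g h _ IH _ IH'|g h _ IH _ IH'|g g0 _ IH|g _ IH|g _ IH|g _ IH] z Oz.
  - exact: sg [::] z Oz.
  - by split=> [|i]; [apply: cst_continuous|apply: derivable_cst].
  - have [[cg dg] [ch dh]] := (IH _ Oz, IH' _ Oz).
    by split=> [|i]; [apply: continuousD|apply: derivableD].
  - have [[cg dg] [ch dh]] := (IH _ Oz, IH' _ Oz).
    by split=> [|i]; [apply: continuousM|apply: derivableM].
  - have [cg dg] := IH _ Oz.
    by split=> [|i]; [apply: continuousV|apply: derivableV]; rewrite ?g0.
  - have [cg dg] := IH _ Oz; split=> [|i].
      by apply: (continuous_comp cg); apply: continuous_expR.
    by have [] := is_derive_compR (dg i) (is_derive_expR _).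
  - have [cg dg] := IH _ Oz; split=> [|i].
      by apply: (continuous_comp cg); apply: continuous_sin.
    by have [] := is_derive_compR (dg i) (is_derive_sin _).
  have [cg dg] := IH _ Oz; split=> [|i].
    by apply: (continuous_comp cg); apply: continuous_cos.
  by have [] := is_derive_compR (dg i) (is_derive_cos _).
apply: smooth_on_coind => // {}f i sf.
elim: sf => {f} [g sg|c|g h sg [g' sg' eg] sh [h' sh' eh]|g h sg [g' sg' eg] sh [h' sh' eh]|
  g g0 sg [g' sg' eg]|g sg [g' sg' eg]|g sg [g' sg' eg]|g sg [g' sg' eg]].
- by exists (pd i g) => //; apply/SGbase/smooth_on_pd.
- by exists (fun=> 0); [apply: SGcst|move=> z _; apply: derive_cst].
- exists (fun z => g' z + h' z); first exact: SGadd.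
  move=> z Oz; rewrite -eg // -eh //; have [[_ dg] [_ dh]] := (loc _ sg _ Oz, loc _ sh _ Oz).
  exact: deriveD.
- exists (fun z => g z * h' z + h z * g' z); first by apply: SGadd; apply: SGmul.
  move=> z Oz; rewrite -eg // -eh //; have [[_ dg] [_ dh]] := (loc _ sg _ Oz, loc _ sh _ Oz).
  exact: deriveM.
- exists (fun z => -1 * ((g z)^-1 * (g z)^-1) * g' z).
    by do !apply: SGmul => //; [apply: SGcst|apply: SGinv|apply: SGinv].
  move=> z Oz; rewrite -eg //; have [_ dg] := loc _ sg _ Oz.
  by rewrite /pd deriveV ?g0 // mulN1r -invfM -expr2.
- exists (fun z => expR (g z) * g' z); first by apply: SGmul => //; apply: SGexp.
  move=> z Oz; rewrite -eg //; have [_ dg] := loc _ sg _ Oz.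
  by rewrite /pd; have [_ ->] := is_derive_compR (dg i) (is_derive_expR _).
- exists (fun z => cos (g z) * g' z); first by apply: SGmul => //; apply: SGcos.
  move=> z Oz; rewrite -eg //; have [_ dg] := loc _ sg _ Oz.
  by rewrite /pd; have [_ ->] := is_derive_compR (dg i) (is_derive_sin _).
exists (fun z => (-1 * sin (g z)) * g' z).
  by apply: SGmul => //; apply: SGmul; [apply: SGcst|apply: SGsin].
move=> z Oz; rewrite -eg //; have [_ dg] := loc _ sg _ Oz.
by rewrite /pd; have [_ ->] := is_derive_compR (dg i) (is_derive_cos _); rewrite mulN1r.
Qed.

Lemma smooth_on_cst (c : R) : smooth_on O (fun=> c).
Proof. exact/smooth_genP/SGcst. Qed.

Lemma smooth_onD f g : smooth_on O f -> smooth_on O g -> smooth_on O (fun z => f z + g z).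
Proof. by move=> sf sg; apply: smooth_genP; apply: SGadd; apply: SGbase. Qed.

Lemma smooth_onM f g : smooth_on O f -> smooth_on O g -> smooth_on O (fun z => f z * g z).
Proof. by move=> sf sg; apply: smooth_genP; apply: SGmul; apply: SGbase. Qed.

Lemma smooth_onV f : (forall z, O z -> f z != 0) -> smooth_on O f ->
  smooth_on O (fun z => (f z)^-1).
Proof. by move=> f0 sf; apply: smooth_genP; apply: SGinv => //; apply: SGbase. Qed.

Lemma smooth_on_comp3 f : smooth_on O f -> [/\ smooth_on O (fun z => expR (f z)),
  smooth_on O (fun z => sin (f z)) & smooth_on O (fun z => cos (f z))].
Proof.
by move=> sf; split; apply: smooth_genP;
  [apply: SGexp|apply: SGsin|apply: SGcos]; apply: SGbase.
Qed.

Lemma pdC f i j z : smooth_on O f -> O z -> pd i (pd j f) z = pd j (pd i f) z.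
Proof.
move=> sf Oz; apply: (derive_comm oO Oz).
- move=> w Ow; split; first exact: (sf [::] w Ow).2.
  + exact: (sf [::] w Ow).2.
  + exact: (sf [:: j] w Ow).2.
  exact: (sf [:: i] w Ow).2.
- exact: (sf [:: i; j] z Oz).1.
exact: (sf [:: j; i] z Oz).1.
Qed.

End SmoothOn.

(** * Smooth functions in a chart *)

Section RealCharts.
Variables (R : realType) (n : nat) (M : manifold R n) (a : chart M).
Implicit Types (f g : M -> R) (x : M) (i j : 'I_n).
Local Notation O := (coord a @` dom a).

Lemma chart_pointK z : O z -> coord a (point a z) = z /\ dom a (point a z).
Proof. by case=> x dx <-; rewrite coordK. Qed.

Lemma rsmooth_eq f g : (forall x, dom a x -> f x = g x) -> rsmooth a f -> rsmooth a g.
Proof.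
move=> fg sf; apply: (smooth_on_eq (@coord_dom_open _ _ M a) _ sf) => z.
by move=> /chart_pointK[_ dz] /=; apply: fg.
Qed.

Lemma rpd_eq f g i x : (forall x, dom a x -> f x = g x) -> dom a x ->
  rpd a i f x = rpd a i g x.
Proof.
move=> fg dx; apply: (pd_eq_on (@coord_dom_open _ _ M a)); last by exists x.
by move=> z /chart_pointK[_ dz] /=; apply: fg.
Qed.

Lemma rsmooth_cst (c : R) : rsmooth a (fun=> c).
Proof. exact: (smooth_on_cst (@coord_dom_open _ _ M a)). Qed.

Lemma rsmoothD f g : rsmooth a f -> rsmooth a g -> rsmooth a (fun x => f x + g x).
Proof. exact: (smooth_onD (@coord_dom_open _ _ M a)). Qed.

Lemma rsmoothM f g : rsmooth a f -> rsmooth a g -> rsmooth a (fun x => f x * g x).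
Proof. exact: (smooth_onM (@coord_dom_open _ _ M a)). Qed.

Lemma rsmoothN f : rsmooth a f -> rsmooth a (fun x => - f x).
Proof.
move=> sf; apply: (@rsmooth_eq (fun x => -1 * f x)); first by move=> x _; rewrite mulN1r.
exact: (rsmoothM (rsmooth_cst (-1)) sf).
Qed.

Lemma rsmoothB f g : rsmooth a f -> rsmooth a g -> rsmooth a (fun x => f x - g x).
Proof. by move=> sf sg; apply: (rsmoothD sf (rsmoothN sg)). Qed.

Lemma rsmoothV f : (forall x, dom a x -> f x != 0) -> rsmooth a f ->
  rsmooth a (fun x => (f x)^-1).
Proof.
move=> f0; apply: (smooth_onV (@coord_dom_open _ _ M a)) => z.
by move=> /chart_pointK[_ dz]; apply: f0.
Qed.

Lemma rsmooth_sum (T : Type) (s : seq T) (Q : pred T) (F : T -> M -> R) :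
  (forall t, rsmooth a (F t)) -> rsmooth a (fun x => \sum_(t <- s | Q t) F t x).
Proof.
move=> h; elim: s => [|t s IH].
  by under eq_fun do rewrite big_nil; apply: rsmooth_cst.
under eq_fun do rewrite big_cons.
by case: (Q t); [apply: (rsmoothD (h t) IH)|apply: IH].
Qed.

Lemma rsmooth_prod (T : Type) (s : seq T) (F : T -> M -> R) :
  (forall t, rsmooth a (F t)) -> rsmooth a (fun x => \prod_(t <- s) F t x).
Proof.
move=> h; elim: s => [|t s IH].
  by under eq_fun do rewrite big_nil; apply: rsmooth_cst.
under eq_fun do rewrite big_cons.
exact: (rsmoothM (h t) IH).
Qed.

Lemma rsmooth_det m (A : M -> 'M[R]_m) : (forall k l, rsmooth a (fun x => A x k l)) ->
  rsmooth a (fun x => \det (A x)).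
Proof.
move=> sA; apply: rsmooth_sum => s; apply: rsmoothM; first exact: rsmooth_cst.
by apply: rsmooth_prod => k; apply: sA.
Qed.

Lemma rsmooth_rpd f i : rsmooth a f -> rsmooth a (rpd a i f).
Proof.
move=> sf; apply: (smooth_on_eq (@coord_dom_open _ _ M a) _ (smooth_on_pd i sf)) => z Oz.
by rewrite /rpd /= (chart_pointK Oz).1.
Qed.

Lemma rsmooth_derivable f x i : rsmooth a f -> dom a x ->
  derivable (f \o point a) (coord a x) (delta_mx 0 i).
Proof. by move=> sf dx; have [|_] := sf [::] (coord a x); [exists x|apply]. Qed.

Lemma rpd_cst (c : R) i x : rpd a i (fun=> c) x = 0.
Proof. exact: derive_cst. Qed.

Lemma rpdD f g i x : rsmooth a f -> rsmooth a g -> dom a x ->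
  rpd a i (fun x => f x + g x) x = rpd a i f x + rpd a i g x.
Proof. by move=> sf sg dx; apply: deriveD; apply: rsmooth_derivable. Qed.

Lemma rpdM f g i x : rsmooth a f -> rsmooth a g -> dom a x ->
  rpd a i (fun x => f x * g x) x = f x * rpd a i g x + g x * rpd a i f x.
Proof.
move=> sf sg dx; rewrite -{2 4}(coordK dx).
by apply: deriveM; apply: rsmooth_derivable.
Qed.

Lemma rpdB f g i x : rsmooth a f -> rsmooth a g -> dom a x ->
  rpd a i (fun x => f x - g x) x = rpd a i f x - rpd a i g x.
Proof. by move=> sf sg dx; apply: deriveB; apply: rsmooth_derivable. Qed.

Lemma rpd_sum (T : Type) (s : seq T) (F : T -> M -> R) i x :
  (forall t, rsmooth a (F t)) -> dom a x ->
  rpd a i (fun x => \sum_(t <- s) F t x) x = \sum_(t <- s) rpd a i (F t) x.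
Proof.
move=> h dx; elim: s => [|t s IH].
  by under eq_fun do rewrite big_nil; rewrite big_nil rpd_cst.
under eq_fun do rewrite big_cons.
by rewrite big_cons rpdD ?IH //; apply: rsmooth_sum.
Qed.

Lemma rsmooth_comp3 f : rsmooth a f -> [/\ rsmooth a (fun x => expR (f x)),
  rsmooth a (fun x => sin (f x)) & rsmooth a (fun x => cos (f x))].
Proof. exact: (smooth_on_comp3 (@coord_dom_open _ _ M a)). Qed.

Lemma rpd_comp (h : R -> R) f i x h' : rsmooth a f -> dom a x ->
  is_derive (f x) 1 h h' -> rpd a i (fun x => h (f x)) x = h' * rpd a i f x.
Proof.
move=> sf dx; rewrite -{1}(coordK dx) => dh.
by have [_] := is_derive_compR (rsmooth_derivable (i := i) sf dx) dh.
Qed.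

Lemma rpdC f i j x : rsmooth a f -> dom a x ->
  rpd a i (rpd a j f) x = rpd a j (rpd a i f) x.
Proof.
move=> sf dx; have Ox : O (coord a x) by exists x.
have e k l : rpd a k (rpd a l f) x = pd k (pd l (f \o point a)) (coord a x).
  apply: (pd_eq_on (@coord_dom_open _ _ M a)) Ox => z Oz.
  by rewrite /rpd /= (chart_pointK Oz).1.
by rewrite !e; apply: (pdC (@coord_dom_open _ _ M a)).
Qed.

Lemma rsmooth_continuous f x : rsmooth a f -> dom a x -> {for x, continuous f}.
Proof.
move=> sf dx; have Ox : O (coord a x) by exists x.
have cf := (sf [::] _ Ox).1.
have cc := Defs.coord_continuous dx.
have := continuous_comp cc cf.
have e : (f \o point a) (coord a x) = f x by rewrite /= coordK.
rewrite /prop_for /continuous_at /= coordK // => h.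
apply: cvg_trans h; apply: (@near_eq_cvg _ _ (nbhs x)).
apply: filterS (open_nbhs_nbhs (conj (@dom_open _ _ M a) dx)) => y dy /=.
by rewrite coordK.
Qed.

End RealCharts.

Section ComplexCharts.
Variables (R : realType) (n : nat) (M : manifold R n) (a : chart M).
Local Notation C := R[i].
Local Notation Re := complex.Re.
Local Notation Im := complex.Im.
Implicit Types (f g : M -> C) (x : M) (i j : 'I_n).

Lemma complex_ext (u v : C) : Re u = Re v -> Im u = Im v -> u = v.
Proof. by case: u v => [? ?] [? ?] /= -> ->. Qed.
Lemma cReD (u v : C) : Re (u + v) = Re u + Re v. Proof. by case: u v => [? ?] []. Qed.
Lemma cImD (u v : C) : Im (u + v) = Im u + Im v. Proof. by case: u v => [? ?] []. Qed.
Lemma cReM (u v : C) : Re (u * v) = Re u * Re v - Im u * Im v.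
Proof. by case: u v => [? ?] []. Qed.
Lemma cImM (u v : C) : Im (u * v) = Re u * Im v + Im u * Re v.
Proof. by case: u v => [? ?] []. Qed.

Lemma csmooth_eq f g : (forall x, dom a x -> f x = g x) -> csmooth a f -> csmooth a g.
Proof.
by move=> fg [f1 f2]; split; [apply: rsmooth_eq f1|apply: rsmooth_eq f2] => x /fg ->.
Qed.

Lemma cpd_eq f g i x : (forall x, dom a x -> f x = g x) -> dom a x ->
  cpd a i f x = cpd a i g x.
Proof.
by move=> fg dx; apply: complex_ext; apply: rpd_eq => // y /fg ->.
Qed.

Lemma csmooth_cst (c : C) : csmooth a (fun=> c).
Proof. by split; apply: rsmooth_cst. Qed.

Lemma csmooth_real (f : M -> R) : rsmooth a f -> csmooth a (fun x => (f x)%:C).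
Proof. by move=> sf; split; [apply: sf|apply: rsmooth_cst]. Qed.

Lemma csmoothD f g : csmooth a f -> csmooth a g -> csmooth a (fun x => f x + g x).
Proof.
move=> [f1 f2] [g1 g2]; split.
  by apply: (rsmooth_eq _ (rsmoothD f1 g1)) => x _; rewrite cReD.
by apply: (rsmooth_eq _ (rsmoothD f2 g2)) => x _; rewrite cImD.
Qed.

Lemma csmoothM f g : csmooth a f -> csmooth a g -> csmooth a (fun x => f x * g x).
Proof.
move=> [f1 f2] [g1 g2]; split.
  by apply: (rsmooth_eq _ (rsmoothB (rsmoothM f1 g1) (rsmoothM f2 g2))) => x _; rewrite cReM.
by apply: (rsmooth_eq _ (rsmoothD (rsmoothM f1 g2) (rsmoothM f2 g1))) => x _; rewrite cImM.
Qed.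

Lemma csmooth_sum (T : Type) (s : seq T) (Q : pred T) (F : T -> M -> C) :
  (forall t, Q t -> csmooth a (F t)) -> csmooth a (fun x => \sum_(t <- s | Q t) F t x).
Proof.
apply: closed_sum; [exact: csmooth_cst|exact: csmoothD].
Qed.

Lemma csmooth_cpd f i : csmooth a f -> csmooth a (cpd a i f).
Proof. by move=> [f1 f2]; split; apply: rsmooth_rpd. Qed.

Lemma cpd_cst (c : C) i x : cpd a i (fun=> c) x = 0.
Proof. by apply: complex_ext; apply: rpd_cst. Qed.

Lemma cpd_real (f : M -> R) i x : cpd a i (fun x => (f x)%:C) x = (rpd a i f x)%:C.
Proof. by apply: complex_ext => //; apply: rpd_cst. Qed.

Lemma cpdD f g i x : csmooth a f -> csmooth a g -> dom a x ->
  cpd a i (fun x => f x + g x) x = cpd a i f x + cpd a i g x.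
Proof.
move=> [f1 f2] [g1 g2] dx; apply: complex_ext; rewrite ?cReD ?cImD /= -rpdD //;
by apply: rpd_eq => // y _; rewrite ?cReD ?cImD.
Qed.

Lemma cpdM f g i x : csmooth a f -> csmooth a g -> dom a x ->
  cpd a i (fun x => f x * g x) x = cpd a i f x * g x + f x * cpd a i g x.
Proof.
move=> [f1 f2] [g1 g2] dx; apply: complex_ext.
  rewrite cReD !cReM /= (@rpd_eq _ _ _ _ _
    (fun x => Re (f x) * Re (g x) - Im (f x) * Im (g x))) //; last first.
    by move=> y _; rewrite cReM.
  rewrite (rpdB i (rsmoothM f1 g1) (rsmoothM f2 g2) dx) (rpdM i f1 g1 dx).
  by rewrite (rpdM i f2 g2 dx); ring.
rewrite cImD !cImM /= (@rpd_eq _ _ _ _ _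
  (fun x => Re (f x) * Im (g x) + Im (f x) * Re (g x))) //; last first.
  by move=> y _; rewrite cImM.
rewrite (rpdD i (rsmoothM f1 g2) (rsmoothM f2 g1) dx) (rpdM i f1 g2 dx).
by rewrite (rpdM i f2 g1 dx); ring.
Qed.

Lemma cpdZ (c : C) f i x : csmooth a f -> dom a x ->
  cpd a i (fun x => c * f x) x = c * cpd a i f x.
Proof.
by move=> sf dx; rewrite (cpdM i (csmooth_cst c) sf dx) cpd_cst mul0r add0r.
Qed.

Lemma cpd_sum (T : Type) (s : seq T) (Q : pred T) (F : T -> M -> C) i x :
  (forall t, Q t -> csmooth a (F t)) -> dom a x ->
  cpd a i (fun x => \sum_(t <- s | Q t) F t x) x = \sum_(t <- s | Q t) cpd a i (F t) x.
Proof.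
move=> h dx; elim: s => [|t s IH].
  by under eq_fun do rewrite big_nil; rewrite big_nil cpd_cst.
under eq_fun do rewrite big_cons.
rewrite big_cons; case Qt : (Q t) => //.
by rewrite cpdD ?IH //; [apply: h|apply: csmooth_sum].
Qed.

Lemma cpdC f i j x : csmooth a f -> dom a x ->
  cpd a i (cpd a j f) x = cpd a j (cpd a i f) x.
Proof. by move=> [f1 f2] dx; apply: complex_ext; apply: rpdC. Qed.

Lemma csmooth_cexp f : csmooth a f -> csmooth a (fun x => cexp (f x)).
Proof.
move=> [f1 f2]; have [e1 _ _] := rsmooth_comp3 f1; have [_ s2 c2] := rsmooth_comp3 f2.
by split; apply: rsmoothM.
Qed.

Lemma cpd_cexp f i x : csmooth a f -> dom a x ->
  cpd a i (fun x => cexp (f x)) x = cexp (f x) * cpd a i f x.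
Proof.
move=> [f1 f2] dx; have [e1 _ _] := rsmooth_comp3 f1; have [_ s2 c2] := rsmooth_comp3 f2.
apply: complex_ext; rewrite ?cReM ?cImM /= rpdM //.
  rewrite (rpd_comp i f1 dx (is_derive_expR _)) (rpd_comp i f2 dx (is_derive_cos _)).
  by ring.
rewrite (rpd_comp i f1 dx (is_derive_expR _)) (rpd_comp i f2 dx (is_derive_sin _)).
by ring.
Qed.

End ComplexCharts.

(** * The Poisson bivector in a chart is smooth and parallel *)

Section SymplecticCharts.
Variables (R : realType) (n : nat) (M : manifold R n) (w : symplectic_form M).
Variables (G : symplectic_connection w) (a : chart M).
Local Notation P := (poisson w a).

(** Cramer's rule: the entries are cofactors over the determinant, which has no zero in the
    chart. *)
Lemma rsmooth_poisson s t : rsmooth a (fun x => P x s t).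
Proof.
have sd : rsmooth a (fun x => (\det (w a x))^-1).
  apply: rsmoothV; first by move=> x /(omega_nondeg w); rewrite unitmxE unitfE.
  by apply: rsmooth_det => i j; apply: omega_smooth.
have sc : rsmooth a (fun x => cofactor (w a x) t s).
  apply: rsmoothM; first exact: rsmooth_cst.
  apply: rsmooth_det => i j; have := @omega_smooth _ _ _ w a (lift t i) (lift s j).
  by apply: rsmooth_eq => x _; rewrite !mxE.
apply: (rsmooth_eq _ (rsmoothM sd sc)) => x /(omega_nondeg w) ux.
by rewrite /poisson /invmx ux !mxE.
Qed.

(** The inverse of a parallel form is parallel: differentiate [P w = 1], insert [chr_symplectic],
    and multiply by [P] on the right. *)
Lemma rpd_poisson i s t x : dom a x ->
  rpd a i (fun y => P y s t) x =
  - \sum_p (G a x s i p * P x p t + G a x t i p * P x s p).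
Proof.
move=> dx; have ux := omega_nondeg w dx.
have key k : \sum_j rpd a i (fun y => P y s j) x * w a x j k =
   - \sum_j P x s j * rpd a i (fun y => w a y j k) x.
  apply/eqP; rewrite -addr_eq0 -big_split /=; apply/eqP.
  have z : rpd a i (fun y => \sum_j P y s j * w a y j k) x = 0.
    pose c : R := (s == k)%:R; transitivity (rpd a i (fun=> c) x); last exact: rpd_cst.
    apply: rpd_eq dx => y dy.
    have := congr1 (fun A : 'M[R]_n => A s k) (mulVmx (omega_nondeg w dy)).
    by rewrite /= mxE [1%:M s k]mxE.
  rewrite -[RHS]z.
  rewrite rpd_sum //; last first.
    by move=> j; apply: rsmoothM; [apply: rsmooth_poisson|apply: omega_smooth].
  apply: eq_bigr => j _; rewrite rpdM //; [|exact: rsmooth_poisson|exact: omega_smooth].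
  by rewrite addrC; congr (_ + _); apply: mulrC.
pose Gm := \matrix_(l, j) G a x l i j.
pose dP := \row_j rpd a i (fun y => P y s j) x.
have wV : w a x *m P x = 1%:M by apply: mulmxV.
have Vw : P x *m w a x = 1%:M by apply: mulVmx.
have edP : dP *m w a x = - (row s (P x) *m (Gm^T *m w a x + w a x *m Gm)).
  apply/rowP => k; rewrite !mxE; under eq_bigr do rewrite mxE; rewrite key.
  congr (- _); apply: eq_bigr => j _; rewrite !mxE; congr (_ * _).
  rewrite (chr_symplectic G i j k dx) big_split /=; congr (_ + _); apply: eq_bigr => l _; rewrite !mxE //.
  by rewrite mulrC.
have : dP = - (row s (P x) *m Gm^T + row s Gm *m P x).
  rewrite -[LHS]mulmx1 -wV mulmxA edP mulNmx mulmxDr mulmxDl -!mulmxA wV mulmx1.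
  by rewrite !mulmxA -[row s (P x) *m w a x]row_mul Vw row1 -rowE.
move=> /(congr1 (fun A : 'rV[R]_n => A 0 t)); rewrite !mxE => ->; congr (- _).
rewrite -big_split; apply: eq_bigr => p _; rewrite !mxE /=.
by rewrite addrC; congr (_ + _); rewrite mulrC.
Qed.

End SymplecticCharts.

(** * The Fedosov connection is a derivation *)

Section Derivation.
Variables (R : realType) (n : nat) (M : manifold R n) (w : symplectic_form M).
Variables (G : symplectic_connection w) (a : chart M) (i : 'I_n).
Local Notation C := R[i].
Local Notation ys := (yseries R n).
Local Notation wl := (weyl R n).
Local Notation P := (poisson w a).
Implicit Types (x z : M) (f g : M -> ys) (s t : M -> wl) (j l p q : 'I_n).

Definition ysmooth f := forall J, csmooth a (fun z => f z J).
Definition wsmooth s := forall k, ysmooth (s^~ k).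

Lemma csmooth_poisson p q v : csmooth a v -> csmooth a (fun z => (P z p q)%:C * v z).
Proof. by move=> sv; apply: (csmoothM (csmooth_real (rsmooth_poisson w p q)) sv). Qed.

Lemma csmoothZ (c : C) v : csmooth a v -> csmooth a (fun z => c * v z).
Proof. by move=> sv; apply: (csmoothM (csmooth_cst a c) sv). Qed.

Lemma ysmooth_yder p f : ysmooth f -> ysmooth (fun z => yder p (f z)).
Proof. by move=> sf J; apply: csmoothZ. Qed.

Lemma ysmoothZ (c : M -> C) f : csmooth a c -> ysmooth f -> ysmooth (fun z => c z *: f z).
Proof. by move=> sc sf J; apply: (csmoothM sc (sf J)). Qed.

Lemma ysmooth_sum (T : Type) (r : seq T) (F : T -> M -> ys) :
  (forall e, ysmooth (F e)) -> ysmooth (fun z => \sum_(e <- r) F e z).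
Proof.
move=> h J; under eq_fun do rewrite fct_sumE.
by apply: csmooth_sum => e _; apply: h.
Qed.

Lemma ysmooth_bidiff r f g : ysmooth f -> ysmooth g ->
  ysmooth (fun z => bidiff (P z) r (f z) (g z)).
Proof.
move=> sf sg J; apply: bidiff_closed => [||||I K _].
- exact: csmooth_cst.
- exact: csmoothD.
- exact: csmoothZ.
- exact: csmooth_poisson.
- exact: csmoothM.
Qed.

Lemma wsmooth_circ s t : wsmooth s -> wsmooth t ->
  wsmooth (fun z => circ (P z) (s z) (t z)).
Proof.
move=> ss st k J; apply: circ_closed => [||||p q I K _].
- exact: csmooth_cst.
- exact: csmoothD.
- exact: csmoothZ.
- exact: csmooth_poisson.
- by apply: csmoothM; [apply: ss|apply: st].
Qed.

Lemma wsmooth_wone : wsmooth (fun=> wone).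
Proof. by move=> k J; apply: csmooth_cst. Qed.

Lemma wsmooth_wpow s m : wsmooth s -> wsmooth (fun z => wpow (P z) (s z) m).
Proof.
by move=> ss; elim: m => [|m IH]; [apply: wsmooth_wone|apply: wsmooth_circ].
Qed.

Lemma wsmoothZ (c : M -> C) s : csmooth a c -> wsmooth s -> wsmooth (fun z => c z *: s z).
Proof. by move=> sc ss k; apply: ysmoothZ. Qed.

Lemma wsmoothD s t : wsmooth s -> wsmooth t -> wsmooth (fun z => s z + t z).
Proof. by move=> ss st k J; apply: csmoothD; [apply: ss|apply: st]. Qed.

(* The [dx^i]-component of [- delta + partial] is [hder] below: the derivative
   [cpdy] of the coefficients plus the fibrewise operator [vert]. *)
Definition vert x (f : ys) : ys :=
  - (\sum_j \sum_l (G a x l i j)%:C *: ymono j (yder l f)) - yder i f.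

Lemma vert_is_linear x : linear (vert x).
Proof.
move=> c f g; rewrite /vert (linearP (@yder R n i)) scalerBr scalerN addrACA -!opprD; congr (- (_ + _)).
rewrite scaler_sumr -big_split; apply: eq_bigr => j _ /=.
rewrite scaler_sumr -big_split; apply: eq_bigr => l _ /=.
by rewrite (linearP (@yder R n l)) (linearP (@ymono R n j)) scalerDr !scalerA mulrC.
Qed.
HB.instance Definition _ x := GRing.isLinear.Build C ys ys _ (vert x) (@vert_is_linear x).

Lemma vert_mul x (f g : ys) : vert x (ymul f g) = ymul (vert x f) g + ymul f (vert x g).
Proof.
have sumr (T : Type) (r : seq T) (h : ys) (F : T -> ys) :
  ymul h (\sum_(e <- r) F e) = \sum_(e <- r) ymul h (F e) by apply: linear_sum.
have subr (h h1 h2 : ys) : ymul h (- h1 - h2) = - (ymul h h1) - ymul h h2.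
  by rewrite linearB; congr (_ - _); apply: linearN.
rewrite /vert yder_mul [ymul (_ - _) g]ymulC !subr [RHS]addrACA.
rewrite (ymulC (yder i f)) opprD; congr (_ + _); rewrite -opprD; congr (- _).
rewrite !sumr -big_split; apply: eq_bigr => j _ /=.
rewrite !sumr -big_split; apply: eq_bigr => l _ /=.
have scale (h h1 : ys) (c : C) : ymul h (c *: h1) = c *: ymul h h1 by apply: linearZ.
have monoD (h h1 : ys) : ymono j (h + h1) = ymono j h + ymono j h1 by apply: linearD.
rewrite !scale -scalerDr; congr (_ *: _).
by rewrite yder_mul monoD (ymulC f (yder l g)) -!ymul_mono !(ymulC (ymono _ _)).
Qed.

(** The extra term arises when [d_p] meets the factor [y_j] of the connection term. In [hder_bidiff]
    it is compensated by the derivative of the bivector. *)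
Lemma vert_yder x p (f : ys) :
  vert x (yder p f) = yder p (vert x f) + \sum_l (G a x l i p)%:C *: yder l f.
Proof.
have e j : \sum_l (G a x l i j)%:C *: ymono j (yder l (yder p f)) =
    yder p (\sum_l (G a x l i j)%:C *: ymono j (yder l f)) -
    (p == j)%:R *: (\sum_l (G a x l i j)%:C *: yder l f).
  rewrite linear_sum scaler_sumr -sumrB; apply: eq_bigr => l _ /=.
  rewrite linearZ /= yder_mono scalerDr !scalerA mulrC (yderC p).
  by rewrite [X in X - _]addrC addrK.
have e2 : \sum_j \sum_l (G a x l i j)%:C *: ymono j (yder l (yder p f)) =
    yder p (\sum_j \sum_l (G a x l i j)%:C *: ymono j (yder l f)) -
    \sum_l (G a x l i p)%:C *: yder l f.
  rewrite linear_sum; under eq_bigr do rewrite e; rewrite sumrB /=; congr (_ - _).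
  rewrite (bigD1 p) //= eqxx scale1r [X in _ + X]big1 ?addr0 // => j /negPf.
  by rewrite eq_sym => ->; rewrite scale0r.
by rewrite /vert e2 opprB linearB linearN /= (yderC i) -addrA addrC.
Qed.

Definition cpdy f x : ys := fun J => cpd a i (fun z => f z J) x.
Definition hder f x : ys := cpdy f x + vert x (f x).

Lemma cpdyE f x J : cpdy f x J = cpd a i (fun z => f z J) x. Proof. by []. Qed.

Lemma cpdy_mul f g x : ysmooth f -> ysmooth g -> dom a x ->
  cpdy (fun z => ymul (f z) (g z)) x = ymul (cpdy f x) (g x) + ymul (f x) (cpdy g x).
Proof.
move=> sf sg dx; apply/funext => J; rewrite ysD cpdyE /ymul cpd_sum //; last first.
  by move=> I _; apply: csmoothM.
by rewrite -big_split; apply: eq_bigr => I _; rewrite (cpdM i (sf _) (sg _) dx).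
Qed.

Lemma cpdy_yder p f x : ysmooth f -> dom a x ->
  cpdy (fun z => yder p (f z)) x = yder p (cpdy f x).
Proof. by move=> sf dx; apply/funext => J; apply: (cpdZ _ _ (sf _) dx). Qed.

Lemma hder_mul f g x : ysmooth f -> ysmooth g -> dom a x ->
  hder (fun z => ymul (f z) (g z)) x = ymul (hder f x) (g x) + ymul (f x) (hder g x).
Proof.
move=> sf sg dx.
by rewrite /hder cpdy_mul // vert_mul ymulDl (linearD _ (cpdy g x)) /= addrACA.
Qed.

Lemma hder_yder p f x : ysmooth f -> dom a x -> hder (fun z => yder p (f z)) x =
  yder p (hder f x) + \sum_l (G a x l i p)%:C *: yder l (f x).
Proof. by move=> sf dx; rewrite /hder cpdy_yder // vert_yder (linearD _ (cpdy f x)) addrA. Qed.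

Lemma hderZ (c : M -> C) f x : csmooth a c -> ysmooth f -> dom a x ->
  hder (fun z => c z *: f z) x = cpd a i c x *: f x + c x *: hder f x.
Proof.
move=> sc sf dx; rewrite /hder.
have -> : vert x (c x *: f x) = c x *: vert x (f x) by rewrite linearZ.
rewrite (scalerDr _ (cpdy f x)) addrA; congr (_ + _).
by apply/funext => J; apply: (cpdM i sc (sf J) dx).
Qed.

Lemma hderD f g x : ysmooth f -> ysmooth g -> dom a x ->
  hder (fun z => f z + g z) x = hder f x + hder g x.
Proof.
move=> sf sg dx; rewrite /hder.
have -> : vert x (f x + g x) = vert x (f x) + vert x (g x) by rewrite linearD.
rewrite [RHS]addrACA; congr (_ + _).
by apply/funext => J; apply: (cpdD _ (sf J) (sg J) dx).
Qed.

Lemma hder_sum (T : Type) (r : seq T) (F : T -> M -> ys) x :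
  (forall e, ysmooth (F e)) -> dom a x ->
  hder (fun z => \sum_(e <- r) F e z) x = \sum_(e <- r) hder (F e) x.
Proof.
move=> h dx; rewrite /hder big_split.
have -> : vert x (\sum_(e <- r) F e x) = \sum_(e <- r) vert x (F e x) by rewrite linear_sum.
congr (_ + _).
apply/funext => J; rewrite cpdyE fct_sumE; under eq_fun do rewrite fct_sumE.
by rewrite cpd_sum // => e _; apply: h.
Qed.

Lemma bidiffDr (Q : 'M[R]_n) r (f g g' : ys) :
  bidiff Q r f (g + g') = bidiff Q r f g + bidiff Q r f g'.
Proof. exact: linearD. Qed.

(* The Christoffel terms cancel because the connection is symplectic. *)
Lemma hder_bidiff r f g x : ysmooth f -> ysmooth g -> dom a x ->
  hder (fun z => bidiff (P z) r (f z) (g z)) x =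
  bidiff (P x) r (hder f x) (g x) + bidiff (P x) r (f x) (hder g x).
Proof.
move=> sf sg dx; elim: r f g sf sg => [|r IH] f g sf sg; first exact: hder_mul.
pose B p q := bidiff (P x) r (yder p (f x)) (yder q (g x)).
have sP p q : csmooth a (fun z => (P z p q)%:C) := csmooth_real (rsmooth_poisson w p q).
have sB p q : ysmooth (fun z => bidiff (P z) r (yder p (f z)) (yder q (g z))) :=
  ysmooth_bidiff r (ysmooth_yder p sf) (ysmooth_yder q sg).
have sPB p q := ysmoothZ (sP p q) (sB p q).
have sPBs p := @ysmooth_sum _ (index_enum 'I_n) _ (sPB p).
rewrite !bidiffS (hder_sum _ sPBs dx).
(* Three groups for each pair of indices: the derivative of the bivector, the Christoffel terms from
   [hder_yder], and the Leibniz terms that remain. The first two cancel by [rpd_poisson] once the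
   indices are renamed. *)
transitivity (\sum_p \sum_q ((rpd a i (fun z => P z p q) x)%:C *: B p q +
   (P x p q)%:C *: (\sum_l (G a x l i p)%:C *: B l q + \sum_l (G a x l i q)%:C *: B p l) +
   ((P x p q)%:C *: bidiff (P x) r (yder p (hder f x)) (yder q (g x)) +
    (P x p q)%:C *: bidiff (P x) r (yder p (f x)) (yder q (hder g x))))).
  apply: eq_bigr => p _; rewrite (hder_sum _ (sPB p) dx).
  apply: eq_bigr => q _; rewrite (hderZ (sP p q) (sB p q) dx) cpd_real.
  rewrite (IH _ _ (ysmooth_yder p sf) (ysmooth_yder q sg)).
  rewrite -addrA; congr (_ + _); rewrite (hder_yder p sf dx) (hder_yder q sg dx).
  rewrite -!scalerDr; congr (_ *: _).
  rewrite bidiffDl bidiffDr addrACA [RHS]addrC; congr (_ + _).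
  rewrite bidiff_suml linear_sum /=; congr (_ + _); apply: eq_bigr => l _.
    by rewrite bidiffZl.
  by rewrite linearZ.
under eq_bigr do rewrite big_split; rewrite big_split /=.
rewrite [X in X + _](_ : _ = 0) ?add0r; last first.
  under eq_bigr do rewrite big_split; rewrite big_split /=.
  have -> : \sum_p \sum_q (P x p q)%:C *:
      (\sum_l (G a x l i p)%:C *: B l q + \sum_l (G a x l i q)%:C *: B p l) =
    \sum_p \sum_q (\sum_l (G a x p i l * P x l q + G a x q i l * P x p l))%:C *: B p q.
    under eq_bigr do under eq_bigr do rewrite scalerDr !scaler_sumr.
    under eq_bigr do rewrite big_split; rewrite big_split /=.
    under [RHS]eq_bigr do under eq_bigr do rewrite big_split rmorphD scalerDl.
    under [RHS]eq_bigr do rewrite big_split; rewrite [RHS]big_split /=; congr (_ + _).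
      rewrite exchange_big [RHS]exchange_big; apply: eq_bigr => q _ /=.
      rewrite exchange_big; apply: eq_bigr => p _ /=.
      rewrite rmorph_sum scaler_suml; apply: eq_bigr => l _ /=.
      by rewrite scalerA rmorphM mulrC.
    apply: eq_bigr => p _; rewrite exchange_big; apply: eq_bigr => q _ /=.
    rewrite rmorph_sum scaler_suml; apply: eq_bigr => l _ /=.
    by rewrite scalerA rmorphM mulrC.
  rewrite -big_split big1 // => p _; rewrite -big_split big1 // => q _ /=.
  by rewrite (rpd_poisson G) // rmorphN scaleNr addNr.
by rewrite -big_split; apply: eq_bigr => p _; rewrite big_split.
Qed.

Definition whder s x : wl := fun k => hder (s^~ k) x.

Lemma whder_circ s t x : wsmooth s -> wsmooth t -> dom a x ->
  whder (fun z => circ (P z) (s z) (t z)) x =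
  circ (P x) (whder s x) (t x) + circ (P x) (s x) (whder t x).
Proof.
move=> ss st dx; apply/funext => k; rewrite wlD !circE /whder.
under eq_fun do rewrite circE.
have sB r (p : 'I_(k - r).+1) : ysmooth
    (fun z => bidiff (P z) r (s z p) (t z (k - r - p)%N)) := ysmooth_bidiff r (ss _) (st _).
have sc r : csmooth a (fun=> @moyal_coef R r) := csmooth_cst a _.
have scB r (p : 'I_(k - r).+1) := ysmoothZ (sc r) (sB r p).
have scBs (r : 'I_k.+1) := @ysmooth_sum _ (index_enum 'I_(k - r).+1) _ (scB r).
rewrite (hder_sum _ scBs dx) -big_split; apply: eq_bigr => r _ /=.
rewrite (hder_sum _ (scB r) dx) -big_split; apply: eq_bigr => p _ /=.
rewrite (hderZ (sc r) (sB r p) dx) cpd_cst scale0r add0r.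
by rewrite (hder_bidiff r (ss _) (st _) dx) scalerDr.
Qed.

Variable F : fedosov G.

(** One chart, one direction and arbitrary maps into the fibre: partial sums can be differentiated
    without first being made into global sections. *)
Definition fedd s x : wl := whder s x - wcomm (P x) (gam F a x i) (s x).

Lemma fedDE S x : fedD F S a x i = fedd (S a) x.
Proof.
apply/funext => k; apply/funext => J.
rewrite /fedd wlD wlN ysD /fedD; congr (_ - _).
rewrite /whder /hder /vert !ysD addrC /covder addrA; congr (_ - _ - _).
rewrite fct_sumE; apply: eq_bigr => j _; rewrite fct_sumE; apply: eq_bigr => l _.
by rewrite ysZ /ymono; congr (_ * _); case: (J j).
Qed.

Lemma fedd_circ s t x : wsmooth s -> wsmooth t -> dom a x ->
  fedd (fun z => circ (P z) (s z) (t z)) x =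
  circ (P x) (fedd s x) (t x) + circ (P x) (s x) (fedd t x).
Proof.
move=> ss st dx; rewrite /fedd whder_circ // wcomm_circ circBl (linearB _ (whder t x)) /=.
by rewrite opprD addrACA.
Qed.

Lemma whderZ (c : M -> C) s x : csmooth a c -> wsmooth s -> dom a x ->
  whder (fun z => c z *: s z) x = cpd a i c x *: s x + c x *: whder s x.
Proof. by move=> sc ss dx; apply/funext => k; apply: (hderZ sc (ss k) dx). Qed.

Lemma whderD s t x : wsmooth s -> wsmooth t -> dom a x ->
  whder (fun z => s z + t z) x = whder s x + whder t x.
Proof. by move=> ss st dx; apply/funext => k; apply: (hderD (ss k) (st k) dx). Qed.

Lemma feddZ (c : M -> C) s x : csmooth a c -> wsmooth s -> dom a x ->
  fedd (fun z => c z *: s z) x = cpd a i c x *: s x + c x *: fedd s x.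
Proof.
move=> sc ss dx; rewrite /fedd (whderZ sc ss dx).
have -> : wcomm (P x) (gam F a x i) (c x *: s x) = c x *: wcomm (P x) (gam F a x i) (s x).
  exact: linearZ.
by rewrite (scalerBr _ (whder s x)) addrA.
Qed.

Lemma feddD s t x : wsmooth s -> wsmooth t -> dom a x ->
  fedd (fun z => s z + t z) x = fedd s x + fedd t x.
Proof.
move=> ss st dx; rewrite /fedd (whderD ss st dx).
have -> : wcomm (P x) (gam F a x i) (s x + t x) =
    wcomm (P x) (gam F a x i) (s x) + wcomm (P x) (gam F a x i) (t x) by apply: linearD.
by rewrite opprD addrACA.
Qed.

Lemma fedd_wone x : fedd (fun=> wone) x = 0.
Proof.
rewrite /fedd wcomm1 subr0; apply/funext => k; rewrite /whder /hder /vert.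
have -> : cpdy (fun=> wone k) x = 0 by apply/funext => J; apply: cpd_cst.
rewrite yder_wone subr0 add0r big1 ?oppr0 // => j _; rewrite big1 // => l _.
by rewrite yder_wone linear0 scaler0.
Qed.

Section Exponential.
Variables (u : M -> C) (s : M -> wl).
Hypotheses (su : csmooth a u) (ss : wsmooth s).
Hypothesis ds : forall x, dom a x -> fedd s x = - (cpd a i u x *: wone).

(** The derivative of [s] is a multiple of the unit, which is central, so the commutative power rule
    holds. For [m = 0] the value of [m.-1] is harmless, the coefficient being 0. *)
Lemma fedd_wpow m x : dom a x -> fedd (fun z => wpow (P z) (s z) m) x =
  - ((m%:R * cpd a i u x) *: wpow (P x) (s x) m.-1).
Proof.
move=> dx; elim: m => [|m IH]; first by rewrite fedd_wone mul0r scale0r oppr0.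
rewrite (fedd_circ ss (wsmooth_wpow m ss) dx) (ds dx) IH -scaleN1r circZl circZl circ1l.
have -> : circ (P x) (s x) (- ((m%:R * cpd a i u x) *: wpow (P x) (s x) m.-1)) =
    - ((m%:R * cpd a i u x) *: circ (P x) (s x) (wpow (P x) (s x) m.-1)).
  by rewrite -scaleNr -[RHS]scaleNr; apply: linearZ.
rewrite scaleN1r -opprD; congr (- _).
rewrite -[in RHS]natr1 mulrDl mul1r scalerDl addrC.
by congr (_ + _); case: m {IH} => [|m]; rewrite ?mul0r ?scale0r.
Qed.

(** The sum telescopes: differentiating the new power cancels the previous remainder, and
    differentiating [cexp] in front of it leaves the next one. *)
Lemma fedd_exp N x : dom a x ->
  fedd (fun z => cexp (u z) *: \sum_(m < N.+1) m`!%:R^-1 *: wpow (P z) (s z) m) x =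
  (cexp (u x) * cpd a i u x) *: (N`!%:R^-1 *: wpow (P x) (s x) N).
Proof.
move=> dx; have se := csmooth_cexp su.
have st m := wsmoothZ (csmooth_cst a (m`!%:R^-1 : C)) (wsmooth_wpow m ss).
have sS m : wsmooth (fun z => \sum_(l < m) (l`!%:R^-1 : C) *: wpow (P z) (s z) l).
  elim: m => [|m IH].
    by under eq_fun do rewrite big_ord0; move=> k J; apply: csmooth_cst.
  by under eq_fun do rewrite big_ord_recr; apply: (wsmoothD IH (st m)).
elim: N => [|N IH].
  under eq_fun do rewrite big_ord1 fact0 invr1 scale1r.
  rewrite (feddZ se wsmooth_wone dx) fedd_wone scaler0 addr0 (cpd_cexp i su dx).
  by rewrite fact0 invr1 scale1r.
under eq_fun do rewrite big_ord_recr scalerDr /=.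
rewrite (feddD (wsmoothZ se (sS N.+1)) (wsmoothZ se (st N.+1)) dx) IH.
rewrite (feddZ se (st N.+1) dx) (cpd_cexp i su dx).
rewrite (feddZ (csmooth_cst a _) (wsmooth_wpow N.+1 ss) dx) cpd_cst scale0r add0r.
rewrite (fedd_wpow _ dx) addrCA -[RHS]addr0; congr (_ + _).
rewrite !scalerN !scalerA; apply/eqP; rewrite subr_eq0; apply/eqP.
congr (_ *: _); rewrite factS natrM invfM.
have m0 : N.+1%:R != 0 :> C by rewrite pnatr_eq0.
by rewrite -!mulrA; congr (_ * _); rewrite [RHS]mulrCA !mulrA mulfVK // mulrC.
Qed.

End Exponential.

(** The commutator divided by lambda reads its product at order [k.+1], that is, in degree
    [2 k + misize J + 2]. Counting [gamma] as of degree at least 0, agreement up to that degree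
    suffices; the other terms reach at most one degree up. *)
Lemma fedd_local s t x k J : dom a x ->
  (forall z k' J', dom a z -> (2 * k' + misize J' < 2 * k + misize J + 3)%N ->
     s z k' J' = t z k' J') ->
  fedd s x k J = fedd t x k J.
Proof.
move=> dx st; rewrite /fedd !wlD !wlN !ysD; congr (_ + - _).
  rewrite /whder /hder !ysD; congr (_ + _).
    by rewrite !cpdyE; apply: cpd_eq dx => z dz; apply: st => //; lia.
  have st' J' : (misize J' <= (misize J).+1)%N -> s x k J' = t x k J'.
    by move=> sJ; apply: st => //; lia.
  rewrite /vert !ysD; congr (- _ - _).
    rewrite !fct_sumE; apply: eq_bigr => j _; rewrite !fct_sumE; apply: eq_bigr => l _.
    rewrite !ysZ /ymono; congr (_ * _); case: ifP => // Jj; rewrite !yderE st' //.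
    have := misubKx Jj => /(congr1 (@misize n)).
    by rewrite !misize_add !misize_midx; lia.
  by rewrite !yderE st' // misize_add misize_midx addn1.
apply/eqP; rewrite -subr_eq0; apply/eqP.
pose d : wl := s x - t x; set g := gam F a x i.
have vd : wvanish (2 * k.+1 + misize J).+1 d.
  move=> k' J' h; rewrite /d wlD wlN ysD; apply/eqP; rewrite subr_eq0; apply/eqP.
  by apply: st => //; lia.
have e : wcomm (P x) g (s x) - wcomm (P x) g (t x) = wcomm (P x) g d.
  by apply/esym; apply: linearB.
have := congr1 (fun v : wl => v k J) e; rewrite wlD wlN ysD => ->; rewrite /wcomm.
have vg : wvanish 0 g by [].
have := @wvanish_circ _ _ (P x) _ _ _ _ vg vd k.+1 J.
have := @wvanish_circ _ _ (P x) _ _ _ _ vd vg k.+1 J.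
by rewrite add0n addn0 => -> // -> //; rewrite subr0.
Qed.

End Derivation.

(** * Differential polynomials *)

Section DiffPoly.
Variables (R : realType) (n : nat) (M : manifold R n) (a : chart M).
Local Notation C := R[i].
Implicit Types (i : 'I_n) (J : mi n) (f : M -> C) (V W : fseries M -> M -> C).

Lemma csmooth_foldr f s : csmooth a f -> csmooth a (foldr (cpd a) f s).
Proof. by move=> sf; elim: s => [|i s IH]; [apply: sf|apply: (csmooth_cpd i IH)]. Qed.

Lemma csmooth_cpdm J f : csmooth a f -> csmooth a (cpdm a J f).
Proof. exact: csmooth_foldr. Qed.

Lemma cpd_foldr i f s t x : csmooth a f -> dom a x ->
  foldr (cpd a) f (s ++ i :: t) x = foldr (cpd a) f (i :: s ++ t) x.
Proof.
move=> sf dx; elim: s x dx => [|j s IH] x dx //=.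
rewrite (cpd_eq j IH dx) /= (cpdC j i (csmooth_foldr (s ++ t) sf) dx).
by [].
Qed.

(** [cpdm] fixes the order of its derivatives; symmetry of second derivatives moves the new one into
    the block of its own index. *)
Lemma cpd_cpdm i J f x : csmooth a f -> dom a x ->
  cpd a i (cpdm a J f) x = cpdm a (miadd J (midx i)) f x.
Proof.
move=> sf dx; rewrite /cpdm.
have := enum_uniq 'I_n; have : i \in enum 'I_n by rewrite mem_enum.
case/splitPr => s t; rewrite cat_uniq /= => /and3P[_ /norP[is1 _] /andP[it1 _]].
have e r : i \notin r -> [seq nseq (miadd J (midx i) j) j | j <- r] =
    [seq nseq (J j) j | j <- r].
  move=> ir; apply/eq_in_map => j jr; rewrite !ffunE.
  by case: eqP => [ji|]; rewrite ?addn0 //; rewrite -ji jr in ir.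
rewrite !map_cat /= !flatten_cat /= !e // !ffunE eqxx addn1 /=.
by rewrite (cpd_foldr _ _ _ sf dx).
Qed.

Lemma cpdm0 f : cpdm a (mi0 n) f = f.
Proof.
rewrite /cpdm (_ : flatten _ = [::]) //; elim: (enum _) => //= i s ->.
by rewrite ffunE.
Qed.

(** The polynomial is chosen before [u]; this uniformity is what later makes the coefficients
    independent of [xi]. *)
Definition dpoly V := exists2 p : diffpoly M, diffpoly_smooth a p &
  forall u, smooth_series u -> forall x, dom a x -> V u x = diffpoly_eval a p u x.

Lemma dpoly_ext V W :
  (forall u, smooth_series u -> forall x, dom a x -> V u x = W u x) -> dpoly W -> dpoly V.
Proof. by move=> VW [p sp ep]; exists p => // u su x dx; rewrite VW // ep. Qed.

Lemma diffpoly_eval_nil u x : diffpoly_eval a [::] u x = 0.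
Proof. by rewrite /diffpoly_eval big_nil. Qed.

Lemma diffpoly_eval_cons t (p : diffpoly M) u x : diffpoly_eval a (t :: p) u x =
  t.1 x * \prod_(v <- t.2) cpdm a v.2 (u v.1) x + diffpoly_eval a p u x.
Proof. by rewrite /diffpoly_eval big_cons. Qed.

Lemma dpoly0 : dpoly (fun _ _ => 0).
Proof. by exists [::] => // u _ x _; rewrite diffpoly_eval_nil. Qed.

Lemma dpolyD V W : dpoly V -> dpoly W -> dpoly (fun u x => V u x + W u x).
Proof.
move=> [p sp ep] [q sq eq]; exists (p ++ q); last first.
  by move=> u su x dx; rewrite ep // eq // /diffpoly_eval big_cat.
by elim: p sp {ep} => //= t p IH [? /IH].
Qed.

Lemma dpoly_monomialM (t : (M -> C) * seq (nat * mi n)) W : csmooth a t.1 -> dpoly W ->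
  dpoly (fun u x => t.1 x * (\prod_(v <- t.2) cpdm a v.2 (u v.1) x) * W u x).
Proof.
move=> st [q sq eq].
exists [seq (fun x => t.1 x * s.1 x, t.2 ++ s.2) | s <- q].
  elim: q sq {eq} => [|s q IH] /= => [//|[ss /IH sq]].
    by split; [apply: (csmoothM st ss)|apply: sq].
move=> u su x dx; rewrite eq //; elim: q {sq eq} => /= [|s q IH].
  by rewrite !diffpoly_eval_nil mulr0.
by rewrite !diffpoly_eval_cons mulrDr IH big_cat /=; congr (_ + _); rewrite mulrACA.
Qed.

Lemma dpolyM V W : dpoly V -> dpoly W -> dpoly (fun u x => V u x * W u x).
Proof.
move=> [p sp ep] dW; apply: (@dpoly_ext _ (fun u x => diffpoly_eval a p u x * W u x)).
  by move=> u su x dx; rewrite ep.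
elim: p sp {ep} => [|t p IH] /= => [_|[st /IH dp]].
  by apply: dpoly_ext dpoly0 => u _ x _; rewrite diffpoly_eval_nil mul0r.
apply: dpoly_ext (dpolyD (dpoly_monomialM st dW) dp) => u _ x _.
by rewrite diffpoly_eval_cons mulrDl.
Qed.

Lemma dpoly_coef (c : M -> C) : csmooth a c -> dpoly (fun _ x => c x).
Proof.
exists [:: (c, [::])] => // u _ x _.
by rewrite diffpoly_eval_cons diffpoly_eval_nil big_nil mulr1 addr0.
Qed.

Lemma dpolyZ (c : C) V : dpoly V -> dpoly (fun u x => c * V u x).
Proof. exact: (dpolyM (dpoly_coef (csmooth_cst a c))). Qed.

Lemma dpolyB V W : dpoly V -> dpoly W -> dpoly (fun u x => V u x - W u x).
Proof.
move=> dV dW; apply: dpoly_ext (dpolyD dV (dpolyZ (-1) dW)) => u _ x _.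
by rewrite mulN1r.
Qed.

Lemma dpoly_var k J : dpoly (fun u x => cpdm a J (u k) x).
Proof.
exists [:: (fun=> 1, [:: (k, J)])]; first by split => //; apply: csmooth_cst.
move=> u _ x _.
by rewrite diffpoly_eval_cons diffpoly_eval_nil big_cons big_nil mulr1 addr0 mul1r.
Qed.

Lemma csmooth_monomial (s : seq (nat * mi n)) u : smooth_series u ->
  csmooth a (fun x => \prod_(v <- s) cpdm a v.2 (u v.1) x).
Proof.
move=> su; elim: s => [|v s IH].
  by under eq_fun do rewrite big_nil; apply: csmooth_cst.
under eq_fun do rewrite big_cons.
exact: (csmoothM (csmooth_cpdm v.2 (su v.1 a)) IH).
Qed.

Lemma csmooth_diffpoly (p : diffpoly M) u : diffpoly_smooth a p -> smooth_series u ->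
  csmooth a (diffpoly_eval a p u).
Proof.
move=> sp su; elim: p sp => [|t p IH] /= => [_|[st /IH sp]].
  by apply: csmooth_eq (csmooth_cst a 0) => x _; rewrite diffpoly_eval_nil.
apply: csmooth_eq (csmoothD (csmoothM st (csmooth_monomial t.2 su)) sp) => x _.
by rewrite diffpoly_eval_cons.
Qed.

Lemma dpoly_cpd_monomial i (s : seq (nat * mi n)) :
  dpoly (fun u => cpd a i (fun x => \prod_(v <- s) cpdm a v.2 (u v.1) x)).
Proof.
elim: s => [|[k J] s IH].
  apply: dpoly_ext dpoly0 => u _ x _.
  by under eq_fun do rewrite big_nil; rewrite cpd_cst.
have dm : dpoly (fun u x => \prod_(v <- s) cpdm a v.2 (u v.1) x).
  elim: {IH} s => [|v s IH].
    apply: dpoly_ext (dpoly_coef (csmooth_cst a 1)) => u _ x _.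
    by rewrite big_nil.
  apply: dpoly_ext (dpolyM (dpoly_var v.1 v.2) IH) => u _ x _.
  by rewrite big_cons.
apply: dpoly_ext (dpolyD (dpolyM (dpoly_var k (miadd J (midx i))) dm)
  (dpolyM (dpoly_var k J) IH)) => u su x dx.
under eq_fun do rewrite big_cons.
rewrite (cpdM i (csmooth_cpdm J (su k a)) (csmooth_monomial s su) dx).
by rewrite (cpd_cpdm _ _ (su k a) dx).
Qed.

Lemma dpoly_cpd i V : dpoly V -> dpoly (fun u => cpd a i (V u)).
Proof.
move=> [p sp ep]; apply: (@dpoly_ext _ (fun u => cpd a i (diffpoly_eval a p u))).
  by move=> u su x dx; apply: cpd_eq dx => y dy; apply: ep.
elim: p sp {ep} => [|t p IH] /= => [_|[st sp]].
  apply: dpoly_ext dpoly0 => u _ x dx; rewrite -(cpd_cst a 0 i x).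
  by apply: cpd_eq dx => y _; rewrite diffpoly_eval_nil.
have dm : dpoly (fun u x => \prod_(v <- t.2) cpdm a v.2 (u v.1) x).
  have d1 := dpoly_coef (csmooth_cst a 1).
  apply: dpoly_ext (@dpoly_monomialM (fun=> 1, t.2) _ (csmooth_cst a 1) d1) => u _ x _.
  by rewrite mul1r mulr1.
apply: dpoly_ext (dpolyD (dpolyD (dpolyM (dpoly_coef (csmooth_cpd i st)) dm)
  (dpolyM (dpoly_coef st) (dpoly_cpd_monomial i t.2))) (IH sp)) => u su x dx.
have sm := csmooth_monomial t.2 su.
rewrite -(cpdM i st sm dx) -(cpdD i (csmoothM st sm) (csmooth_diffpoly sp su) dx).
by apply: cpd_eq dx => y _; rewrite diffpoly_eval_cons.
Qed.

End DiffPoly.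

(** * Coefficients of the quantization map and of its powers *)

Section QuantizationPoly.
Variables (R : realType) (n : nat) (M : manifold R n) (w : symplectic_form M).
Variables (nabla : symplectic_connection w) (F : fedosov nabla).
Variables (Q : fseries M -> wfield M) (HQ : is_quantization_map F Q) (a : chart M).
Local Notation C := R[i].
Local Notation P := (poisson w a).

Lemma dpoly_sum (T : Type) (r : seq T) (Z : T -> fseries M -> M -> C) :
  (forall e, dpoly a (Z e)) -> dpoly a (fun u x => \sum_(e <- r) Z e u x).
Proof.
move=> h; pose Pr (v : fseries M * M -> C) := dpoly a (fun u x => v (u, x)).
apply: (@closed_sum R _ Pr (dpoly0 a) _ T r xpredT (fun e ux => Z e ux.1 ux.2)) => [v v'|e _].
  exact: dpolyD.
exact: h.
Qed.

(** [circ_closed] is applied over the pairs [(u, x)], so that a single polynomial results for all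
    [u]. *)
Lemma dpoly_circ (f g : fseries M -> M -> weyl R n) k J :
  (forall p q I K, (2 * p + misize I + (2 * q + misize K) = 2 * k + misize J)%N ->
     dpoly a (fun u x => f u x p I * g u x q K)) ->
  dpoly a (fun u x => circ (P x) (f u x) (g u x) k J).
Proof.
move=> h; pose Pr (v : fseries M * M -> C) := dpoly a (fun u x => v (u, x)).
apply: (@circ_closed R n _ Pr (fun ux => P ux.2) (dpoly0 a) _ _ _
   (fun ux => f ux.1 ux.2) (fun ux => g ux.1 ux.2)).
- by move=> v v'; apply: dpolyD.
- by move=> c v; apply: dpolyZ.
- by move=> s t v; apply: (dpolyM (dpoly_coef (csmooth_real (rsmooth_poisson w s t)))).
- exact: h.
Qed.

Lemma wsection_heval0 (s : wfield M) b x k : wsection s -> dom a x -> dom b x ->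
  s a x k (mi0 n) = s b x k (mi0 n).
Proof.
move=> [_ h] da db; have := h a b x da db k 0%N 0.
by rewrite !hevalE !yeval0.
Qed.

Lemma quantization_symbol u x k : smooth_series u -> dom a x ->
  Q u a x k (mi0 n) = u k x.
Proof.
move=> su dx; have [[sQ _] eQ] := HQ.1 u su.
rewrite (wsection_heval0 k sQ dx (dom_chart_at x)).
by have := congr1 (fun v : fseries M => v k x) eQ.
Qed.

(* The flatness equation expresses the derivative in [y] of [Q u] in a given
   degree through coefficients of lower degree. *)
Lemma quantization_dpoly k J : dpoly a (fun u x => Q u a x k J).
Proof.
suff main N : forall k J, (2 * k + misize J < N)%N -> dpoly a (fun u x => Q u a x k J).
  exact: (main (2 * k + misize J).+1).
elim: N => // N IH {}k {}J kJ.
have [->|J0] := eqVneq J (mi0 n).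
  apply: dpoly_ext (dpoly_var a k (mi0 n)) => u su x dx.
  by rewrite cpdm0 quantization_symbol.
have [i Ji] := mi_neq0 J0; have eJ := misubKx Ji.
set J' := misub J (midx i) in eJ.
have sJ : (misize J = (misize J').+1)%N by rewrite -eJ misize_add misize_midx addn1.
have IH' k' K : (2 * k' + misize K <= 2 * k + misize J')%N ->
    dpoly a (fun u x => Q u a x k' K).
  by move=> h; apply: IH; lia.
pose cov u x := covder nabla a i (Q u a) x k J'.
pose com u x := wcomm (P x) (gam F a x i) (Q u a x) k J'.
apply: (@dpoly_ext _ _ _ _ _ (fun u x => (J' i).+1%:R^-1 * (cov u x - com u x))).
  move=> u su x dx; have [[_ flatQ] _] := HQ.1 u su.
  have := flatQ a x i k J' dx; rewrite /fedD yderE eJ => /eqP.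
  rewrite -addrA addrC addr_eq0 opprK => /eqP ->.
  by rewrite mulrA mulVf ?mul1r // pnatr_eq0.
apply: dpolyZ; apply: dpolyB.
  apply: dpolyB; first exact: dpoly_cpd (IH' _ _ _).
  apply: dpoly_sum => j; apply: dpoly_sum => l; apply: dpolyM.
    by apply: dpoly_coef; apply: csmooth_real; apply: chr_smooth.
  case Jj : (J' j) => [|m]; first exact: dpoly0.
  apply: dpolyZ; apply: IH'; have Jj' : (0 < J' j)%N by rewrite Jj.
  have := misubKx Jj' => /(congr1 (@misize n)).
  by rewrite !misize_add !misize_midx; lia.
(* Division by lambda raises the total degree to [2 k + misize J' + 2], but a nonzero coefficient of
   [gamma] takes at least 3 of it. What is left for [Q u] is at most [2 k + misize J' - 1], within
   the induction hypothesis. *)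
have gQ p q I K : (2 * p + misize I + (2 * q + misize K) = 2 * k.+1 + misize J')%N ->
    dpoly a (fun u x => gam F a x i p I * Q u a x q K).
  move=> e; have [lt3|ge3] := ltnP (2 * p + misize I) 3.
    by apply: dpoly_ext (dpoly0 a) => u _ x dx; rewrite gam_deg // mul0r.
  apply: dpolyM; last by apply: IH'; lia.
  exact: (dpoly_coef ((gam_section F).1 a i p I)).
apply: dpolyB; apply: dpoly_circ => p q I K e; first exact: gQ.
have := gQ q p K I; rewrite addnC => /(_ e).
by apply: dpoly_ext => u _ x _; rewrite mulrC.
Qed.

(** Only the lambda-free coefficient of the symbol is removed: the higher ones have positive degree
    through lambda. *)
Definition nilpart (u : fseries M) (x : M) : weyl R n := Q u a x - u 0%N x *: wone.

Lemma nilpart_dpoly k J : dpoly a (fun u x => nilpart u x k J).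
Proof.
apply: dpolyB; first exact: quantization_dpoly.
apply: dpolyM; last exact: (dpoly_coef (csmooth_cst a _)).
by apply: dpoly_ext (dpoly_var a 0 (mi0 n)) => u _ x _; rewrite cpdm0.
Qed.

Lemma wpow_dpoly m k J : dpoly a (fun u x => wpow (P x) (nilpart u x) m k J).
Proof.
elim: m k J => [|m IH] k J; first exact: (dpoly_coef (csmooth_cst a _)).
apply: dpoly_circ => p q I K _; apply: dpolyM; [exact: nilpart_dpoly|exact: IH].
Qed.

Definition exppart N (u : fseries M) (x : M) : weyl R n :=
  \sum_(m < N) m`!%:R^-1 *: wpow (P x) (nilpart u x) m.

Lemma exppart_dpoly N k J : dpoly a (fun u x => exppart N u x k J).
Proof.
apply: (@dpoly_ext _ _ _ _ _ (fun u x => \sum_(m < N)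
    m`!%:R^-1 * wpow (P x) (nilpart u x) m k J)).
  by move=> u _ x _; rewrite /exppart !fct_sumE.
by apply: dpoly_sum => m; apply: dpolyZ; apply: wpow_dpoly.
Qed.

Lemma wvanish_nilpart u x : smooth_series u -> dom a x -> wvanish 1 (nilpart u x).
Proof.
move=> su dx [|k] J; last by rewrite mulnS.
rewrite muln0 add0n ltnS leqn0 misize_eq0 => /eqP ->.
have -> : nilpart u x 0%N (mi0 n) = Q u a x 0%N (mi0 n) - u 0%N x * wone 0%N (mi0 n) by [].
by rewrite quantization_symbol // /wone !eqxx mulr1 subrr.
Qed.

Lemma exppart_stable N N' u x k J : smooth_series u -> dom a x ->
  (2 * k + misize J < N)%N -> (N <= N')%N -> exppart N' u x k J = exppart N u x k J.
Proof.
move=> su dx kN; elim: N' => [|N' IH]; first by rewrite leqn0 => /eqP <-.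
rewrite leq_eqVlt => /orP[/eqP -> //|NN']; rewrite -IH // /exppart big_ord_recr /= wlD ysD.
rewrite wlZ ysZ (wvanish_pow (P x) (m := N') (wvanish_nilpart su dx)) ?mulr0 ?addr0 //.
exact: leq_trans kN NN'.
Qed.

End QuantizationPoly.

(** * The complex exponential series *)

Section ComplexNorm.
Variable R : realType.
Local Notation C := R[i].
Local Notation Re := complex.Re.
Local Notation Im := complex.Im.
Local Notation normc := ComplexField.Normc.normc.
Implicit Types z u v : C.

Lemma normc_ge0 z : 0 <= normc z.
Proof. by case: z => x y; apply: sqrtr_ge0. Qed.

Lemma normr_Re z : `|Re z| <= normc z.
Proof.
case: z => x y /=; rewrite -sqrtr_sqr ler_wsqrtr // lerDl; exact: sqr_ge0.
Qed.

Lemma normr_Im z : `|Im z| <= normc z.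
Proof.
case: z => x y /=; rewrite -sqrtr_sqr ler_wsqrtr // lerDr; exact: sqr_ge0.
Qed.

Lemma normcD u v : normc (u + v) <= normc u + normc v.
Proof. exact: (@le_normcD R). Qed.

Lemma normc_opp z : normc (- z) = normc z.
Proof. exact: (@complex.normcN R). Qed.

Lemma normc_le z : normc z <= `|Re z| + `|Im z|.
Proof.
case: z => x y /=; rewrite -[leRHS]ger0_norm ?addr_ge0 // -sqrtr_sqr ler_wsqrtr //.
rewrite sqrrD !real_normK ?num_real // addrAC lerDl.
by rewrite mulrn_wge0 // mulr_ge0.
Qed.

Lemma normcM u v : normc (u * v) = normc u * normc v.
Proof. exact: ComplexField.Normc.normcM. Qed.

Lemma normcR (x : R) : normc x%:C = `|x|.
Proof. by rewrite /= expr0n addr0 sqrtr_sqr. Qed.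

Lemma normcX z k : normc (z ^+ k) = normc z ^+ k.
Proof.
by elim: k => [|k IH]; rewrite ?expr0 ?ComplexField.Normc.normc1 // !exprS normcM IH.
Qed.

Lemma natrC k : (k%:R : C) = (k%:R : R)%:C.
Proof. by rewrite rmorph_nat. Qed.

Lemma normcV_nat k : normc (k%:R^-1 : C) = k%:R^-1.
Proof. by rewrite natrC -fmorphV normcR ger0_norm // invr_ge0. Qed.

Lemma normc_sum (T : Type) (s : seq T) (Q : pred T) (F : T -> C) :
  normc (\sum_(i <- s | Q i) F i) <= \sum_(i <- s | Q i) normc (F i).
Proof.
elim: s => [|i s IH]; first by rewrite !big_nil ComplexField.Normc.normc0.
rewrite !big_cons; case: (Q i) => //.
by apply: le_trans (normcD _ _) _; rewrite lerD2l.
Qed.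

Lemma normc_cexp z : normc (cexp z) = expR (Re z).
Proof.
rewrite /cexp /= !exprMn -mulrDr cos2Dsin2 mulr1 sqrtr_sqr ger0_norm //.

Qed.

Lemma cexpD u v : cexp (u + v) = cexp u * cexp v.
Proof.
case: u v => [a b] [c d]; apply: complex_ext; rewrite ?cReM ?cImM /= expRD.
  by rewrite cosD; ring.
by rewrite sinD; ring.
Qed.

Lemma cexp0 : cexp (0 : C) = 1.
Proof. by apply: complex_ext; rewrite /= expR0 ?cos0 ?sin0 mul1r. Qed.

(** Componentwise, because the mean value theorem will be applied to the real and the imaginary part
    separately. *)
Definition is_cderive (t : R) (f : R -> C) (l : C) :=
  is_derive t 1 (fun s => Re (f s)) (Re l) /\ is_derive t 1 (fun s => Im (f s)) (Im l).

Lemma is_cderive_cst t c : is_cderive t (fun=> c) 0.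
Proof. by split; apply: is_derive_cst. Qed.

Lemma is_cderiveD t f g l m : is_cderive t f l -> is_cderive t g m ->
  is_cderive t (fun s => f s + g s) (l + m).
Proof.
move=> [f1 f2] [g1 g2]; split.
  by rewrite cReD; under eq_fun do rewrite cReD; apply: is_deriveD.
by rewrite cImD; under eq_fun do rewrite cImD; apply: is_deriveD.
Qed.

Lemma is_cderiveM t f g l m : is_cderive t f l -> is_cderive t g m ->
  is_cderive t (fun s => f s * g s) (l * g t + f t * m).
Proof.
move=> [f1 f2] [g1 g2]; split.
  rewrite (_ : (fun s => Re (f s * g s)) =
    (fun s => Re (f s)) * (fun s => Re (g s)) - (fun s => Im (f s)) * (fun s => Im (g s))).
    apply: (is_derive_eq (is_deriveB (is_deriveM f1 g1) (is_deriveM f2 g2))).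
    rewrite cReD (cReM l) (cReM _ m).
    change (Re (f t) * Re m + Re (g t) * Re l - (Im (f t) * Im m + Im (g t) * Im l) =
      Re l * Re (g t) - Im l * Im (g t) + (Re (f t) * Re m - Im (f t) * Im m)).
    by ring.
  by apply/funext => s; rewrite cReM.
rewrite (_ : (fun s => Im (f s * g s)) =
  (fun s => Re (f s)) * (fun s => Im (g s)) + (fun s => Im (f s)) * (fun s => Re (g s))).
  apply: (is_derive_eq (is_deriveD (is_deriveM f1 g2) (is_deriveM f2 g1))).
  rewrite cImD (cImM l) (cImM _ m).
  change (Re (f t) * Im m + Im (g t) * Re l + (Im (f t) * Re m + Re (g t) * Im l) =
    Re l * Im (g t) + Im l * Re (g t) + (Re (f t) * Im m + Im (f t) * Re m)).
  by ring.
by apply/funext => s; rewrite cImM.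
Qed.

Lemma is_cderive_line t z : is_cderive t (fun s => s%:C * z) z.
Proof.
have e (c : R) : is_derive t 1 (fun s : R => s * c) c.
  have := is_deriveM (is_derive_id t 1) (is_derive_cst c t 1).
  by rewrite scaler0 add0r [_ *: _]mulr1.
split.
  rewrite (_ : (fun s => _) = fun s : R => s * Re z); first exact: e.
  by apply/funext => s; rewrite cReM /= mul0r subr0.
rewrite (_ : (fun s => _) = fun s : R => s * Im z); first exact: e.
by apply/funext => s; rewrite cImM /= mul0r addr0.
Qed.

Lemma is_cderive_cexp t f l : is_cderive t f l ->
  is_cderive t (fun s => cexp (f s)) (l * cexp (f t)).
Proof.
move=> [f1 f2].
have e1 : is_derive t 1 (fun s => expR (Re (f s))) (expR (Re (f t)) * Re l).
  exact: is_derive1_comp.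
have c2 : is_derive t 1 (fun s => cos (Im (f s))) (- sin (Im (f t)) * Im l).
  exact: is_derive1_comp.
have s2 : is_derive t 1 (fun s => sin (Im (f s))) (cos (Im (f t)) * Im l).
  exact: is_derive1_comp.
split.
  have := is_deriveM e1 c2; rewrite cReM /= /GRing.scale /= => h.
  by apply: is_derive_eq h _; ring.
have := is_deriveM e1 s2; rewrite cImM /= /GRing.scale /= => h.
by apply: is_derive_eq h _; ring.
Qed.

Definition cexp_sum z N : C := \sum_(k < N) k`!%:R^-1 * z ^+ k.

Lemma is_cderive_power t z k :
  is_cderive t (fun s => (s%:C * z) ^+ k.+1) (k.+1%:R * z * (t%:C * z) ^+ k).
Proof.
elim: k => [|k IH].
  by under eq_fun do rewrite expr1; rewrite mul1r expr0 mulr1; apply: is_cderive_line.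
under eq_fun do rewrite exprS.
have := is_cderiveM (is_cderive_line t z) IH; congr is_cderive.
by rewrite -[k.+2%:R]natr1 exprS; set X := t%:C * z; set m : C := k.+1%:R; ring.
Qed.

Lemma is_cderive_cexp_sum t z N :
  is_cderive t (fun s => cexp_sum (s%:C * z) N.+1) (z * cexp_sum (t%:C * z) N).
Proof.
elim: N => [|N IH].
  rewrite /cexp_sum big_ord0 mulr0; under eq_fun do rewrite big_ord1 expr0.
  exact: is_cderive_cst.
rewrite /cexp_sum; under eq_fun do rewrite big_ord_recr /=.
have := is_cderiveD IH (is_cderiveM (is_cderive_cst t N.+1`!%:R^-1) (is_cderive_power t z N)).
congr is_cderive; rewrite mul0r add0r big_ord_recr /= mulrDr; congr (_ + _).
have N0 : N.+1%:R != 0 :> C by rewrite pnatr_eq0.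
have f0 : N`!%:R != 0 :> C by rewrite pnatr_eq0 -lt0n fact_gt0.
by rewrite factS natrM; field; rewrite f0 addrC natr1 N0.
Qed.

Lemma MVT_unit_bound (h h' : R -> R) B : (forall t : R, is_derive t 1 h (h' t)) ->
  (forall t, 0 <= t <= 1 -> `|h' t| <= B) -> `|h 1 - h 0| <= B.
Proof.
move=> dh hB; have [c] : exists2 c, c \in `]0, 1[%R & h 1 - h 0 = h' c * (1 - 0).
  apply: (@MVT _ h h' 0 1 ltr01 (fun t _ => dh t)).
  by apply: derivable_within_continuous => t _; have [] := dh t.
rewrite in_itv /= => /andP[/ltW c0 /ltW c1] ->; rewrite subr0 mulr1.
by apply: hB; rewrite c0.
Qed.

(* The derivative of [t |-> exp(-tz) E_(N+1)(tz)], with [E_(N+1)] the partial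
   sum of the exponential series, is minus the last term times [z exp(-tz)]. *)
Lemma cexp_sum_bound z N B : normc z <= B ->
  normc (cexp_sum z N.+1 - cexp z) <= 2 * B * expR B * expR B * exp_coeff B N.
Proof.
move=> zB; have B0 : 0 <= B := le_trans (normc_ge0 z) zB.
pose h (t : R) := cexp (- (t%:C * z)) * cexp_sum (t%:C * z) N.+1.
pose h' (t : R) : C := - (cexp (- (t%:C * z)) * z * (N`!%:R^-1 * (t%:C * z) ^+ N)).
have dh t : is_cderive t h (h' t).
  have dN : is_cderive t (fun s => - (s%:C * z)) (- z).
    have := is_cderive_line t (- z); congr is_cderive.
    by apply/funext => s; rewrite mulrN.
  have := is_cderiveM (is_cderive_cexp dN) (is_cderive_cexp_sum t z N).
  congr is_cderive; rewrite /h' {1}/cexp_sum big_ord_recr /= -/(cexp_sum _ N).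
  by ring.
have hB t : 0 <= t <= 1 -> normc (h' t) <= B * expR B * exp_coeff B N.
  move=> /andP[t0 t1]; rewrite /h' normc_opp !normcM normc_cexp normcV_nat normcX.
  have tz : normc (t%:C * z) <= B.
    rewrite normcM normcR ger0_norm //; apply: le_trans zB.
    by rewrite ler_piMl // normc_ge0.
  rewrite [B * _]mulrC; apply: ler_pM.
  - by rewrite mulr_ge0 ?expR_ge0 ?normc_ge0.
  - by rewrite mulr_ge0 ?invr_ge0 ?exprn_ge0 ?normcM ?mulr_ge0 ?normc_ge0.
  - apply: ler_pM => //; rewrite ?expR_ge0 ?normc_ge0 // ler_expR.
    by apply: le_trans (ler_norm _) _; apply: le_trans (normr_Re _) _;
       rewrite normc_opp.
  rewrite /exp_coeff /= mulrC ler_wpM2r ?invr_ge0 //.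
  by rewrite lerXn2r ?nnegrE ?normc_ge0.
have h0 : h 0 = 1.
  rewrite /h mul0r oppr0 cexp0 mul1r /cexp_sum big_ord_recl big1 ?addr0.
    by rewrite expr0 mulr1 fact0 invr1.
  by move=> k _; rewrite expr0n /= mulr0.
(* Multiplying back by [cexp z] accounts for the second [expR B] in the bound; the 2 adds up the
   estimates of the real and the imaginary part. *)
have e : cexp_sum z N.+1 - cexp z = cexp z * (h 1 - h 0).
  by rewrite h0 /h mul1r mulrBr mulrA -cexpD subrr cexp0 mul1r mulr1.
rewrite e normcM normc_cexp.
have b1 : `|Re (h 1) - Re (h 0)| <= B * expR B * exp_coeff B N.
  apply: (MVT_unit_bound (fun t => (dh t).1)) => t /hB; apply: le_trans.
  exact: normr_Re.
have b2 : `|Im (h 1) - Im (h 0)| <= B * expR B * exp_coeff B N.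
  apply: (MVT_unit_bound (fun t => (dh t).2)) => t /hB; apply: le_trans.
  exact: normr_Im.
have b : normc (h 1 - h 0) <= 2 * (B * expR B * exp_coeff B N).
  apply: le_trans (normc_le _) _; rewrite mulr2n mulrDl mul1r; apply: lerD.
    by apply: le_trans b1; rewrite cReD; case: (h 0) => x y /=.
  by apply: le_trans b2; rewrite cImD; case: (h 0) => x y /=.
have -> : 2 * B * expR B * expR B * exp_coeff B N =
  expR B * (2 * (B * expR B * exp_coeff B N)) by ring.
apply: ler_pM => //; rewrite ?expR_ge0 ?normc_ge0 // ler_expR.
by apply: le_trans (ler_norm _) _; apply: le_trans (normr_Re _) _.
Qed.

Lemma cexp_sum_unif B e : 0 < e -> exists N, forall k z, (N <= k)%N -> normc z <= B ->
  normc (cexp_sum z k - cexp z) < e.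
Proof.
move=> e0; have [B0|B0] := ltP B 0.
  exists 0%N => k z _ zB; have := le_lt_trans zB B0.
  by rewrite ltNge normc_ge0.
(* The constant of [cexp_sum_bound], increased by 1 to stay positive when [B = 0]. *)
pose c := 2 * B * expR B * expR B + 1.
have c0 : 0 < c by rewrite ltr_wpDl // !mulr_ge0 ?expR_ge0.
have := cvg_series_cvg_0 (is_cvg_series_exp_coeff B).
move=> /cvgrPdist_lt /(_ (e / c)); rewrite divr_gt0 // => /(_ isT) [N _ hN].
exists N.+1 => -[//|k] z Nk zB; apply: le_lt_trans (cexp_sum_bound k zB) _.
have := hN k Nk; rewrite /= sub0r normrN ltr_pdivlMr // => h.
apply: le_lt_trans h; rewrite ger0_norm; last first.
  by rewrite /exp_coeff /= mulr_ge0 ?invr_ge0 ?exprn_ge0.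
rewrite mulrC ler_wpM2l ?lerDl // /exp_coeff /= mulr_ge0 ?invr_ge0 ?exprn_ge0 //.
Qed.

Lemma sum_exp_coeff_le (B : R) N : 0 <= B -> \sum_(k < N) k`!%:R^-1 * B ^+ k <= expR B.
Proof.
move=> B0; have e : \sum_(k < N) k`!%:R^-1 * B ^+ k = series (exp_coeff B) N.
  rewrite /series /= big_mkord; apply: eq_bigr => k _.
  by rewrite /exp_coeff /= mulrC.
rewrite e /expR; apply: nondecreasing_cvgn_le; last exact: is_cvg_series_exp_coeff.
apply: nondecreasing_series => k _ _.
by rewrite /exp_coeff /= mulr_ge0 ?invr_ge0 ?exprn_ge0.
Qed.

End ComplexNorm.

(** * The exponential of a flat section *)

Section UniformConvergence.
Variables (R : realType) (n : nat) (M : manifold R n).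
Local Notation C := R[i].
Local Notation Re := complex.Re.
Local Notation Im := complex.Im.
Local Notation normc := ComplexField.Normc.normc.
Implicit Types (K : set M) (x : M).

Lemma uniform_cvg_seq K (f : nat -> M -> R) (l : M -> R) :
  (forall e, 0 < e -> exists N, forall k x, (N <= k)%N -> K x -> `|l x - f k x| < e) ->
  {uniform K, f @ \oo --> l}.
Proof.
move=> h P /uniform_nbhs[E [entE EP]].
move: entE; rewrite -entourage_ballE => -[e /= e0 eE].
have [N hN] := h e e0; exists N => // k Nk; apply: EP => x Kx; apply: eE.
by rewrite /= -ball_normE; apply: hN.
Qed.

Lemma csmooth_bounded a K (f : M -> C) : csmooth a f -> compact K -> K `<=` dom a ->
  exists2 B, 0 <= B & forall x, K x -> normc (f x) <= B.
Proof.
move=> [f1 f2] cK Kd.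
have bnd (g : M -> R) : rsmooth a g -> exists B, forall x, K x -> `|g x| <= B.
  move=> sg; have cg : {within K, continuous g}.
    apply: continuous_in_subspaceT => x; rewrite inE => Kx.
    by apply: rsmooth_continuous sg _; apply: Kd.
  have [B [_ hB]] := compact_bounded (continuous_compact cg cK).
  exists (B + 1) => x Kx; apply: (hB (B + 1)); first by rewrite ltrDl.
  by exists x.
have [B1 h1] := bnd _ f1; have [B2 h2] := bnd _ f2.
exists (Num.max 0 (B1 + B2)); first by rewrite le_max lexx.
move=> x Kx; apply: le_trans (normc_le _) _; rewrite le_max; apply/orP; right.
by apply: lerD; [apply: h1|apply: h2].
Qed.

Lemma cexp_sum_shift (z : C) l N :
  \sum_(m < N) (if (l <= m)%N then (m - l)`!%:R^-1 * z ^+ (m - l) else 0) =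
  cexp_sum z (N - l).
Proof.
elim: N => [|N IH]; first by rewrite sub0n /cexp_sum !big_ord0.
rewrite big_ord_recr /= IH; case: leqP => lN.
  by rewrite subSn // /cexp_sum big_ord_recr.
have [/eqP e /eqP e'] : (N - l == 0)%N /\ (N.+1 - l == 0)%N by rewrite !subn_eq0 ltnW.
by rewrite addr0 e e'.
Qed.

(** [f] is the Cauchy product of the exponential series of [u] with a finite sequence [c]; in the
    application [c l] is a coefficient of [a'^l / l!]. Partial sums are thus finite combinations of
    shifted exponential partial sums. *)
Lemma abs_unif_cvg_cexp K (u : M -> C) L (c : nat -> M -> C) (B : R) (D : nat -> R)
    (f : nat -> M -> C) (S : M -> C) :
  (forall x, K x -> normc (u x) <= B) ->
  (forall l, 0 <= D l) -> (forall l x, K x -> normc (c l x) <= D l) ->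
  (forall m x, K x -> f m x = \sum_(l < L)
     (if (l <= m)%N then (m - l)`!%:R^-1 * u x ^+ (m - l) else 0) * c l x) ->
  (forall x, K x -> S x = cexp (u x) * \sum_(l < L) c l x) ->
  abs_unif_cvg K f S.
Proof.
move=> uB D0 cD fE SE.
have sumE N x : K x -> \sum_(m < N) f m x = \sum_(l < L) cexp_sum (u x) (N - l) * c l x.
  move=> Kx; under eq_bigr do rewrite fE //.
  rewrite exchange_big; apply: eq_bigr => l _ /=.
  by rewrite -mulr_suml cexp_sum_shift.
have unif e : 0 < e -> exists N, forall k x, (N <= k)%N -> K x ->
    normc (S x - \sum_(m < k) f m x) < e.
  move=> e0; pose A := \sum_(l < L) D l + 1.
  have A0 : 0 < A by rewrite ltr_wpDl // sumr_ge0.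
  have [N hN] := cexp_sum_unif B (divr_gt0 e0 A0).
  (* The margin [L] keeps [k - l] above [N] for every shift [l < L]. *)
  exists (N + L)%N => k x Nk Kx; rewrite SE // sumE // mulr_sumr -sumrB.
  apply: le_lt_trans (normc_sum _ _ _) _.
  apply: (@le_lt_trans _ _ (\sum_(l < L) e / A * D l)).
    apply: ler_sum => l _; rewrite -mulrBl normcM; apply: ler_pM; rewrite ?normc_ge0 ?cD //.
    rewrite -normc_opp opprB; apply/ltW/hN; last exact: uB.
    by rewrite leq_subRL; [rewrite (leq_trans _ Nk) // addnC leq_add2l ltnW|
      rewrite (leq_trans _ Nk) // (leq_trans (ltnW (ltn_ord l))) // leq_addl].
  rewrite -mulr_sumr mulrAC ltr_pdivrMr // ltr_pM2l //.
  by rewrite ltrDl.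
split.
(* The series of norms is dominated by the same Cauchy product with norms inside, hence by a finite
   multiple of the real exponential. *)
- move=> x Kx; apply: nondecreasing_is_cvgn.
    by apply: nondecreasing_series => k _ _; apply: normc_ge0.
  exists (\sum_(l < L) normc (c l x) * expR (normc (u x))) => _ [N _ <-].
  rewrite /series /= big_mkord.
  apply: (@le_trans _ _ (\sum_(m < N) \sum_(l < L)
     (if (l <= m)%N then (m - l)`!%:R^-1 * normc (u x) ^+ (m - l) else 0) * normc (c l x))).
    apply: ler_sum => m _; rewrite fE //; apply: le_trans (normc_sum _ _ _) _.
    apply: ler_sum => l _; rewrite normcM; case: leqP => _.
      by rewrite normcM normcV_nat normcX.
    by rewrite ComplexField.Normc.normc0.
  rewrite exchange_big; apply: ler_sum => l _ /=.
  rewrite -mulr_suml mulrC ler_wpM2l ?normc_ge0 //.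
  have -> : \sum_(m < N) (if (l <= m)%N then (m - l)`!%:R^-1 * normc (u x) ^+ (m - l) else 0)
     = \sum_(k < N - l) k`!%:R^-1 * normc (u x) ^+ k :> R.
    elim: N => [|N IH]; first by rewrite sub0n !big_ord0.
    rewrite big_ord_recr /= IH; case: leqP => lN; first by rewrite subSn // big_ord_recr.
    have [/eqP e /eqP e'] : (N - l == 0)%N /\ (N.+1 - l == 0)%N by rewrite !subn_eq0 ltnW.
    by rewrite addr0 e e' !big_ord0.
  by apply: sum_exp_coeff_le; apply: normc_ge0.
- apply: uniform_cvg_seq => e /unif[N hN]; exists N => k x Nk Kx.
  apply: le_lt_trans (hN k x Nk Kx); apply: le_trans (normr_Re _).
  by rewrite cReD; case: (\sum_(m < k) f m x).
- apply: uniform_cvg_seq => e /unif[N hN]; exists N => k x Nk Kx.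
  apply: le_lt_trans (hN k x Nk Kx); apply: le_trans (normr_Im _).
  by rewrite cImD; case: (\sum_(m < k) f m x).
Qed.

End UniformConvergence.

Lemma sum_truncate (A : nmodType) (G : nat -> A) m L :
  (forall l, (L <= l)%N -> (l < m)%N -> G l = 0) ->
  \sum_(l < m) G l = \sum_(l < L) if (l < m)%N then G l else 0.
Proof.
move=> G0; rewrite -big_mkcond (big_ord_widen_cond (m + L) (fun l => l < m)%N G) ?leq_addl //.
rewrite (big_ord_widen (m + L) G) ?leq_addr // big_mkcond [RHS]big_mkcond.
apply: eq_bigr => l _; case: ifP => //= lm; case: ltnP => // Ll.
exact: G0.
Qed.

Section Binomial.
Variables (R : realType) (n : nat) (P : 'M[R]_n).
Local Notation C := R[i].
Local Notation wl := (weyl R n).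

(** Multiples of the unit are central, so the binomial theorem holds for [circ]; the induction is
    Pascal's rule. *)
Lemma wpow_binomial (c : C) (b : wl) m : wpow P (c *: wone + b) m =
  \sum_(l < m.+1) ('C(m, l)%:R * c ^+ (m - l)) *: wpow P b l.
Proof.
elim: m => [|m IH]; first by rewrite big_ord1 bin0 expr0 mulr1 scale1r.
rewrite /wpow iterS -/(wpow P _ m) IH circDl circZl circ1l.
have -> : circ P b (\sum_(l < m.+1) ('C(m, l)%:R * c ^+ (m - l)) *: wpow P b l) =
    \sum_(l < m.+1) ('C(m, l)%:R * c ^+ (m - l)) *: wpow P b l.+1.
  by rewrite linear_sum; apply: eq_bigr => l _; rewrite linearZ.
rewrite [RHS]big_ord_recl bin0 mul1r subn0.
have -> : c *: (\sum_(l < m.+1) ('C(m, l)%:R * c ^+ (m - l)) *: wpow P b l) =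
    c ^+ m.+1 *: wpow P b 0 + \sum_(l < m.+1) ('C(m, l.+1)%:R * c ^+ (m - l)) *: wpow P b l.+1.
  rewrite scaler_sumr big_ord_recl bin0 mul1r subn0 scalerA -exprS; congr (_ + _).
  rewrite [RHS]big_ord_recr /= bin_small // mul0r scale0r addr0.
  apply: eq_bigr => l _; rewrite /bump leq0n add1n scalerA mulrCA -exprS.
  by rewrite subnSK.
rewrite -addrA; congr (_ + _); rewrite -big_split; apply: eq_bigr => l _ /=.
by rewrite /bump leq0n add1n subSS -scalerDl -mulrDl -natrD binS.
Qed.

End Binomial.

Section Exponential.
Variables (R : realType) (n : nat) (M : manifold R n) (w : symplectic_form M).
Variables (nabla : symplectic_connection w) (F : fedosov nabla).
Variables (Q : fseries M -> wfield M) (HQ : is_quantization_map F Q).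
Variables (u : fseries M) (su : smooth_series u).
Local Notation C := R[i].
Local Notation P := (poisson w).
Local Notation trans a b x := (jac a b (@id M) x).

(** Each coefficient gets its own number of terms, just enough for its degree, so the definition
    involves no limit. *)
Definition star_exp : wfield M := fun a x j I =>
  cexp (u 0%N x) * exppart w Q a (2 * j + misize I).+1 u x j I.

Lemma star_expE N a x j I : dom a x -> (2 * j + misize I < N)%N ->
  star_exp a x j I = (cexp (u 0%N x) *: exppart w Q a N u x) j I.
Proof. by move=> dx h; rewrite wlZ ysZ (exppart_stable HQ su dx _ h). Qed.

Lemma csmooth_dpoly a V : dpoly a V -> csmooth a (V u).
Proof.
by move=> [p sp ep]; apply: csmooth_eq (csmooth_diffpoly sp su) => x dx; rewrite ep.
Qed.

Lemma star_exp_cvg a (K : set M) : compact K -> K `<=` dom a -> forall I j,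
  abs_unif_cvg K (fun m x => m`!%:R^-1 * spow w (Q u) m a x j I)
    (fun x => star_exp a x j I).
Proof.
move=> cK Kd I j; pose L := (2 * j + misize I).+1.
pose c l x : C := l`!%:R^-1 * wpow (P a x) (nilpart Q a u x) l j I.
have sc l : csmooth a (c l).
  exact: (csmooth_dpoly (dpolyZ _ (wpow_dpoly HQ a l j I))).
have [B _ uB] := csmooth_bounded (su 0%N a) cK Kd.
have /choice[D hD] : forall l, exists D, 0 <= D /\
    forall x, K x -> ComplexField.Normc.normc (c l x) <= D.
  by move=> l; have [D D0 hD] := csmooth_bounded (sc l) cK Kd; exists D.
have c0 l x : K x -> (L <= l)%N -> c l x = 0.
  move=> /Kd dx Ll.
  by rewrite /c (wvanish_pow (P a x) (m := l) (wvanish_nilpart HQ su dx)) ?mulr0.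
apply: (abs_unif_cvg_cexp uB (fun l => (hD l).1) (fun l => (hD l).2)) => [m x Kx|x Kx];
  last first.
  rewrite /star_exp /exppart !fct_sumE; congr (_ * _); exact: eq_bigr.
have -> : spow w (Q u) m a x = wpow (P a x) (u 0%N x *: wone + nilpart Q a u x) m.
  by rewrite /spow /nilpart addrC subrK.
rewrite wpow_binomial !fct_sumE mulr_sumr.
(* Since ['C(m, l) / m!] equals [1 / ((m - l)! l!)], a binomial term separates into an exponential
   coefficient of [u 0%N x] and [c l x]. *)
pose G l : C := m`!%:R^-1 * (('C(m, l)%:R * u 0%N x ^+ (m - l)) *
   wpow (P a x) (nilpart Q a u x) l j I).
have GE l : (l <= m)%N -> G l = (m - l)`!%:R^-1 * u 0%N x ^+ (m - l) * c l x.
  move=> lm; rewrite /G /c -(bin_fact lm) !natrM.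
  have b0 : 'C(m, l)%:R != 0 :> C by rewrite pnatr_eq0 -lt0n bin_gt0.
  have l0 : l`!%:R != 0 :> C by rewrite pnatr_eq0 -lt0n fact_gt0.
  have ml0 : (m - l)`!%:R != 0 :> C by rewrite pnatr_eq0 -lt0n fact_gt0.
  by field; rewrite b0 l0 ml0.
transitivity (\sum_(l < m.+1) G l).
  by apply: eq_bigr => l _; rewrite wlZ ysZ.
(* The range [l <= m] becomes a range independent of [m], since powers from [L] on do not reach this
   coefficient. *)
rewrite (@sum_truncate _ G _ L) => [|l Ll lm]; last by rewrite GE // c0 // mulr0.
by apply: eq_bigr => l _; rewrite ltnS; case: leqP => [/GE|_]; rewrite ?mul0r.
Qed.

Lemma fedd_nilpart a x i : dom a x ->
  fedd a i F (nilpart Q a u) x = - (cpd a i (u 0%N) x *: wone).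
Proof.
move=> dx; have [[[sQ _] fQ] _] := HQ.1 u su.
have sQa : wsmooth a (Q u a) by move=> k J; apply: sQ.
have sN : csmooth a (fun z => -1 * u 0%N z) := csmoothM (csmooth_cst a _) (su 0%N a).
have -> : nilpart Q a u = fun z => Q u a z + (-1 * u 0%N z) *: wone.
  by apply/funext => z; rewrite /nilpart mulN1r scaleNr.
rewrite (feddD i F sQa (wsmoothZ sN (wsmooth_wone a)) dx).
rewrite (feddZ i F sN (wsmooth_wone a) dx) fedd_wone scaler0 addr0.
have -> : fedd a i F (Q u a) x = 0.
  by rewrite -fedDE; apply/funext => k; apply/funext => J; apply: fQ.
by rewrite add0r (cpdZ _ _ (su 0%N a) dx) mulN1r scaleNr.
Qed.

Lemma fedD_star_exp a x i k J : dom a x -> fedD F star_exp a x i k J = 0.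
Proof.
(* [N] exceeds every degree read by [fedd_local], so [star_exp] may be replaced by one partial sum;
   the remainder given by [fedd_exp] is a multiple of the [N]-th power, which vanishes in degree
   [2 k + misize J]. *)
move=> dx; rewrite fedDE; pose N := (2 * k + misize J + 3)%N.
have sn : wsmooth a (nilpart Q a u).
  by move=> k' J'; apply: (csmooth_dpoly (nilpart_dpoly HQ a k' J')).
rewrite (@fedd_local _ _ _ _ _ _ _ _ _
  (fun z => cexp (u 0%N z) *: exppart w Q a N.+1 u z) x k J dx); last first.
  by move=> z k' J' dz h; apply: star_expE => //; rewrite ltnS ltnW.
rewrite /exppart (fedd_exp (su 0%N a) sn (fun x => @fedd_nilpart a x i) N dx).
rewrite !wlZ !ysZ (wvanish_pow (P a x) (m := N) (wvanish_nilpart HQ su dx)) ?mulr0 //.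
by rewrite /N; lia.
Qed.

(** With [T] the Jacobian, [P_a T w_b T^T = 1]; a one-sided inverse of a square matrix is two-sided,
    so [T^T P_a T w_b = 1], and [P_b] inverts [w_b]. *)
Lemma poisson_trans a b x : dom a x -> dom b x ->
  P b x = (trans a b x)^T *m P a x *m trans a b x.
Proof.
move=> da db; have e := omega_trans w da db; set T := trans a b x in e *.
have /mulmx1C e1 : P a x *m T *m w b x *m T^T = 1%:M.
  by have := mulVmx (omega_nondeg w da); rewrite {2}e !mulmxA.
have wP : w b x *m P b x = 1%:M by apply: mulmxV; apply: omega_nondeg.
by rewrite -[LHS]mul1mx -e1 -!mulmxA wP mulmx1.
Qed.

Lemma yeval_local (f g : yseries R n) m v : (forall I, misize I = m -> f I = g I) ->
  yeval f m v = yeval g m v.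
Proof. by move=> fg; apply: eq_bigr => I /eqP /fg ->. Qed.

Lemma star_exp_trans a b x k m v : dom a x -> dom b x ->
  heval (star_exp a x) k m v = heval (star_exp b x) k m (v *m trans a b x).
Proof.
move=> da db; have [[sQ _] _] := HQ.1 u su.
have pn l : pulled (trans a b x) (nilpart Q a u x l) (nilpart Q b u x l).
  have nE c : nilpart Q c u x l = Q u c x l + (- u 0%N x) *: @wone R n l.
    by rewrite /nilpart wlD wlN wlZ scaleNr.
  have pQ : pulled (trans a b x) (Q u a x l) (Q u b x l).
    by apply/pulledP => p y; have := sQ.2 a b x da db l p y; rewrite !hevalE.
  rewrite !nE; exact: (pulledD pQ (pulledZ _ (pulled_wone _ l))).
(* Only coefficients at [lambda^k] of degree [m] in [y] enter, so one partial sum of this length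
   represents [star_exp] in both charts. *)
pose N := (2 * k + m).+1.
have pe : pulled (trans a b x) ((cexp (u 0%N x) *: exppart w Q a N u x) k)
    ((cexp (u 0%N x) *: exppart w Q b N u x) k).
  have eE c : exppart w Q c N u x k =
      \sum_(l < N) l`!%:R^-1 *: wpow (P c x) (nilpart Q c u x) l k.
    by rewrite /exppart fct_sumE.
  rewrite !wlZ !eE (poisson_trans da db).
  by apply/pulledZ/pulled_sum => l _; apply/pulledZ/pulled_wpow.
rewrite !hevalE.
have loc c : dom c x -> forall y, yeval (star_exp c x k) m y =
    yeval ((cexp (u 0%N x) *: exppart w Q c N u x) k) m y.
  by move=> dc y; apply: yeval_local => I Im; apply: star_expE; rewrite // /N Im.
by rewrite !loc //; move/pulledP: pe.
Qed.

Lemma star_exp_flat : flat F star_exp.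
Proof.
split; last by move=> a x i k J; apply: fedD_star_exp.
split=> [a k J|a b x da db k m v]; last exact: star_exp_trans.
apply: csmoothM; first exact: csmooth_cexp (su 0%N a).
exact: (csmooth_dpoly (exppart_dpoly HQ a _ k J)).
Qed.

End Exponential.

(** * The classical part of the moment map *)

Section ClassicalPart.
Variables (R : realType) (n d : nat) (M : manifold R n) (w : symplectic_form M).
Variables (G : lieGroup R d) (act : G -> M -> M).
Variable Cn : nat -> (M -> R[i]) -> (M -> R[i]) -> M -> R[i].
Variable Phi : uea G -> fseries M.

Lemma ucls_eq (s t : uterm R d) : ueq G s t -> ucls G s = ucls G t.
Proof. by move=> st; apply/eqP; rewrite eqmodE; apply/asboolP. Qed.

Lemma glam_split (xi : glam R d) :
  xi = gadd (gconst (xi 0%N)) (gscale (fun k => (k == 1%N)%:R) (fun k => xi k.+1)).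
Proof.
apply/funext => -[|k]; rewrite /gadd /gscale /=.
  by rewrite big_ord1 scale0r addr0.
rewrite add0r big_ord_recl scale0r add0r big_ord_recl big1 ?addr0 => [|p _].
  by rewrite scale1r subSS subn0.
by rewrite scale0r.
Qed.

(** By [glam_split], [xi] differs from its leading term by lambda times an element. [Phi] sends that
    multiple to a star product with the constant series lambda, which has no term of order zero. *)
Lemma quantum_moment_map_classical (xi : glam R d) :
  is_star_product w Cn -> quantum_moment_map act (star Cn) Phi ->
  Phi (uinc G xi) 0%N = Phi (uinc G (gconst (xi 0%N))) 0%N.
Proof.
move=> hs hq; apply/funext => x; rewrite {1}(glam_split xi) /uinc.
rewrite (ucls_eq (UE_genD _ _ _)) (qmm_add hq).
rewrite (ucls_eq (UE_genZ _ _ _)) (qmm_mul hq) (qmm_scal hq) /star !big_ord1 /=.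
by rewrite (star_C0 hs) mul0r mulr0 addr0.
Qed.

End ClassicalPart.

(** The polynomials are produced before the group, the moment map and [xi], which expresses that
    they depend on the Fedosov data alone. Coefficients of [y^I] are defined in a chart, hence the
    compact sets inside [dom a]; finitely many of these cover any compact set. *)
Theorem lemma3p1 (R : realType) (n : nat) (M : manifold R n)
    (w : symplectic_form M) (nabla : symplectic_connection w)
    (F : fedosov nabla) (Q : fseries M -> wfield M)
    (HQ : is_quantization_map F Q) :
  exists P : chart M -> mi n -> nat -> diffpoly M,
    (forall a I j, diffpoly_smooth a (P a I j)) /\
    forall (d : nat) (G : lieGroup R d) (act : G -> M -> M)
      (Cn : nat -> (M -> R[i]) -> (M -> R[i]) -> M -> R[i])
      (Phi : uea G -> fseries M),
      is_symplectic_action w act ->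
      is_star_product w Cn ->
      star_invariant act (star Cn) ->
      fedosov_type w Cn Q ->
      quantum_moment_map act (star Cn) Phi ->
      forall xi : glam R d,
      exists S : wfield M,
        [/\ forall a (K : set M), compact K -> K `<=` dom a ->
              forall I j,
              abs_unif_cvg K
                (fun m x => (m`!%:R)^-1 * spow w (Q (Phi (uinc G xi))) m a x j I)
                (fun x => S a x j I),
            flat F S &
            forall a x, dom a x -> forall I j,
              S a x j I =
              cexp (Phi (uinc G (gconst (xi 0%N))) 0%N x) *
              diffpoly_eval a (P a I j) (Phi (uinc G xi)) x].
Proof.
(* The number of terms is the one used in [star_exp] for the coefficient of [y^I lambda^j]. *)
have dE a I j := exppart_dpoly HQ a (2 * j + misize I).+1 j I.
exists (fun a I j => sval (cid2 (dE a I j))); split=> [a I j|].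
  by case: (cid2 (dE a I j)).
move=> d G act Cn Phi _ hs _ _ hq xi; have su := qmm_smooth hq (uinc G xi).
exists (star_exp w Q (Phi (uinc G xi))); split.
- by move=> a K cK Kd I j; apply: (star_exp_cvg HQ su cK Kd I j).
- exact: (star_exp_flat HQ su).
move=> a x dx I j; rewrite -(quantum_moment_map_classical xi hs hq).
by case: (cid2 (dE a I j)) => p sp /= ep; rewrite /star_exp ep.
Qed.
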